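(* Let $n>3$ be an odd number and let $T=\sum_{\ell=1}^{n}e_\ell T_\ell\in\mathcal{BC}^{0,1}(V_n)$ (so $T_0=0$) with $\sigma(T_\ell)\subset\mathbb R$ for all $\ell=1,\dots,n$. Let $\sigma_{\mathcal F}(T)=\sigma_{\mathcal F,1}(T)\cup\sigma_{\mathcal F,2}(T)$ with $$\operatorname{dist}\big(\sigma_{\mathcal F,1}(T),\sigma_{\mathcal F,2}(T)\big)>0 .$$ Let $G_1,G_2$ be two admissible sets for $T$ such that $\sigma_{\mathcal F,1}(T)\subset G_1$, $\overline{G_1}\subset G_2$ and $\operatorname{dist}\big(G_2,\sigma_{\mathcal F,2}(T)\big)>0$, and let $I\in\mathbb S$. Then the operator $$\check P=\frac{1}{2\pi\gamma_n}\int_{\partial(G_1\cap\mathbb C_I)}\mathcal F_n^L(p,T)\,dp_I\,p^{\,n-1}=\frac{1}{2\pi\gamma_n}\int_{\partial(G_2\cap\mathbb C_I)}s^{\,n-1}\,ds_I\,\mathcal F_n^R(s,T)$$ (where the two integrals coincide) is a projector, i.e. $\check P^2=\check P$.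
   Context: $\mathbb R_n$ is the real Clifford algebra generated by $e_1,\dots,e_n$ with $e_\ell^2=-1$ and $e_\ell e_m+e_me_\ell=0$ for $\ell\neq m$. A point $(x_0,\dots,x_n)\in\mathbb R^{n+1}$ is identified with the paravector $x=x_0+\sum_{j=1}^n x_je_j$; $|x|^2=\sum_{j=0}^n x_j^2$. $\mathbb S=\{\sum_{j=1}^n x_je_j:\sum_j x_j^2=1\}$; for $I\in\mathbb S$ one has $I^2=-1$ and $\mathbb C_I=\mathbb R+I\mathbb R$. On $\mathbb C_I$ put $ds_I=ds\,(-I)$ and $dp_I=dp\,(-I)$. $V$ is a real Banach space, $V_n=V\otimes\mathbb R_n$ is the associated two-sided Banach module over $\mathbb R_n$, and $\mathcal B(V_n)$ is the space of bounded right linear operators on $V_n$. Clifford numbers act on operators by $(aT)(v)=a\,T(v)$, $(Ta)(v)=T(av)$; products of operators are compositions. $\mathcal{BC}^{0,1}(V_n)$ is the set of paravector operators $T=T_0+\sum_{\ell=1}^n e_\ell T_\ell$ with pairwise commuting components $T_\ell\in\mathcal B(V)$ (acting componentwise on $V_n$). Put $\overline T=T_0-\sum_{\ell=1}^n e_\ell T_\ell$, so that $T+\overline T=2T_0$ and $T\overline T=\sum_{\ell=0}^nT_\ell^2$. $\sigma(T_\ell)$ is the usual spectrum of $T_\ell$. $\sigma_{\mathcal F}(T)$ is the set of $s\in\mathbb R^{n+1}$ such that $s^2\mathcal I-s(T+\overline T)+T\overline T$ is not invertible in $\mathcal B(V_n)$; $\rho_{\mathcal F}(T)=\mathbb R^{n+1}\setminus\sigma_{\mathcal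 F}(T)$. For $s\in\rho_{\mathcal F}(T)$ let $\mathcal Q_s(T)=(s^2\mathcal I-s(T+\overline T)+T\overline T)^{-1}$, $$\mathcal F_n^L(s,T)=\gamma_n(s\mathcal I-\overline T)\mathcal Q_s(T)^{\frac{n+1}2},\qquad \mathcal F_n^R(s,T)=\gamma_n\mathcal Q_s(T)^{\frac{n+1}2}(s\mathcal I-\overline T),$$ $$\gamma_n=(-1)^{\frac{n-1}2}2^{n-1}\Big[\Big(\tfrac{n-1}2\Big)!\Big]^2 .$$ An open set $U\subset\mathbb R^{n+1}$ is axially symmetric if $u+Iv\in U$ (with $u,v\in\mathbb R$, $I\in\mathbb S$) implies $u+Jv\in U$ for all $J\in\mathbb S$. A bounded slice Cauchy domain is a bounded axially symmetric open set $U$ such that for every $I\in\mathbb S$ the set $U\cap\mathbb C_I$ has finitely many components with pairwise disjoint closures and its boundary in $\mathbb C_I$ consists of finitely many disjoint closed piecewise continuously differentiable Jordan curves. An admissible set for $T$ is a bounded slice Cauchy domain $G$ whose boundary lies in $\rho_{\mathcal F}(T)$; $\partial(G\cap\mathbb C_I)$ carries the standard positive orientation. *)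

(* Defs.v *)
(* Real numbers, Banach spaces and integrals are those of Coquelicot; MathComp
   is used for finite index types only. *)
From Stdlib Require Import Reals Lra.
From Stdlib Require Import Classical ClassicalEpsilon.
From Stdlib Require Import FunctionalExtensionality ProofIrrelevance.
From HB Require Import structures.
From mathcomp Require Import all_boot.
From Coquelicot Require Import Coquelicot.

Set Implicit Arguments.
Unset Strict Implicit.
Unset Printing Implicit Defensive.

Local Open Scope R_scope.

HB.instance Definition _ (G : AbelianMonoid) :=
  Monoid.isComLaw.Build G zero plus (@plus_assoc G) (@plus_comm G) (@plus_zero_l G).

Lemma scal_bigl (V : ModuleSpace R_Ring) (J : finType) (c : R) (F : J -> V) :
  scal c (\big[plus/zero]_j F j) = \big[plus/zero]_j scal c (F j).
Proof.
apply: (big_morph (fun v => scal c v)).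
- exact: scal_distr_l.
- exact: scal_zero_r.
Qed.

Lemma sum_scal (V : ModuleSpace R_Ring) (J : finType) (F : J -> R) (v : V) :
  scal (\big[plus/zero]_j F j) v = \big[plus/zero]_j scal (F j) v.
Proof.
apply: (big_morph (fun c : R => scal c v)).
- by move=> x y; exact: (scal_distr_r (K := R_Ring)).
- exact: (scal_zero_l (K := R_Ring)).
Qed.

Lemma sum_mulr (J : finType) (F : J -> R) (c : R) :
  (\big[plus/zero]_j F j) * c = \big[plus/zero]_j (F j * c).
Proof. exact: (sum_scal (V := R_ModuleSpace)). Qed.

Lemma sum_ge0 (J : finType) (F : J -> R) :
  (forall j, 0 <= F j) -> 0 <= \big[plus/zero]_j F j.
Proof.
move=> F0; apply: (big_ind (fun r : R => 0 <= r)) => //.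
- exact: Rle_refl.
- by move=> x y; exact: Rplus_le_le_0_compat.
Qed.

Lemma sum_le (J : finType) (F G : J -> R) :
  (forall j, F j <= G j) -> \big[plus/zero]_j F j <= \big[plus/zero]_j G j.
Proof.
move=> FG; apply: (big_ind2 (fun x y : R => x <= y)) => //.
- exact: Rle_refl.
- by move=> x1 x2 y1 y2; exact: Rplus_le_compat.
Qed.

Lemma le_sum1 (J : finType) (F : J -> R) (i : J) :
  (forall j, 0 <= F j) -> F i <= \big[plus/zero]_j F j.
Proof.
move=> F0; rewrite (bigD1 i) //= big_mkcond /=.
have : 0 <= \big[plus/zero]_(j : J) (if j != i then F j else zero).
  by apply: sum_ge0 => j; case: (j != i) => //; exact: Rle_refl.
by move=> H; rewrite -{1}(Rplus_0_r (F i)); exact: Rplus_le_compat_l.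
Qed.

Lemma norm_sum_le (V : NormedModule R_AbsRing) (J : finType) (F : J -> V) :
  norm (\big[plus/zero]_j F j) <= \big[plus/zero]_j (norm (F j) : R).
Proof.
apply: (big_ind2 (fun (x : V) (y : R) => norm x <= y)).
- by rewrite norm_zero; exact: Rle_refl.
- move=> x1 x2 y1 y2 h1 h2; apply: Rle_trans (norm_triangle _ _) _.
  exact: Rplus_le_compat.
- by move=> j _; exact: Rle_refl.
Qed.

(* V_n = V (x) R_n: the element sum_A v_A (x) e_A is the family A |-> v_A,
   where e_A is the product of the e_i, i in A, in increasing order. The norm is
   sum_A |v_A|. *)

Definition Vn (V : NormedModule R_AbsRing) (n : nat) : Type := {set 'I_n} -> V.

Section VnNormed.
Variables (V : NormedModule R_AbsRing) (n : nat).
Implicit Types u v w : Vn V n.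

Definition Vn_plus u v : Vn V n := fun A => plus (u A) (v A).
Definition Vn_zero : Vn V n := fun _ => zero.
Definition Vn_opp u : Vn V n := fun A => opp (u A).
Definition Vn_scal (c : R) u : Vn V n := fun A => scal c (u A).
Definition Vn_ball u (e : R) v := forall A, ball (u A) e (v A).
Definition Vn_norm u : R := \big[plus/zero]_(A : {set 'I_n}) (norm (u A) : R).

Lemma Vn_plus_comm u v : Vn_plus u v = Vn_plus v u.
Proof. by apply: functional_extensionality => A; exact: plus_comm. Qed.
Lemma Vn_plus_assoc u v w : Vn_plus u (Vn_plus v w) = Vn_plus (Vn_plus u v) w.
Proof. by apply: functional_extensionality => A; exact: plus_assoc. Qed.
Lemma Vn_plus_zero u : Vn_plus u Vn_zero = u.
Proof. by apply: functional_extensionality => A; exact: plus_zero_r. Qed.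
Lemma Vn_plus_opp u : Vn_plus u (Vn_opp u) = Vn_zero.
Proof. by apply: functional_extensionality => A; exact: plus_opp_r. Qed.

Definition Vn_AbelianMonoid_mixin :=
  AbelianMonoid.Mixin _ _ _ Vn_plus_comm Vn_plus_assoc Vn_plus_zero.
Canonical Vn_AbelianMonoid :=
  AbelianMonoid.Pack (Vn V n) Vn_AbelianMonoid_mixin (Vn V n).
Definition Vn_AbelianGroup_mixin := AbelianGroup.Mixin Vn_AbelianMonoid _ Vn_plus_opp.
Canonical Vn_AbelianGroup :=
  AbelianGroup.Pack (Vn V n)
    (AbelianGroup.Class _ Vn_AbelianMonoid_mixin Vn_AbelianGroup_mixin) (Vn V n).

Lemma Vn_scal_assoc (x y : R) u : Vn_scal x (Vn_scal y u) = Vn_scal (x * y) u.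
Proof. by apply: functional_extensionality => A; exact: scal_assoc. Qed.
Lemma Vn_scal_one u : Vn_scal 1 u = u.
Proof. by apply: functional_extensionality => A; exact: scal_one. Qed.
Lemma Vn_scal_distr_l x u v :
  Vn_scal x (Vn_plus u v) = Vn_plus (Vn_scal x u) (Vn_scal x v).
Proof. by apply: functional_extensionality => A; exact: scal_distr_l. Qed.
Lemma Vn_scal_distr_r (x y : R) u :
  Vn_scal (x + y) u = Vn_plus (Vn_scal x u) (Vn_scal y u).
Proof. by apply: functional_extensionality => A; exact: scal_distr_r. Qed.

Definition Vn_ModuleSpace_mixin :=
  ModuleSpace.Mixin R_Ring Vn_AbelianGroup Vn_scal
    Vn_scal_assoc Vn_scal_one Vn_scal_distr_l Vn_scal_distr_r.
Canonical Vn_ModuleSpace :=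
  ModuleSpace.Pack R_Ring (Vn V n)
    (ModuleSpace.Class R_Ring _ _ Vn_ModuleSpace_mixin) (Vn V n).

Lemma Vn_ball_center u (e : posreal) : Vn_ball u e u.
Proof. by move=> A; exact: ball_center. Qed.
Lemma Vn_ball_sym u v (e : R) : Vn_ball u e v -> Vn_ball v e u.
Proof. by move=> h A; exact: ball_sym. Qed.
Lemma Vn_ball_triangle u v w (e1 e2 : R) :
  Vn_ball u e1 v -> Vn_ball v e2 w -> Vn_ball u (e1 + e2) w.
Proof. by move=> h1 h2 A; apply: ball_triangle (h1 A) (h2 A). Qed.

Definition Vn_UniformSpace_mixin :=
  UniformSpace.Mixin _ (@zero Vn_AbelianMonoid) Vn_ball Vn_ball_center Vn_ball_sym Vn_ball_triangle.
Canonical Vn_UniformSpace :=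
  UniformSpace.Pack (Vn V n) Vn_UniformSpace_mixin (Vn V n).
Canonical Vn_NormedModuleAux :=
  NormedModuleAux.Pack R_AbsRing (Vn V n)
    (NormedModuleAux.Class R_AbsRing _ (ModuleSpace.class _ Vn_ModuleSpace)
      Vn_UniformSpace_mixin) (Vn V n).

Lemma Vn_norm_ge0 u : 0 <= Vn_norm u.
Proof. by apply: sum_ge0 => A; exact: norm_ge_0. Qed.

Lemma Vn_norm_comp u A : norm (u A) <= Vn_norm u.
Proof.
by apply: (le_sum1 (F := fun A => norm (u A) : R)) => B; exact: norm_ge_0.
Qed.

Lemma Vn_norm_triangle u v : Vn_norm (plus u v) <= Vn_norm u + Vn_norm v.
Proof.
apply: Rle_trans (_ : \big[plus/zero]_(A : {set 'I_n})
   (plus (norm (u A) : R) (norm (v A) : R)) <= _).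
  by apply: sum_le => A; exact: norm_triangle.
by rewrite big_split; exact: Rle_refl.
Qed.

Lemma Vn_norm_scal (l : R) u : Vn_norm (scal l u) <= Rabs l * Vn_norm u.
Proof.
have -> : Rabs l * Vn_norm u = scal (Rabs l : R) (Vn_norm u : R_ModuleSpace) by [].
rewrite /Vn_norm (scal_bigl (V := R_ModuleSpace)).
by apply: sum_le => A; exact: (norm_scal l (u A)).
Qed.

Lemma Vn_norm_compat1 u v (e : R) : Vn_norm (minus v u) < e -> ball u e v.
Proof.
move=> h A; apply: norm_compat1; apply: Rle_lt_trans h.
exact: (Vn_norm_comp (minus v u) A).
Qed.

Definition Vn_norm_factor : R := \big[plus/zero]_(A : {set 'I_n}) (@norm_factor _ V : R).

Lemma sum_lt (J : finType) (F G : J -> R) (i : J) :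
  (forall j, F j < G j) -> \big[plus/zero]_j F j < \big[plus/zero]_j G j.
Proof.
move=> FG; rewrite (bigD1 i) //= [X in _ < X](bigD1 i) //=.
apply: Rplus_lt_le_compat => //.
rewrite big_mkcond [X in _ <= X]big_mkcond /=; apply: sum_le => j.
by case: (j != i); [exact: Rlt_le | exact: Rle_refl].
Qed.

Lemma Vn_norm_compat2 u v (e : posreal) :
  ball u e v -> Vn_norm (minus v u) < Vn_norm_factor * e.
Proof.
move=> h; rewrite Rmult_comm.
have -> : e * Vn_norm_factor = scal (e : R) (Vn_norm_factor : R_ModuleSpace) by [].
rewrite /Vn_norm_factor (scal_bigl (V := R_ModuleSpace)).
apply: (sum_lt set0) => A; rewrite /scal /= /mult /= Rmult_comm.
exact: norm_compat2.
Qed.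

Lemma Vn_norm_eq_zero u : Vn_norm u = 0 -> u = zero.
Proof.
move=> h; apply: functional_extensionality => A; apply: norm_eq_zero.
by apply: Rle_antisym; [rewrite -h; exact: Vn_norm_comp | exact: norm_ge_0].
Qed.

Definition Vn_NormedModule_mixin :=
  NormedModule.Mixin R_AbsRing Vn_NormedModuleAux Vn_norm Vn_norm_factor
    Vn_norm_triangle Vn_norm_scal Vn_norm_compat1 Vn_norm_compat2 Vn_norm_eq_zero.
Canonical Vn_NormedModule :=
  NormedModule.Pack R_AbsRing (Vn V n)
    (NormedModule.Class R_AbsRing _ _ Vn_NormedModule_mixin) (Vn V n).

End VnNormed.

Definition Cl (n : nat) : Type := Vn R_NormedModule n.

Definition symdiff n (A B : {set 'I_n}) : {set 'I_n} := (A :\: B) :|: (B :\: A).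

(* e_A e_B = cl_sgn A B * e_(A symdiff B): moving each e_j (j in B) to its place
   among the e_i (i in A) gives a sign -1 for every i > j, and e_j^2 = -1 gives
   one more for i = j. *)
Definition cl_sgn n (A B : {set 'I_n}) : R :=
  (-1) ^ #|[set p : 'I_n * 'I_n | [&& p.1 \in A, p.2 \in B & (p.2 <= p.1)%N]]|.

(* a v, with a (v (x) e_B) = v (x) (a e_B); the sum is over the pairs (A, B)
   with A symdiff B = C, that is, B = A symdiff C. *)
Definition lact (V : NormedModule R_AbsRing) n (a : Cl n) (v : Vn V n) : Vn V n :=
  fun C => \big[plus/zero]_(A : {set 'I_n})
    scal (a A * cl_sgn A (symdiff A C)) (v (symdiff A C)).

(* v a, with (v (x) e_B) a = v (x) (e_B a). *)
Definition ract (V : NormedModule R_AbsRing) n (v : Vn V n) (a : Cl n) : Vn V n :=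
  fun C => \big[plus/zero]_(A : {set 'I_n})
    scal (a A * cl_sgn (symdiff C A) A) (v (symdiff C A)).

Definition cl_mul n (a b : Cl n) : Cl n := lact (V := R_NormedModule) a b.
Definition cl_basis n (B : {set 'I_n}) : Cl n := fun A => if A == B then 1 else 0.
Definition cl_one (n : nat) : Cl n := @cl_basis n set0.
Arguments cl_one : clear implicits.
Definition cl_gen n (j : 'I_n) : Cl n := cl_basis [set j].
Definition cl_pow n (a : Cl n) (k : nat) : Cl n := iter k (cl_mul a) (cl_one n).

Lemma symdiffC n (A B : {set 'I_n}) : symdiff A B = symdiff B A.
Proof. by rewrite /symdiff setUC. Qed.

Lemma symdiffA n (A B C : {set 'I_n}) :
  symdiff A (symdiff B C) = symdiff (symdiff A B) C.
Proof.
by apply/setP => i; rewrite !inE; case: (i \in A); case: (i \in B); case: (i \in C).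
Qed.

Lemma symdiff0 n (A : {set 'I_n}) : symdiff A set0 = A.
Proof. by apply/setP => i; rewrite !inE; case: (i \in A). Qed.

Lemma symdiffK n (A B : {set 'I_n}) : symdiff A (symdiff A B) = B.
Proof. by apply/setP => i; rewrite !inE; case: (i \in A); case: (i \in B). Qed.

Lemma pow_m1_symdiff (J : finType) (X Y Z : {set J}) :
  Z = (X :\: Y) :|: (Y :\: X) -> (-1) ^ #|Z| = (-1) ^ #|X| * (-1) ^ #|Y|.
Proof.
move=> ->; have dis : (X :\: Y) :&: (Y :\: X) = set0.
  by apply/setP => p; rewrite !inE; case: (p \in X); case: (p \in Y).
rewrite cardsU dis cards0 subn0 -(cardsID Y X) -(cardsID X Y) (setIC Y X).
rewrite -!plusE !pow_add.
have sq k : (-1) ^ k * (-1) ^ k = 1 by rewrite -Rpow_mult_distr (_ : -1 * -1 = 1) ?pow1 //; ring.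
transitivity ((-1) ^ #|X :\: Y| * (-1) ^ #|Y :\: X| *
              ((-1) ^ #|X :&: Y| * (-1) ^ #|X :&: Y|)); last by ring.
by rewrite sq Rmult_1_r.
Qed.

Lemma cl_sgn_sq n (A B : {set 'I_n}) : cl_sgn A B * cl_sgn A B = 1.
Proof. by rewrite -Rpow_mult_distr (_ : -1 * -1 = 1) ?pow1 //; ring. Qed.

Lemma cl_sgnDl n (A A' B : {set 'I_n}) :
  cl_sgn (symdiff A A') B = cl_sgn A B * cl_sgn A' B.
Proof.
apply: pow_m1_symdiff; apply/setP => -[i j]; rewrite !inE /=.
by case: (i \in A); case: (i \in A'); case: (j \in B); case: (j <= i)%N.
Qed.

Lemma cl_sgnDr n (A B B' : {set 'I_n}) :
  cl_sgn A (symdiff B B') = cl_sgn A B * cl_sgn A B'.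
Proof.
apply: pow_m1_symdiff; apply/setP => -[i j]; rewrite !inE /=.
by case: (i \in A); case: (j \in B); case: (j \in B'); case: (j <= i)%N.
Qed.

Section Actions.
Variables (V : NormedModule R_AbsRing) (n : nat).
Implicit Types (u v : Vn V n) (a b : Cl n).

Lemma lact_ract a v b : ract (lact a v) b = lact a (ract v b).
Proof.
apply: functional_extensionality => C; rewrite /ract /lact.
under eq_bigr => B _ do rewrite scal_bigl.
under [RHS]eq_bigr => A _ do rewrite scal_bigl.
rewrite exchange_big; apply: eq_bigr => A _; apply: eq_bigr => B _.
rewrite !scal_assoc symdiffA; congr scal.
rewrite !(cl_sgnDl, cl_sgnDr) /mult /=; ring.
Qed.

Lemma lact_assoc a b v : lact (cl_mul a b) v = lact a (lact b v).
Proof.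
apply: functional_extensionality => C; rewrite /cl_mul /lact.
under [RHS]eq_bigr => A _ do rewrite scal_bigl.
transitivity (\big[plus/zero]_(D : {set 'I_n}) \big[plus/zero]_(A : {set 'I_n})
  scal (a A * cl_sgn A (symdiff A D) * b (symdiff A D) * cl_sgn D (symdiff D C))
    (v (symdiff D C))).
  by apply: eq_bigr => D _; rewrite -sum_scal; congr scal; exact: sum_mulr.
rewrite exchange_big /=; apply: eq_bigr => A _.
rewrite (reindex_inj (can_inj (symdiffK A))); apply: eq_bigr => B _.
rewrite scal_assoc symdiffK !symdiffA (symdiffC B A); congr scal.
rewrite !(cl_sgnDl, cl_sgnDr) /scal /= /mult /=.
rewrite -[RHS]Rmult_1_r -(cl_sgn_sq A B); ring.
Qed.

Lemma lact_one v : lact (cl_one n) v = v.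
Proof.
apply: functional_extensionality => C; rewrite /lact (bigD1 set0) //=.
rewrite big1 => [|A /negbTE A0]; last first.
  by rewrite /cl_one /cl_basis A0 Rmult_0_l; exact: (scal_zero_l (K := R_Ring)).
rewrite plus_zero_r /cl_one /cl_basis eqxx symdiffC symdiff0 /cl_sgn.
rewrite (_ : [set p : 'I_n * 'I_n | _] = set0); last by apply/setP => p; rewrite !inE.
by rewrite cards0 /= Rmult_1_r; exact: (scal_one (K := R_Ring)).
Qed.

Lemma lactDr a u v : lact a (plus u v) = plus (lact a u) (lact a v).
Proof.
apply: functional_extensionality => C; rewrite /lact [RHS]/plus /= /Vn_plus -big_split.
by apply: eq_bigr => A _; exact: scal_distr_l.
Qed.

Lemma lactZr a (k : R) v : lact a (scal k v) = scal k (lact a v).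
Proof.
apply: functional_extensionality => C; rewrite [RHS]/scal /= /Vn_scal /lact scal_bigl.
apply: eq_bigr => A _; rewrite {2}/scal /= /Vn_scal !scal_assoc; congr scal.
by rewrite /mult /=; ring.
Qed.

Lemma ractDl u v a : ract (plus u v) a = plus (ract u a) (ract v a).
Proof.
apply: functional_extensionality => C; rewrite /ract [RHS]/plus /= /Vn_plus -big_split.
by apply: eq_bigr => A _; exact: scal_distr_l.
Qed.

Lemma ractZl (k : R) v a : ract (scal k v) a = scal k (ract v a).
Proof.
apply: functional_extensionality => C; rewrite [RHS]/scal /= /Vn_scal /ract scal_bigl.
apply: eq_bigr => A _; rewrite {2}/scal /= /Vn_scal !scal_assoc; congr scal.
by rewrite /mult /=; ring.
Qed.

End Actions.

Lemma cl_mul_basis n (A B : {set 'I_n}) :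
  cl_mul (cl_basis A) (cl_basis B) = scal (cl_sgn A B) (cl_basis (symdiff A B)).
Proof.
apply: functional_extensionality => C; rewrite /cl_mul /lact (bigD1 A) //=.
rewrite big1 => [|A' /negbTE A0]; last first.
  by rewrite /cl_basis A0 Rmult_0_l; exact: (scal_zero_l (K := R_Ring)).
rewrite plus_zero_r [RHS]/scal /= /Vn_scal /cl_basis eqxx.
rewrite -(can_eq (symdiffK A) (symdiff A C)) symdiffK.
by case: eqP => [->|_]; rewrite /scal /= /mult /= ?symdiffK; ring.
Qed.

Lemma cl_gen_sq n (j : 'I_n) : cl_mul (cl_gen j) (cl_gen j) = opp (cl_one n).
Proof.
rewrite cl_mul_basis /cl_sgn (_ : symdiff _ _ = set0); last first.
  by apply/setP => i; rewrite !inE; case: (i == j).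
rewrite (_ : [set p | _] = [set (j, j)]) ?cards1; last first.
  apply/setP => -[i k]; rewrite !inE /= xpair_eqE.
  by case: eqP => //= ->; case: eqP => //= ->; rewrite leqnn.
apply: functional_extensionality => C.
rewrite /scal /= /Vn_scal /opp /= /Vn_opp /scal /opp /= /mult /= /cl_one; ring.
Qed.

Lemma cl_gen_anticomm n (j k : 'I_n) : j != k ->
  plus (cl_mul (cl_gen j) (cl_gen k)) (cl_mul (cl_gen k) (cl_gen j)) = zero.
Proof.
have gen_sgn (i l : 'I_n) :
    cl_sgn [set i] [set l] = if (l <= i)%N then -1 else 1.
  rewrite /cl_sgn; case: leqP => li.
    rewrite (_ : [set p | _] = [set (i, l)]) ?cards1 /=; first by ring.
    apply/setP => -[i' l']; rewrite !inE /= xpair_eqE.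
    by case: eqP => //= ->; case: eqP => //= ->; rewrite li.
  rewrite (_ : [set p | _] = set0) ?cards0 //.
  apply/setP => -[i' l']; rewrite !inE /=.
  by case: eqP => //= ->; case: eqP => //= ->; rewrite leqNgt li.
move=> jk; rewrite !cl_mul_basis (symdiffC [set k]) !gen_sgn.
apply: functional_extensionality => C.
rewrite /plus /= /Vn_plus /scal /= /Vn_scal /scal /plus /zero /= /mult /= /Vn_zero /zero /=.
by case: (ltngtP j k) jk => [h|h|/val_inj ->]; rewrite ?eqxx // => _; ring.
Qed.

(* B(V_n): bounded right linear operators on V_n, with the operator norm.
   Coquelicot's is_linear means real linear and bounded. *)

Record rop (V : NormedModule R_AbsRing) (n : nat) : Type := Rop {
  rop_fun :> Vn V n -> Vn V n;
  rop_linear : is_linear rop_fun;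
  rop_right : forall v a, rop_fun (ract v a) = ract (rop_fun v) a }.

Section Operators.
Variables (V : NormedModule R_AbsRing) (n : nat).
Implicit Types (S T : rop V n) (u v : Vn V n) (a : Cl n).

Lemma rop_ext S T : (forall v, S v = T v) -> S = T.
Proof.
case: S T => [f f1 f2] [g g1 g2] /= /functional_extensionality fg.
by subst g; congr Rop; exact: proof_irrelevance.
Qed.

Lemma is_linear_intro (f : Vn V n -> Vn V n) (M : R) :
  (forall u v, f (plus u v) = plus (f u) (f v)) ->
  (forall (k : R) v, f (scal k v) = scal k (f v)) ->
  (forall v, norm (f v) <= M * norm v) -> is_linear f.
Proof.
move=> fD fZ fM; split=> //; exists (Rmax 1 M); split.
  exact: Rlt_le_trans Rlt_0_1 (Rmax_l _ _).
move=> v; apply: Rle_trans (fM v) _.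
by apply: Rmult_le_compat_r; [exact: norm_ge_0 | exact: Rmax_r].
Qed.

Lemma lact_linear a : is_linear (fun v : Vn V n => lact a v).
Proof.
apply: (is_linear_intro (M := \big[plus/zero]_(C : {set 'I_n})
  \big[plus/zero]_(A : {set 'I_n}) (Rabs (a A * cl_sgn A (symdiff A C)) : R))).
- by move=> u v; exact: lactDr.
- by move=> k v; exact: lactZr.
move=> v; rewrite sum_mulr; apply: sum_le => C; rewrite sum_mulr.
apply: Rle_trans (norm_sum_le _) _; apply: sum_le => A.
apply: Rle_trans (norm_scal _ _) _; apply: Rmult_le_compat_l; first exact: Rabs_pos.
exact: Vn_norm_comp.
Qed.

Definition lmul a : rop V n := Rop (lact_linear a) (fun v b => esym (lact_ract a v b)).

Definition rop_comp S T : rop V n :=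
  @Rop V n (fun v => S (T v)) (is_linear_comp T S (rop_linear T) (rop_linear S))
    (fun v a => eq_trans (f_equal S (rop_right T v a)) (rop_right S (T v) a)).

Lemma rop_id_right v a : id (ract v a) = ract (id v) a. Proof. by []. Qed.
Definition rop_id : rop V n := @Rop V n id is_linear_id rop_id_right.

Definition rop_pow T (k : nat) : rop V n := iter k (rop_comp T) rop_id.

Definition cl_rop a T : rop V n := rop_comp (lmul a) T.
Definition rop_cl T a : rop V n := rop_comp T (lmul a).

Definition rop_invertible T :=
  exists S, rop_comp T S = rop_id /\ rop_comp S T = rop_id.

Definition rop_inv T : rop V n :=
  epsilon (inhabits rop_id)
    (fun S => rop_comp T S = rop_id /\ rop_comp S T = rop_id).

Lemma rop_invP T : rop_invertible T ->
  rop_comp T (rop_inv T) = rop_id /\ rop_comp (rop_inv T) T = rop_id.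
Proof. exact: epsilon_spec. Qed.

Lemma rop_plus_linear S T : is_linear (fun v => plus (S v) (T v)).
Proof.
exact: (is_linear_comp (fun v => (S v, T v)) (fun p => plus p.1 p.2)
  (is_linear_prod S T (rop_linear S) (rop_linear T)) is_linear_plus).
Qed.
Lemma rop_plus_right S T v a :
  plus (S (ract v a)) (T (ract v a)) = ract (plus (S v) (T v)) a.
Proof. by rewrite !rop_right ractDl. Qed.
Definition rop_plus S T : rop V n := Rop (rop_plus_linear S T) (rop_plus_right S T).

Lemma rop_zero_right v a : (zero : Vn V n) = ract (zero : Vn V n) a.
Proof.
have -> : (zero : Vn V n) = scal (0 : R) v by rewrite (scal_zero_l (K := R_Ring)).
by rewrite ractZl !(scal_zero_l (K := R_Ring)).
Qed.
Definition rop_zero : rop V n := @Rop V n (fun _ => zero) is_linear_zero rop_zero_right.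

Lemma rop_scal_linear (k : R) T : is_linear (fun v => scal k (T v)).
Proof.
apply: (is_linear_comp T (scal k) (rop_linear T)).
by apply: (is_linear_scal_r (K := R_AbsRing)) => x y; exact: Rmult_comm.
Qed.
Lemma rop_scal_right (k : R) T v a : scal k (T (ract v a)) = ract (scal k (T v)) a.
Proof. by rewrite rop_right ractZl. Qed.
Definition rop_scal (k : R) T : rop V n := Rop (rop_scal_linear k T) (rop_scal_right k T).

Lemma rop_opp_linear T : is_linear (fun v => opp (T v)).
Proof. exact: (is_linear_comp T opp (rop_linear T) is_linear_opp). Qed.
Lemma rop_opp_right T v a : opp (T (ract v a)) = ract (opp (T v)) a.
Proof.
rewrite -(scal_opp_one (K := R_Ring) (T (ract v a))) -(scal_opp_one (K := R_Ring) (T v)).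
by rewrite rop_right ractZl.
Qed.
Definition rop_opp T : rop V n := Rop (rop_opp_linear T) (rop_opp_right T).

Lemma rop_plusC S T : rop_plus S T = rop_plus T S.
Proof. by apply: rop_ext => v; exact: plus_comm. Qed.
Lemma rop_plusA S T (W : rop V n) : rop_plus S (rop_plus T W) = rop_plus (rop_plus S T) W.
Proof. by apply: rop_ext => v; exact: plus_assoc. Qed.
Lemma rop_plus0 T : rop_plus T rop_zero = T.
Proof. by apply: rop_ext => v; exact: plus_zero_r. Qed.
Lemma rop_plusN T : rop_plus T (rop_opp T) = rop_zero.
Proof. by apply: rop_ext => v; exact: plus_opp_r. Qed.

Definition rop_AbelianMonoid_mixin := AbelianMonoid.Mixin _ _ _ rop_plusC rop_plusA rop_plus0.
Canonical rop_AbelianMonoid := AbelianMonoid.Pack (rop V n) rop_AbelianMonoid_mixin (rop V n).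
Definition rop_AbelianGroup_mixin := AbelianGroup.Mixin rop_AbelianMonoid _ rop_plusN.
Canonical rop_AbelianGroup :=
  AbelianGroup.Pack (rop V n)
    (AbelianGroup.Class _ rop_AbelianMonoid_mixin rop_AbelianGroup_mixin) (rop V n).

Lemma rop_scalA (x y : R) T : rop_scal x (rop_scal y T) = rop_scal (x * y) T.
Proof. by apply: rop_ext => v; exact: scal_assoc. Qed.
Lemma rop_scal1 T : rop_scal 1 T = T.
Proof. by apply: rop_ext => v; exact: (scal_one (K := R_Ring)). Qed.
Lemma rop_scalDr (x : R) S T :
  rop_scal x (rop_plus S T) = rop_plus (rop_scal x S) (rop_scal x T).
Proof. by apply: rop_ext => v; exact: scal_distr_l. Qed.
Lemma rop_scalDl (x y : R) T :
  rop_scal (x + y) T = rop_plus (rop_scal x T) (rop_scal y T).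
Proof. by apply: rop_ext => v; exact: (scal_distr_r (K := R_Ring)). Qed.

Definition rop_ModuleSpace_mixin :=
  ModuleSpace.Mixin R_Ring rop_AbelianGroup rop_scal
    rop_scalA rop_scal1 rop_scalDr rop_scalDl.
Canonical rop_ModuleSpace :=
  ModuleSpace.Pack R_Ring (rop V n)
    (ModuleSpace.Class R_Ring _ _ rop_ModuleSpace_mixin) (rop V n).

Definition op_bound T (M : R) := 0 <= M /\ forall v, norm (T v) <= M * norm v.

Definition rop_norm T : R := real (Glb_Rbar (op_bound T)).

Lemma rop_norm_finite T : is_finite (Glb_Rbar (op_bound T)).
Proof.
have [M [M0 hM]] := linear_norm _ (rop_linear T).
have [lb glb] := Glb_Rbar_correct (op_bound T).
have h1 := lb M (conj (Rlt_le _ _ M0) hM).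
have h2 : Rbar_le 0 (Glb_Rbar (op_bound T)) by apply: glb => r [].
by move: h1 h2; rewrite /is_finite; case: (Glb_Rbar _).
Qed.

Lemma rop_norm_ge0 T : 0 <= rop_norm T.
Proof.
have [_ glb] := Glb_Rbar_correct (op_bound T).
have : Rbar_le 0 (Glb_Rbar (op_bound T)) by apply: glb => r [].
by rewrite -rop_norm_finite.
Qed.

Lemma rop_norm_min T (M : R) : op_bound T M -> rop_norm T <= M.
Proof.
have [lb _] := Glb_Rbar_correct (op_bound T).
by move=> /lb; rewrite -rop_norm_finite.
Qed.

Lemma rop_normP T v : norm (T v) <= rop_norm T * norm v.
Proof.
have [_ glb] := Glb_Rbar_correct (op_bound T).
case: (norm_ge_0 v) => [v0|v0]; last first.
  have -> : v = zero by apply: norm_eq_zero.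
  rewrite (linear_zero _ (rop_linear T)) !norm_zero Rmult_0_r; exact: Rle_refl.
have : Rbar_le (norm (T v) / norm v) (Glb_Rbar (op_bound T)).
  apply: glb => M [_ hM] /=; apply: (Rmult_le_reg_r (norm v)) => //.
  rewrite /Rdiv Rmult_assoc Rinv_l ?Rmult_1_r; [exact: hM | exact: Rgt_not_eq].
rewrite -rop_norm_finite /= => h.
rewrite -{1}(Rmult_1_r (norm (T v))) -(Rinv_l (norm v)); last exact: Rgt_not_eq.
by rewrite -Rmult_assoc; apply: Rmult_le_compat_r => //; exact: Rlt_le.
Qed.

Lemma rop_norm_triangle S T : rop_norm (plus S T) <= rop_norm S + rop_norm T.
Proof.
apply: rop_norm_min; split.
  by apply: Rplus_le_le_0_compat; exact: rop_norm_ge0.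
move=> v; apply: Rle_trans (norm_triangle (S v) (T v)) _.
by rewrite Rmult_plus_distr_r; apply: Rplus_le_compat; exact: rop_normP.
Qed.

Lemma rop_norm_scal (k : R) T : rop_norm (scal k T) <= Rabs k * rop_norm T.
Proof.
apply: rop_norm_min; split.
  by apply: Rmult_le_pos; [exact: Rabs_pos | exact: rop_norm_ge0].
move=> v; apply: Rle_trans (norm_scal k (T v)) _; rewrite Rmult_assoc.
by apply: Rmult_le_compat_l; [exact: Rabs_pos | exact: rop_normP].
Qed.

Lemma rop_norm_eq0 T : rop_norm T = 0 -> T = zero.
Proof.
move=> T0; apply: rop_ext => v; apply: norm_eq_zero; apply: Rle_antisym.
  by apply: Rle_trans (rop_normP T v) _; rewrite T0 Rmult_0_l; exact: Rle_refl.
exact: norm_ge_0.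
Qed.

Definition rop_ball S (e : R) T := rop_norm (minus T S) < e.

Lemma rop_ball_center T (e : posreal) : rop_ball T e T.
Proof.
rewrite /rop_ball minus_eq_zero; apply: Rle_lt_trans (cond_pos e).
apply: rop_norm_min; split; first exact: Rle_refl.
by move=> v; rewrite Rmult_0_l /= norm_zero; exact: Rle_refl.
Qed.
Lemma rop_ball_sym S T (e : R) : rop_ball S e T -> rop_ball T e S.
Proof.
apply: Rle_lt_trans; rewrite -opp_minus -(scal_opp_one (K := R_Ring) (minus T S)).
apply: Rle_trans (rop_norm_scal _ _) _.
rewrite /opp /= /one /= Rabs_Ropp Rabs_R1 Rmult_1_l; exact: Rle_refl.
Qed.
Lemma rop_ball_triangle S T (W : rop V n) (e1 e2 : R) :
  rop_ball S e1 T -> rop_ball T e2 W -> rop_ball S (e1 + e2) W.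
Proof.
move=> h1 h2; rewrite /rop_ball (minus_trans T) Rplus_comm.
by apply: Rle_lt_trans (rop_norm_triangle _ _) _; exact: Rplus_lt_compat.
Qed.

Definition rop_UniformSpace_mixin :=
  UniformSpace.Mixin _ rop_zero rop_ball rop_ball_center rop_ball_sym rop_ball_triangle.
Canonical rop_UniformSpace :=
  UniformSpace.Pack (rop V n) rop_UniformSpace_mixin (rop V n).
Canonical rop_NormedModuleAux :=
  NormedModuleAux.Pack R_AbsRing (rop V n)
    (NormedModuleAux.Class R_AbsRing _ (ModuleSpace.class _ rop_ModuleSpace)
      rop_UniformSpace_mixin) (rop V n).

Lemma rop_norm_compat1 S T (e : R) : rop_norm (minus T S) < e -> ball S e T.
Proof. by []. Qed.
Lemma rop_norm_compat2 S T (e : posreal) : ball S e T -> rop_norm (minus T S) < 1 * e.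
Proof. by rewrite Rmult_1_l. Qed.

Definition rop_NormedModule_mixin :=
  NormedModule.Mixin R_AbsRing rop_NormedModuleAux rop_norm 1
    rop_norm_triangle rop_norm_scal rop_norm_compat1 rop_norm_compat2 rop_norm_eq0.
Canonical rop_NormedModule :=
  NormedModule.Pack R_AbsRing (rop V n)
    (NormedModule.Class R_AbsRing _ _ rop_NormedModule_mixin) (rop V n).

Lemma cwise_linear (f : V -> V) :
  is_linear f -> is_linear (fun v : Vn V n => (fun A => f (v A)) : Vn V n).
Proof.
move=> lf; have [M [M0 hM]] := linear_norm _ lf.
apply: (is_linear_intro (M := M)).
- by move=> u v; apply: functional_extensionality => A; exact: linear_plus lf _ _.
- by move=> k v; apply: functional_extensionality => A; exact: linear_scal lf _ _.
move=> v; rewrite Rmult_comm [norm v]/norm /= /Vn_norm sum_mulr.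
by apply: sum_le => A; rewrite Rmult_comm.
Qed.

Lemma cwise_right (f : V -> V) : is_linear f -> forall (v : Vn V n) a,
  ((fun A => f (ract v a A)) : Vn V n) = ract ((fun A => f (v A)) : Vn V n) a.
Proof.
move=> lf v a; apply: functional_extensionality => C; rewrite /ract.
rewrite (big_morph f (linear_plus _ lf) (linear_zero _ lf)).
by apply: eq_bigr => A _; exact: linear_scal lf _ _.
Qed.

(* A bounded operator of V acting componentwise on V_n. *)
Definition cwise (f : V -> V) (lf : is_linear f) : rop V n :=
  Rop (cwise_linear lf) (cwise_right lf).

End Operators.

Arguments rop_id {V n}.
Arguments lmul {V n} a.

Definition pv (n : nat) : Type := 'I_n.+1 -> R.

Definition paravec n (x : pv n) : Cl n :=
  plus (scal (x ord0) (cl_one n))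
       (\big[plus/zero]_(j < n) scal (x (lift ord0 j)) (cl_gen j)).

Definition pv_norm n (x : pv n) : R :=
  sqrt (\big[plus/zero]_(j < n.+1) (x j ^ 2 : R)).

Definition imag_sphere n (I : pv n) : Prop :=
  I ord0 = 0 /\ \big[plus/zero]_(j < n) (I (lift ord0 j) ^ 2 : R) = 1.

(* The point u + I v of the plane C_I, for z = (u, v). *)
Definition slice_pt n (I : pv n) (z : C) : pv n :=
  fun j => (if j == ord0 then fst z else 0) + snd z * I j.

Definition slice n (I : pv n) (U : pv n -> Prop) : C -> Prop :=
  fun z => U (slice_pt I z).

(* inf {|x - y| : x in A, y in B}; it is +oo if A or B is empty. *)
Definition set_dist n (A B : pv n -> Prop) : Rbar :=
  Glb_Rbar (fun d => exists x y, A x /\ B y /\ d = pv_norm (fun j => x j - y j)).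

Definition pv_space (n : nat) : UniformSpace := fct_UniformSpace 'I_n.+1 R_UniformSpace.

Definition closure_set (X : UniformSpace) (A : X -> Prop) (x : X) : Prop :=
  forall e : posreal, exists y, ball x e y /\ A y.

Definition boundary_set (X : UniformSpace) (A : X -> Prop) (x : X) : Prop :=
  closure_set A x /\ closure_set (fun y => ~ A y) x.

Definition connected_set (X : UniformSpace) (A : X -> Prop) : Prop :=
  forall U W : X -> Prop, open U -> open W ->
  (forall x, A x -> U x \/ W x) ->
  (exists x, A x /\ U x) -> (exists x, A x /\ W x) ->
  exists x, A x /\ U x /\ W x.

Definition is_component (X : UniformSpace) (D K : X -> Prop) : Prop :=
  (exists x, K x) /\ (forall x, K x -> D x) /\ connected_set K /\
  forall K' : X -> Prop, connected_set K' ->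
    (forall x, K x -> K' x) -> (forall x, K' x -> D x) -> forall x, K' x -> K x.

Definition finite_separated_components (X : UniformSpace) (D : X -> Prop) : Prop :=
  exists (k : nat) (K : 'I_k -> X -> Prop),
    (forall i, is_component D (K i)) /\
    (forall x, D x -> exists i, K i x) /\
    (forall i j, i <> j -> forall x, ~ (closure_set (K i) x /\ closure_set (K j) x)).

(* Piecewise C^1 on [0, 1]: on each interval of a subdivision the curve is the
   restriction of a C^1 function on R. *)
Definition piecewise_C1 (gam : R -> C) : Prop :=
  exists (k : nat) (t : nat -> R),
    t 0%N = 0 /\ t k = 1 /\
    forall i : nat, (i < k)%N -> t i < t i.+1 /\
      exists g dg : R -> C,
        (forall s, is_derive (V := C_R_NormedModule) g s (dg s)
                   /\ continuous (U := C_R_NormedModule) dg s) /\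
        forall s, t i <= s <= t i.+1 -> gam s = g s.

Definition jordan_curve (gam : R -> C) : Prop :=
  piecewise_C1 gam /\ gam 0 = gam 1 /\
  forall s t, 0 <= s < 1 -> 0 <= t < 1 -> gam s = gam t -> s = t.

Definition curve_image (gam : R -> C) : C -> Prop :=
  fun z => exists t, 0 <= t <= 1 /\ gam t = z.

Definition jordan_boundary (D : C -> Prop) (m : nat) (Gam : 'I_m -> R -> C) : Prop :=
  (forall j, jordan_curve (Gam j)) /\
  (forall i j, i <> j -> forall z, ~ (curve_image (Gam i) z /\ curve_image (Gam j) z)) /\
  (forall z, boundary_set (X := C_UniformSpace) D z <-> exists j, curve_image (Gam j) z).

(* The velocity; its values at the finitely many breaks of a piecewise C^1
   curve are irrelevant in an integral. *)
Definition velocity (gam : R -> C) (t : R) : C :=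
  (Derive (fun s => fst (gam s)) t, Derive (fun s => snd (gam s)) t).

(* l is the integral of f(z, dz) along the curves Gam. *)
Definition is_contour_int (W : NormedModule R_AbsRing) (m : nat)
    (Gam : 'I_m -> R -> C) (f : C -> C -> W) (l : W) : Prop :=
  exists J : 'I_m -> W,
    (forall j, is_RInt (fun t => f (Gam j t) (velocity (Gam j) t)) 0 1 (J j)) /\
    l = \big[plus/zero]_(j < m) J j.

(* The standard positive orientation of the boundary of D: the curves together
   wind once around the points of D, and zero times around the points outside
   the closure of D. *)
Definition positive_boundary (D : C -> Prop) (m : nat) (Gam : 'I_m -> R -> C) : Prop :=
  jordan_boundary D Gam /\
  (forall z, D z ->
     is_contour_int (W := C_R_NormedModule) Gam
       (fun w dw => (dw / (w - z))%C) (RtoC (2 * PI) * Ci)%C) /\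
  (forall z, ~ closure_set (X := C_UniformSpace) D z ->
     is_contour_int (W := C_R_NormedModule) Gam
       (fun w dw => (dw / (w - z))%C) (RtoC 0)).

Definition axially_symmetric n (U : pv n -> Prop) : Prop :=
  forall I J u v, imag_sphere I -> imag_sphere J ->
    U (slice_pt I (u, v)) -> U (slice_pt J (u, v)).

Definition bounded_slice_Cauchy_domain n (U : pv n -> Prop) : Prop :=
  (exists M : R, forall x, U x -> pv_norm x <= M) /\
  axially_symmetric U /\
  open (T := pv_space n) U /\
  forall I, imag_sphere I ->
    finite_separated_components (X := C_UniformSpace) (slice I U) /\
    exists (m : nat) (Gam : 'I_m -> R -> C), jordan_boundary (slice I U) Gam.

(* The spectrum of a bounded operator f of a real Banach space V is that of its
   complexification f + i f on V + i V = V * V. *)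

Definition cx_scal (V : NormedModule R_AbsRing) (l : C) (x : V * V) : V * V :=
  (minus (scal (fst l) (fst x)) (scal (snd l) (snd x)),
   plus (scal (fst l) (snd x)) (scal (snd l) (fst x))).

Definition cx_op (V : NormedModule R_AbsRing) (f : V -> V) (x : V * V) : V * V :=
  (f (fst x), f (snd x)).

Definition cx_bounded (V : NormedModule R_AbsRing) (g : V * V -> V * V) : Prop :=
  is_linear g /\ forall (l : C) x, g (cx_scal l x) = cx_scal l (g x).

Definition spectrum (V : NormedModule R_AbsRing) (f : V -> V) (l : C) : Prop :=
  ~ exists g : V * V -> V * V, cx_bounded g /\
      (forall x, g (minus (cx_op f x) (cx_scal l x)) = x) /\
      (forall x, minus (cx_op f (g x)) (cx_scal l (g x)) = x).

Record BC01 (V : NormedModule R_AbsRing) (n : nat) : Type := MkBC01 {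
  component :> 'I_n.+1 -> V -> V;
  component_linear : forall l, is_linear (component l);
  component_comm : forall k l x,
    component k (component l x) = component l (component k x) }.

Section FCalculus.
Variables (V : NormedModule R_AbsRing) (n : nat) (T : BC01 V n).

Definition comp_op (l : 'I_n.+1) : rop V n := cwise n (component_linear T l).

Definition vec_part : rop V n :=
  \big[plus/zero]_(l < n) cl_rop (cl_gen l) (comp_op (lift ord0 l)).

Definition para_op : rop V n := plus (comp_op ord0) vec_part.
Definition para_conj : rop V n := minus (comp_op ord0) vec_part.

Definition quad_op (s : pv n) : rop V n :=
  plus (minus (cl_rop (cl_pow (paravec s) 2) rop_id)
              (cl_rop (paravec s) (plus para_op para_conj)))
       (rop_comp para_op para_conj).

Definition F_spectrum (s : pv n) : Prop := ~ rop_invertible (quad_op s).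
Definition F_resolvent_set (s : pv n) : Prop := ~ F_spectrum s.

Definition Q_op (s : pv n) : rop V n := rop_inv (quad_op s).

Definition gamma_n (k : nat) : R :=
  (-1) ^ k.-1./2 * 2 ^ k.-1 * INR (k.-1./2)`! ^ 2.

Definition FL (s : pv n) : rop V n :=
  scal (gamma_n n)
    (rop_comp (minus (cl_rop (paravec s) rop_id) para_conj) (rop_pow (Q_op s) n.+1./2)).

Definition FR (s : pv n) : rop V n :=
  scal (gamma_n n)
    (rop_comp (rop_pow (Q_op s) n.+1./2) (minus (cl_rop (paravec s) rop_id) para_conj)).

Definition admissible (G : pv n -> Prop) : Prop :=
  bounded_slice_Cauchy_domain G /\
  forall x, boundary_set (X := pv_space n) G x -> F_resolvent_set x.

End FCalculus.

(* dp_I = dp (-I), for p = slice_pt I z and dp = slice_pt I dz. *)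
Definition diff_I n (I : pv n) (dz : C) : Cl n :=
  cl_mul (paravec (slice_pt I dz)) (opp (paravec I)).

(* F_n^L(p, T) dp_I p^k and s^k ds_I F_n^R(s, T) *)
Definition left_integrand V n (T : BC01 V n) (I : pv n) (k : nat) (z dz : C) : rop V n :=
  rop_cl (rop_cl (FL T (slice_pt I z)) (diff_I I dz)) (cl_pow (paravec (slice_pt I z)) k).

Definition right_integrand V n (T : BC01 V n) (I : pv n) (k : nat) (z dz : C) : rop V n :=
  cl_rop (cl_pow (paravec (slice_pt I z)) k) (cl_rop (diff_I I dz) (FR T (slice_pt I z))).

(* Main.v *)
Require Import Defs.
From Stdlib Require Import Reals Lra Lia.
From Stdlib Require Import Classical ClassicalEpsilon.
From Stdlib Require Import FunctionalExtensionality PropExtensionality ProofIrrelevance.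
From mathcomp Require Import all_boot.
From Coquelicot Require Import Coquelicot.

(** Since T_0 = 0, the pencil s^2 - s(T + conj T) + T conj T is s^2 + A with
    A the sum of the squares of the components. On the plane C_I both s and A
    live in one commutative complex Banach algebra K, in which left
    multiplication by I plays the part of i: the bicommutant of that
    multiplication and of the components of T. With Q_p = (p^2 + A)^-1 and
    h = (n - 1)/2 the left integral is, up to constants, X_h + T Y_h, and the
    right one is X_h + Y_h T, where X_h is the integral of p^(2h+1) Q_p^(h+1)
    and Y_h that of p^(2h) Q_p^(h+1). Integrating the derivatives of
    p^k Q_p^l by parts reduces the exponents: X_h = X = int p Q_p, and Y_h is a
    multiple of Y = int Q_p ([moment_odd], [moment_even]). So it is enough that
    Y = 0, that X is the same for both domains, and that X/(2 pi i) is
    idempotent.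

    These three facts have one source. Let c(z) be the integral of
    Q_p/(p - z). Because p^2 + A and z^2 + A differ by (p - z)(p + z),
      (z^2 + A) c(z) = 2 pi i w(z) - z Y - X,
    with w the winding number ([pencil_cauchy_tr]). Hence certain combinations
    D of X and Y are, near each spectral point, multiples of the pencil:
    z^2 D = (z^2 + A) F(z) with F holomorphic. Then F extends to an entire
    function that equals z^2 Q_z D off the spectrum, vanishes at 0 and tends to
    D at infinity, so D = 0 by a theorem of Liouville type
    ([entire_division]). Applied to D = 2Y this gives [int_Q_eq0], applied to
    the difference of the two X it gives [int_pQ_unique], and applied to
    P^2 - P with P = X/(2 pi i) it gives [riesz_proj_idempotent]. The
    contours enter through their winding numbers only.

    The vanishing of Y is where the reality of the spectra is used. For D = 2Y
    one takes F(z) = - z (c(z) - c(- z)), which requires w(z) = w(- z) near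
    the spectrum. Commuting elements with spectrum in [0, oo[ have a sum with
    spectrum in [0, oo[ ([nonneg_spectrum_add]), so A is such an element, the
    spectral points of the pencil on C_I are purely imaginary, - z is the
    conjugate of z there, and the domains are symmetric under conjugation.

    The analysis rests on a discrete mean value property ([mean_value]): for a
    function with uniform quadratic remainders, the average over the scaled
    N-th roots of unity tends to the value at 0. It yields both
    [entire_division] and the spectral radius bound [power_bound]. *)

Set Implicit Arguments.
Unset Strict Implicit.
Unset Printing Implicit Defensive.

Local Open Scope R_scope.

(** * Commutative complex Banach algebras *)

(** Complex algebras are encoded as real ones with a distinguished square root
   [iu] of -1, because curves are integrated in real normed modules and because
   the imaginary unit of interest is itself an operator. *)
Record cba : Type := Cba {
  cba_space :> CompleteNormedModule R_AbsRing;
  mul : cba_space -> cba_space -> cba_space;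
  one : cba_space;
  iu : cba_space;
  mulC : forall x y, mul x y = mul y x;
  mulA : forall x y z, mul x (mul y z) = mul (mul x y) z;
  mul1 : forall x, mul one x = x;
  mulDl : forall x y z, mul (plus x y) z = plus (mul x z) (mul y z);
  scal_mul : forall (k : R) x y, scal k (mul x y) = mul (scal k x) y;
  iu_sq : mul iu iu = opp one;
  norm_mul : forall x y, norm (mul x y) <= norm x * norm y;
  norm_one : norm one <= 1 }.

Arguments one {c}.
Arguments iu {c}.

(** The module operations are restated at the carrier itself, so that their
   instances are syntactically equal and [ring] can compare terms. *)
Definition add (K : cba) (x y : K) : K := plus x y.
Definition neg (K : cba) (x : K) : K := opp x.
Definition sub (K : cba) (x y : K) : K := minus x y.
Definition nul (K : cba) : K := zero.
Definition sc (K : cba) (k : R) (x : K) : K := scal k x.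
Arguments nul {K}.

Declare Scope cba_scope.
Delimit Scope cba_scope with K.
Notation "x + y" := (add x y) : cba_scope.
Notation "x - y" := (sub x y) : cba_scope.
Notation "- x" := (neg x) : cba_scope.
Notation "x * y" := (mul x y) : cba_scope.
Notation "0" := nul : cba_scope.
Notation "1" := one : cba_scope.

Lemma cba_ring (K : cba) :
  ring_theory (@nul K) one (@add K) (@mul K) (@sub K) (@neg K) eq.
Proof.
split.
- exact: plus_zero_l.
- exact: plus_comm.
- exact: plus_assoc.
- exact: mul1.
- exact: mulC.
- exact: mulA.
- exact: mulDl.
- by [].
- exact: plus_opp_r.
Qed.

Section Algebra.
Variable K : cba.
Implicit Types x y z : K.

Add Ring Kring : (cba_ring K).

Fixpoint kpow x (k : nat) : K := if k is k'.+1 then (x * kpow x k')%K else one.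

Fixpoint ksum (F : nat -> K) (N : nat) : K :=
  if N is N'.+1 then (ksum F N' + F N')%K else nul.

Definition cx (c : C) : K := (sc (fst c) one + sc (snd c) iu)%K.

Lemma scE (k : R) x : sc k x = (sc k one * x)%K.
Proof. by rewrite /sc -scal_mul mul1. Qed.

Lemma scD (a b : R) x : sc (a + b) x = (sc a x + sc b x)%K.
Proof. exact: (scal_distr_r (K := R_Ring)). Qed.

Lemma scM (a b : R) x : sc (a * b) x = sc a (sc b x).
Proof. by rewrite /sc scal_assoc. Qed.

Lemma sc1 x : sc 1 x = x.
Proof. exact: (scal_one (K := R_Ring)). Qed.

Lemma sc0 x : sc 0 x = nul.
Proof. exact: (scal_zero_l (K := R_Ring)). Qed.

Lemma scN (a : R) x : sc (- a) x = (- sc a x)%K.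
Proof. exact: (scal_opp_l (K := R_Ring)). Qed.

Lemma cxD (a b : C) : cx (a + b)%C = (cx a + cx b)%K.
Proof. rewrite /cx /= !scD; ring. Qed.

Lemma cxN (a : C) : cx (- a)%C = (- cx a)%K.
Proof. rewrite /cx /= !scN; ring. Qed.

Lemma cxB (a b : C) : cx (a - b)%C = (cx a - cx b)%K.
Proof. rewrite /Cminus cxD cxN; ring. Qed.

Lemma cxM (a b : C) : cx (a * b)%C = (cx a * cx b)%K.
Proof.
rewrite /cx /= /Rminus ?scD ?scN ?scM.
rewrite !(scE _ (sc _ _)) !(scE _ iu).
have h := iu_sq K; change (iu * iu = - one :> K)%K in h.
ring [h].
Qed.

Lemma cxR (k : R) : cx (RtoC k) = sc k one.
Proof. rewrite /cx /= sc0; ring. Qed.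

Lemma scE_cx (k : R) x : sc k x = (cx (RtoC k) * x)%K.
Proof. by rewrite cxR -scE. Qed.

Lemma cx1 : cx (RtoC 1) = one.
Proof. by rewrite cxR sc1. Qed.

Lemma cx0 : cx (RtoC 0) = nul.
Proof. by rewrite cxR sc0. Qed.

Lemma cx_inv (c : C) : c <> RtoC 0 -> (cx c * cx (/ c)%C)%K = one.
Proof. by move=> c0; rewrite -cxM Cinv_r // cx1. Qed.

Lemma normD x y : norm (x + y)%K <= norm x + norm y.
Proof. exact: norm_triangle. Qed.

Lemma normN x : norm (- x)%K = norm x.
Proof. exact: norm_opp. Qed.

Lemma normB x y : norm (x - y)%K <= norm x + norm y.
Proof. by rewrite -(normN y); exact: normD. Qed.

Lemma norm_nul : norm (nul : K) = 0.
Proof. exact: norm_zero. Qed.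

Lemma norm0_eq x : norm x <= 0 -> x = nul.
Proof. by move=> h; apply: norm_eq_zero; apply: Rle_antisym => //; exact: norm_ge_0. Qed.

Lemma norm_sc (k : R) x : norm (sc k x) <= Rabs k * norm x.
Proof. exact: (norm_scal k x). Qed.

Lemma norm_mul_le x y (a b : R) :
  norm x <= a -> norm y <= b -> norm (x * y)%K <= a * b.
Proof.
move=> xa yb; apply: Rle_trans (norm_mul x y) _.
by apply: Rmult_le_compat => //; exact: norm_ge_0.
Qed.

(** The norm of [iu] is arbitrary, so [cx] is bounded but not isometric. *)
Definition cx_bound : R := 1 + norm (iu : K).

Lemma cx_bound_ge1 : 1 <= cx_bound.
Proof. rewrite /cx_bound; have := norm_ge_0 (iu : K); lra. Qed.

Lemma norm_cx (c : C) : norm (cx c) <= Cmod c * cx_bound.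
Proof.
apply: Rle_trans (normD _ _) _.
have h1 := norm_sc (fst c) one; have h2 := norm_sc (snd c) iu.
have [m1 m2] : Rabs (fst c) <= Cmod c /\ Rabs (snd c) <= Cmod c.
  by split; apply: Rle_trans (Rmax_Cmod c); [exact: Rmax_l | exact: Rmax_r].
have n1 := norm_one K; have n0 := norm_ge_0 (one : K).
have i0 := norm_ge_0 (iu : K); have a0 := Rabs_pos (fst c); have b0 := Rabs_pos (snd c).
rewrite /cx_bound; nra.
Qed.

Lemma norm_pow x k : norm (kpow x k) <= norm x ^ k.
Proof.
elim: k => [|k IH] /=; first exact: norm_one.
by apply: norm_mul_le => //; exact: Rle_refl.
Qed.

Lemma powM x y k : kpow (x * y)%K k = (kpow x k * kpow y k)%K.
Proof. elim: k => [|k IH]; rewrite ?add0n ?addSn /= ?IH; ring. Qed.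

Lemma pow_cx (c : C) k : kpow (cx c) k = cx (Cpow c k).
Proof. elim: k => [|k IH] /=; [by rewrite cx1 | by rewrite IH cxM]. Qed.

Lemma ksum_ext (F G : nat -> K) N :
  (forall k, (k < N)%coq_nat -> F k = G k) -> ksum F N = ksum G N.
Proof.
elim: N => //= N IH h; rewrite (h N (Nat.lt_succ_diag_r N)); congr add.
by apply: IH => k hk; apply: h; lia.
Qed.

Lemma ksumD (F G : nat -> K) N :
  ksum (fun k => F k + G k)%K N = (ksum F N + ksum G N)%K.
Proof. elim: N => [|N IH] /=; [ring | rewrite IH; ring]. Qed.

Lemma ksumM x (F : nat -> K) N : ksum (fun k => x * F k)%K N = (x * ksum F N)%K.
Proof. elim: N => [|N IH] /=; [ring | rewrite IH; ring]. Qed.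

Lemma ksum_const x N : ksum (fun _ => x) N = sc (INR N) x.
Proof.
elim: N => [|N IH]; first by rewrite /= sc0.
by rewrite [LHS]/= IH S_INR scD sc1.
Qed.

Lemma ksum_tele (F : nat -> K) N : ksum (fun k => F k.+1 - F k)%K N = (F N - F 0%N)%K.
Proof. elim: N => [|N IH] /=; [ring | rewrite IH; ring]. Qed.

Lemma ksum_swap (F : nat -> nat -> K) M N :
  ksum (fun i => ksum (F i) N) M = ksum (fun j => ksum (fun i => F i j) M) N.
Proof.
elim: M => [|M IH] /=; last by rewrite IH -ksumD.
by elim: N => [|N IH] //=; rewrite -IH; ring.
Qed.

Lemma norm_ksum (F : nat -> K) (b : R) N :
  (forall k, (k < N)%coq_nat -> norm (F k) <= b) -> norm (ksum F N) <= INR N * b.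
Proof.
elim: N => [|N IH] h; first by rewrite /= norm_nul; lra.
rewrite [ksum _ _]/= S_INR; apply: Rle_trans (normD _ _) _.
have h1 := IH (fun k hk => h k (Nat.lt_lt_succ_r _ _ hk)).
have h2 := h N (Nat.lt_succ_diag_r N); lra.
Qed.

Lemma geom_sum x N : ((one - x) * ksum (kpow x) N)%K = (one - kpow x N)%K.
Proof.
elim: N => [|N IH] /=; first by ring.
transitivity ((one - x) * ksum (kpow x) N + (one - x) * kpow x N)%K; first by ring.
rewrite IH; ring.
Qed.

Definition inv_pair x y := (x * y)%K = one.
Definition invertible x := exists y, inv_pair x y.
Definition kinv x : K := epsilon (inhabits nul) (inv_pair x).

Lemma kinvP x : invertible x -> (x * kinv x)%K = one.
Proof. exact: epsilon_spec. Qed.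

Lemma kinv_eq x y : (x * y)%K = one -> kinv x = y.
Proof.
move=> xy; have xi := kinvP (ex_intro _ y xy).
transitivity (x * y * kinv x)%K; first by rewrite xy; ring.
by rewrite (mulC x) -mulA xi; ring.
Qed.

Lemma invertible_mul x y : invertible (x * y)%K -> invertible x.
Proof. by move=> [z h]; exists (y * z)%K; rewrite /inv_pair -h; ring. Qed.

Lemma mul_invertible x y : invertible x -> invertible y -> invertible (x * y)%K.
Proof.
move=> [x' hx] [y' hy]; exists (x' * y')%K; rewrite /inv_pair in hx hy *.
transitivity ((x * x') * (y * y'))%K; [ring | rewrite hx hy; ring].
Qed.

Lemma invertible_cx (c : C) : c <> RtoC 0 -> invertible (cx c).
Proof. by move=> c0; exists (cx (/ c)%C); exact: cx_inv. Qed.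

Lemma kinv_cx (c : C) : c <> RtoC 0 -> kinv (cx c) = cx (/ c)%C.
Proof. by move=> c0; apply: kinv_eq; exact: cx_inv. Qed.

(** The Neumann series; completeness enters the algebra only here. *)
Lemma neumann y : norm y < 1 -> invertible (one - y)%K.
Proof.
move=> y1.
have [l hl] : ex_series (V := K) (kpow y).
  apply: (ex_series_le (V := K) _ (fun k => norm y ^ k)); first exact: norm_pow.
  by eexists; apply: is_series_geom; rewrite Rabs_pos_eq //; exact: norm_ge_0.
exists l; rewrite /inv_pair.
have sumE N : sum_n (kpow y) N = ksum (kpow y) N.+1.
  elim: N => [|N IH]; first by rewrite sum_O /=; ring.
  by rewrite sum_Sn IH.
suff : norm ((one - y) * l - one)%K <= 0.
  move=> /norm0_eq h.
  transitivity ((one - y) * l - one + one)%K; first by ring.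
  rewrite h; ring.
apply: le_epsilon => e e0; rewrite Rplus_0_l.
set c := norm (one - y)%K; have c0 : 0 <= c := norm_ge_0 _.
have f0 := @norm_factor_gt_0 _ K.
pose d := e / 2 / (c + 1) / @norm_factor _ K.
have d0 : 0 < d by rewrite /d; repeat apply: Rdiv_lt_0_compat => //; lra.
have [N1 h1] := hl _ (locally_ball l (mkposreal d d0)).
have [|N2 h2] := pow_lt_1_zero (norm y) _ (e / 2) ltac:(lra).
  by rewrite Rabs_pos_eq //; exact: norm_ge_0.
pose N := (N1 + N2)%coq_nat.
have {h1} := norm_compat2 _ _ _ (h1 N (Nat.le_add_r _ _)).
have {h2} := h2 N.+1 ltac:(rewrite /N; lia).
rewrite Rabs_pos_eq; last by apply: pow_le; exact: norm_ge_0.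
rewrite sumE /= -/(sub _ _) => h2 h1.
have -> : ((one - y) * l - one = - ((one - y) * (ksum (kpow y) N.+1 - l)) - kpow y N.+1)%K.
  transitivity ((one - y) * l - ((one - y) * ksum (kpow y) N.+1 + kpow y N.+1))%K.
    by rewrite geom_sum; ring.
  ring.
apply: Rle_trans (normB _ _) _; rewrite normN.
have h3 := norm_pow y N.+1.
have {}h1 : norm (ksum (kpow y) N.+1 - l)%K <= e / 2 / (c + 1).
  apply: Rlt_le; apply: Rlt_le_trans h1 _; rewrite /d /=; right; field; lra.
have h4 := norm_mul_le (Rle_refl c) h1.
have h5 : c * (e / 2 / (c + 1)) <= e / 2.
  have p : 0 < e / 2 / (c + 1) by apply: Rdiv_lt_0_compat; lra.
  have q : (c + 1) * (e / 2 / (c + 1)) = e / 2 by field; lra.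
  lra.
have h6 : norm (kpow y N.+1) <= e / 2 by apply: Rle_trans h3 (Rlt_le _ _ h2).
apply: Rle_trans (Rplus_le_compat _ _ _ _ (Rle_trans _ _ _ h4 h5) h6) _; lra.
Qed.

Lemma neumann_bound y u : norm y <= / 2 -> ((one + y) * u)%K = one ->
  norm u <= 2 /\ norm (u - one)%K <= 2 * norm y.
Proof.
move=> y2 h.
have e : (u - one = - (y * u))%K by rewrite -[in LHS]h; ring.
have u2 : norm u <= 2.
  have : norm u <= 1 + / 2 * norm u.
    have {1}-> : (u = one + (u - one))%K by ring.
    apply: Rle_trans (normD _ _) _; rewrite e normN.
    apply: Rplus_le_compat; first exact: norm_one.
    by apply: norm_mul_le => //; exact: Rle_refl.
  lra.
split=> //; rewrite e normN Rmult_comm.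
by apply: norm_mul_le => //; exact: Rle_refl.
Qed.

Lemma neumann_half y : norm y <= / 2 -> invertible (one + y)%K.
Proof.
move=> h; have [|z hz] := @neumann (- y)%K; first by rewrite normN; lra.
by exists z; rewrite /inv_pair -[RHS]hz; ring.
Qed.

(** Invertibility is open; the bound on the inverse is what makes the estimates
   for the inverse of a holomorphic function locally uniform. *)
Lemma invertible_near x x' : invertible x -> norm (x' - x)%K * norm (kinv x) <= / 2 ->
  invertible x' /\ norm (kinv x') <= 2 * norm (kinv x).
Proof.
move=> xi h; have hx := kinvP xi.
pose y := ((x' - x) * kinv x)%K.
have y2 : norm y <= / 2 by apply: Rle_trans h; exact: norm_mul.
have [u hu] := neumann_half y2; rewrite /inv_pair in hu.
have e : (x' * (kinv x * u))%K = one.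
  rewrite -hu /y; ring [hx].
split; first by exists (kinv x * u)%K.
rewrite (kinv_eq e) Rmult_comm; apply: norm_mul_le; first exact: Rle_refl.
by have [] := neumann_bound y2 hu.
Qed.

End Algebra.

(** * Holomorphic functions with values in the algebra *)

Section Holomorphic.
Variable K : cba.
Implicit Types (f g : C -> K) (z w : C).

Add Ring Kring : (cba_ring K).

(** Holomorphy is a quadratic remainder that is uniform on a ball. Unlike
   pointwise differentiability this passes through sums, products, inverses and
   parameter integrals by algebra alone, and it can be summed over a fine
   subdivision. *)
Definition hol_on f f' z0 (d M : R) := forall z z',
  Cmod (z - z0) < d -> Cmod (z' - z0) < d ->
  norm (f z) <= M /\ norm (f' z) <= M /\
  norm (f z' - f z - cx K (z' - z) * f' z)%K <= M * Cmod (z' - z) ^ 2.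

Definition hol f f' z0 := exists d M : R, 0 < d <= 1 /\ 0 <= M /\ hol_on f f' z0 d M.

Lemma hol_on_mono f f' z0 d M d' M' :
  d' <= d -> M <= M' -> hol_on f f' z0 d M -> hol_on f f' z0 d' M'.
Proof.
move=> dd MM h z z' hz hz'; have [h1 [h2 h3]] := h z z' ltac:(lra) ltac:(lra).
have := pow2_ge_0 (Cmod (z' - z)); split; last split; try lra; nra.
Qed.

Lemma hol_common f f' g g' z0 : hol f f' z0 -> hol g g' z0 ->
  exists d M : R, 0 < d <= 1 /\ 0 <= M /\ hol_on f f' z0 d M /\ hol_on g g' z0 d M.
Proof.
move=> [d1 [M1 [hd1 [hM1 h1]]]] [d2 [M2 [hd2 [hM2 h2]]]].
have [a1 a2] := (Rmin_l d1 d2, Rmin_r d1 d2).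
have [b1 b2] := (Rmax_l M1 M2, Rmax_r M1 M2).
exists (Rmin d1 d2), (Rmax M1 M2); split; first by split; [apply: Rmin_pos; lra | lra].
split; first lra.
split; first exact: hol_on_mono h1. 
exact: hol_on_mono h2.
Qed.

Lemma Cmod_near z z' z0 d : d <= 1 -> Cmod (z - z0) < d -> Cmod (z' - z0) < d ->
  Cmod (z' - z) <= 2.
Proof.
move=> d1 h h'; have -> : (z' - z = (z' - z0) + - (z - z0))%C by ring.
by apply: Rle_trans (Cmod_triangle _ _) _; rewrite Cmod_opp; lra.
Qed.

Lemma hol_on_lip f f' z0 d M : d <= 1 -> 0 <= M -> hol_on f f' z0 d M ->
  forall z z', Cmod (z - z0) < d -> Cmod (z' - z0) < d ->
  norm (f z' - f z)%K <= M * (cx_bound K + 2) * Cmod (z' - z).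
Proof.
move=> d1 M0 h z z' hz hz'; have [_ [h2 h3]] := h z z' hz hz'.
have h4 := Cmod_near d1 hz hz'; have h5 := Cmod_ge_0 (z' - z).
have -> : (f z' - f z = (f z' - f z - cx K (z' - z) * f' z) + cx K (z' - z) * f' z)%K by ring.
apply: Rle_trans (normD _ _) _.
have h6 := norm_mul_le (norm_cx K (z' - z)) h2.
set t := Cmod (z' - z) in h3 h4 h5 h6 *.
have Mt : 0 <= M * t by exact: Rmult_le_pos.
have h7 : M * t * t <= M * t * 2 by exact: Rmult_le_compat_l.
simpl in h3; lra.
Qed.

Lemma hol_cont f f' z0 (e : R) : hol f f' z0 -> 0 < e ->
  exists d, 0 < d /\ forall z, Cmod (z - z0) < d -> norm (f z - f z0)%K <= e.
Proof.
move=> [d [M [[d0 d1] [M0 h]]]] e0.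
have c1 := cx_bound_ge1 K.
pose L := M * (cx_bound K + 2) + 1; have L1 : 1 <= L by rewrite /L; nra.
exists (Rmin d (e / L)); split; first by apply: Rmin_pos => //; apply: Rdiv_lt_0_compat; lra.
move=> z hz.
have hz1 := Rlt_le_trans _ _ _ hz (Rmin_l _ _).
have hz2 := Rlt_le_trans _ _ _ hz (Rmin_r _ _).
have z00 : Cmod (z0 - z0) < d by rewrite (_ : (z0 - z0 = RtoC 0)%C) ?Cmod_0 //; ring.
apply: Rle_trans (hol_on_lip d1 M0 h z00 hz1) _.
have h0 := Cmod_ge_0 (z - z0).
apply: Rle_trans (_ : L * (e / L) <= _); last by right; field; lra.
apply: Rmult_le_compat => //; [nra | rewrite /L; lra | lra].
Qed.

Lemma hol_const x z0 : hol (fun _ => x) (fun _ => nul) z0.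
Proof.
exists 1, (norm x); split; first lra; split; first exact: norm_ge_0.
move=> z z' _ _; split; first exact: Rle_refl.
split; first by rewrite norm_nul; exact: norm_ge_0.
have -> : (x - x - cx K (z' - z) * nul = nul)%K by ring.
rewrite norm_nul; apply: Rmult_le_pos; [exact: norm_ge_0 | exact: pow2_ge_0].
Qed.

Lemma hol_cx z0 : hol (cx K) (fun _ => one) z0.
Proof.
have c1 := cx_bound_ge1 K; have m0 := Cmod_ge_0 z0.
exists 1, ((Cmod z0 + 1) * cx_bound K); split; first lra; split; first nra.
move=> z z' hz _; split; last split.
- apply: Rle_trans (norm_cx K z) _; apply: Rmult_le_compat_r; first lra.
  have -> : (z = z0 + (z - z0))%C by ring.
  by apply: Rle_trans (Cmod_triangle _ _) _; lra.
- by have := norm_one K; nra.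
rewrite cxB (_ : sub _ _ = nul); last by ring.
rewrite norm_nul; apply: Rmult_le_pos; [nra | exact: pow2_ge_0].
Qed.

Lemma hol_add f f' g g' z0 : hol f f' z0 -> hol g g' z0 ->
  hol (fun z => f z + g z)%K (fun z => f' z + g' z)%K z0.
Proof.
move=> hf hg; have [d [M [hd [hM [h1 h2]]]]] := hol_common hf hg.
exists d, (M + M); split=> //; split; first lra.
move=> z z' hz hz'; have [a1 [a2 a3]] := h1 z z' hz hz'; have [b1 [b2 b3]] := h2 z z' hz hz'.
split; first by apply: Rle_trans (normD _ _) _; lra.
split; first by apply: Rle_trans (normD _ _) _; lra.
rewrite (_ : sub _ _ = ((f z' - f z - cx K (z' - z) * f' z) + (g z' - g z - cx K (z' - z) * g' z)))%K;
  last by ring.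
by apply: Rle_trans (normD _ _) _; lra.
Qed.

Lemma hol_mul f f' g g' z0 : hol f f' z0 -> hol g g' z0 ->
  hol (fun z => f z * g z)%K (fun z => f' z * g z + f z * g' z)%K z0.
Proof.
move=> hf hg; have [d [M [[d0 d1] [hM [h1 h2]]]]] := hol_common hf hg.
have c1 := cx_bound_ge1 K.
pose L := M * (cx_bound K + 2).
exists d, (2 * (M * M) + L * cx_bound K * M + 2 * (M * M)); split=> //.
have L0 : 0 <= L by rewrite /L; nra.
have LM : 0 <= L * cx_bound K * M by apply: Rmult_le_pos => //; apply: Rmult_le_pos; lra.
have MM : 0 <= M * M by nra.
split; first lra.
move=> z z' hz hz'; have [a1 [a2 a3]] := h1 z z' hz hz'; have [b1 [b2 b3]] := h2 z z' hz hz'.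
have [a1' _] := h1 z' z hz' hz.
split; first by have := norm_mul_le a1 b1; lra.
split.
  by apply: Rle_trans (normD _ _) _; have := norm_mul_le a2 b1; have := norm_mul_le a1 b2; lra.
have lip := hol_on_lip d1 hM h1 hz hz'.
rewrite (_ : sub _ _ = ((f z' - f z) * (cx K (z' - z) * g' z)
   + f z' * (g z' - g z - cx K (z' - z) * g' z)
   + (f z' - f z - cx K (z' - z) * f' z) * g z)%K); last by ring.
apply: Rle_trans (normD _ _) _; apply: Rle_trans (Rplus_le_compat_r _ _ _ (normD _ _)) _.
have k1 := norm_mul_le lip (norm_mul_le (norm_cx K (z' - z)) b2).
have k2 := norm_mul_le a1' b3; have k3 := norm_mul_le a3 b1.
apply: Rle_trans (Rplus_le_compat _ _ _ _ (Rplus_le_compat _ _ _ _ k1 k2) k3) _.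
rewrite -/L; set t := Cmod _; have t2 := pow2_ge_0 t; simpl in t2 |- *.
have : 0 <= M * M * (t * (t * 1)) by apply: Rmult_le_pos.
lra.
Qed.

Lemma hol_ext f f' g g' z0 d : 0 < d ->
  (forall z, Cmod (z - z0) < d -> f z = g z /\ f' z = g' z) -> hol f f' z0 -> hol g g' z0.
Proof.
move=> d0 e [d' [M [hd [hM h]]]].
exists (Rmin d d'), M; split.
  by split; [apply: Rmin_pos; lra | have := Rmin_r d d'; lra].
split=> // z z' hz hz'.
have [e1 e2] := e z (Rlt_le_trans _ _ _ hz (Rmin_l _ _)).
have [e1' _] := e z' (Rlt_le_trans _ _ _ hz' (Rmin_l _ _)).
rewrite -e1 -e2 -e1'; apply: h.
- exact: Rlt_le_trans hz (Rmin_r _ _).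
- exact: Rlt_le_trans hz' (Rmin_r _ _).
Qed.

Lemma hol_local f f' g z0 d : 0 < d -> (forall z, Cmod (z - z0) < d -> f z = g z) ->
  hol f f' z0 -> hol g f' z0.
Proof. by move=> d0 e; apply: (hol_ext d0) => z hz; rewrite e. Qed.

Lemma hol_opp_arg f f' z0 : hol f f' (- z0)%C ->
  hol (fun z => f (- z)%C) (fun z => - f' (- z)%C)%K z0.
Proof.
move=> [d [M [hd [hM h]]]]; exists d, M; split=> //; split=> // z z' hz hz'.
have e1 a : Cmod (- a - - z0)%C = Cmod (a - z0)%C.
  by rewrite -Cmod_opp; congr Cmod; ring.
have [h1 [h2 h3]] := h (- z)%C (- z')%C ltac:(by rewrite e1) ltac:(by rewrite e1).
split=> //; split; first by rewrite normN.
have e2 : (- z' - - z = - (z' - z))%C by ring.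
move: h3; rewrite e2 Cmod_opp cxN.
by rewrite (_ : sub _ _ = (f (- z')%C - f (- z)%C - cx K (z' - z) * - f' (- z)%C)%K);
  last by ring.
Qed.

Lemma hol_inv_near q q' z0 : hol q q' z0 -> invertible (q z0) ->
  exists d, 0 < d /\ forall z, Cmod (z - z0) < d ->
    invertible (q z) /\ norm (kinv (q z)) <= 2 * norm (kinv (q z0)).
Proof.
move=> hq qi.
have n0 := norm_ge_0 (kinv (q z0)).
have [|d [d0 h]] := hol_cont (e := / 2 / (norm (kinv (q z0)) + 1)) hq.
  by apply: Rdiv_lt_0_compat; lra.
exists d; split=> // z hz; apply: invertible_near => //.
have h1 := h z hz; have h2 := norm_ge_0 (q z - q z0)%K.
apply: Rle_trans (_ : / 2 / (norm (kinv (q z0)) + 1) * (norm (kinv (q z0)) + 1) <= _);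
  last by right; field; lra.
apply: Rmult_le_compat => //; lra.
Qed.

(** With r = 1/q the remainder of r is that of q times - r^2, plus the term
   (q z' - q z)^2 r(z') r(z)^2, which is quadratic by the Lipschitz bound. *)
Lemma hol_inv q q' z0 : hol q q' z0 -> invertible (q z0) ->
  hol (fun z => kinv (q z)) (fun z => - (q' z * (kinv (q z) * kinv (q z))))%K z0.
Proof.
move=> hq qi; have [d1 [d10 near]] := hol_inv_near hq qi.
have [d [M [hd [hM h]]]] := hq.
have c1 := cx_bound_ge1 K.
pose B := 2 * norm (kinv (q z0)); have B0 : 0 <= B by rewrite /B; have := norm_ge_0 (kinv (q z0)); lra.
pose L := M * (cx_bound K + 2).
have L0 : 0 <= L by rewrite /L; nra.
exists (Rmin d d1), (B + M * (B * B) + (M * (B * B) + L * L * (B * (B * B)))).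
have BB : 0 <= B * B by nra.
have MB : 0 <= M * (B * B) by nra.
have LB : 0 <= L * L * (B * (B * B)) by apply: Rmult_le_pos; nra.
split; first by split; [apply: Rmin_pos; lra | have := Rmin_l d d1; lra].
split; first lra.
move=> z z' hz hz'.
have hz1 := Rlt_le_trans _ _ _ hz (Rmin_l _ _); have hz2 := Rlt_le_trans _ _ _ hz (Rmin_r _ _).
have hz1' := Rlt_le_trans _ _ _ hz' (Rmin_l _ _); have hz2' := Rlt_le_trans _ _ _ hz' (Rmin_r _ _).
have [i1 n1] := near z hz2; have [i2 n2] := near z' hz2'; rewrite -/B in n1 n2.
have [a1 [a2 a3]] := h z z' hz1 hz1'.
have e1 := kinvP i1; have e2 := kinvP i2.
set r := kinv (q z) in n1 e1 *; set r' := kinv (q z') in n2 e2 *.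
split; first lra.
have k := norm_mul_le a2 (norm_mul_le n1 n1).
split; first by rewrite normN; lra.
have lip := hol_on_lip (proj2 hd) hM h hz1 hz1'; rewrite -/L in lip.
rewrite (_ : sub _ _ = (- ((q z' - q z - cx K (z' - z) * q' z) * (r * r))
   + (q z' - q z) * (q z' - q z) * (r' * (r * r)))%K); last by ring [e1 e2].
apply: Rle_trans (normD _ _) _; rewrite normN.
have k1 := norm_mul_le a3 (norm_mul_le n1 n1).
have k2 := norm_mul_le (norm_mul_le lip lip) (norm_mul_le n2 (norm_mul_le n1 n1)).
apply: Rle_trans (Rplus_le_compat _ _ _ _ k1 k2) _.
set t := Cmod _; have t2 := pow2_ge_0 t.
have : 0 <= (B + M * (B * B)) * t ^ 2 by apply: Rmult_le_pos; lra.
simpl; lra.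
Qed.

End Holomorphic.

(** * The mean value property *)

Section MeanValue.
Variable K : cba.
Implicit Types (f g : C -> K) (z w : C).

Add Ring Kring : (cba_ring K).

Definition circle_pt (r t : R) : C := (r * cos t, r * sin t).

Lemma Cmod_le1 z : Cmod z <= Rabs (fst z) + Rabs (snd z).
Proof.
have a := Rabs_pos (fst z); have b := Rabs_pos (snd z).
rewrite -[X in _ <= X]sqrt_pow2; last lra.
apply: sqrt_le_1_alt; rewrite -(pow2_abs (fst z)) -(pow2_abs (snd z)); nra.
Qed.

Lemma Cmod_circle_pt r t : 0 <= r -> Cmod (circle_pt r t) = r.
Proof.
move=> r0; rewrite /Cmod /circle_pt /=.
rewrite (_ : _ + _ = r ^ 2); first exact: sqrt_pow2.
have := sin2_cos2 t; rewrite /Rsqr => h; nra.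
Qed.

Lemma cos_lt1 t : 0 < t < 2 * PI -> cos t < 1.
Proof.
move=> ht; have -> : t = 2 * (t / 2) by field.
rewrite cos_2a_sin; have : 0 < sin (t / 2) by apply: sin_gt_0; lra.
nra.
Qed.

(** Compactness of the disc makes the radius and the constant uniform. A single
   positive number is attached to each point of a square around the disc, half
   the distance to the disc outside it, and inside it a number whose inverse
   also bounds the remainder. *)
Lemma hol_uniform f (R0 : R) : (forall z, Cmod z <= R0 -> exists f', hol f f' z) ->
  exists (d M : R) (f' : C -> K), 0 < d /\ 0 <= M /\
    forall z z', Cmod z <= R0 -> Cmod (z' - z) < d ->
    norm (f z' - f z - cx K (z' - z) * f' z)%K <= M * Cmod (z' - z) ^ 2.
Proof.
move=> hf.
pose ok (u v : R) (d : posreal) :=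
  (R0 < Cmod (u, v) -> 2 * d <= Cmod (u, v) - R0) /\
  (Cmod (u, v) <= R0 -> exists f', hol_on f f' (u, v) (4 * d) (/ d)).
have ex u v : exists d, ok u v d.
  case: (Rle_lt_dec (Cmod (u, v)) R0) => h.
    have [f' [d [M [hd [hM h1]]]]] := hf _ h.
    have p0 : 0 < Rmin (d / 4) (/ (M + 1)).
      by apply: Rmin_pos; [lra | apply: Rinv_0_lt_compat; lra].
    exists (mkposreal _ p0); split; first lra.
    move=> _ /=; have m1 := Rmin_l (d / 4) (/ (M + 1)); have m2 := Rmin_r (d / 4) (/ (M + 1)).
    exists f'; apply: hol_on_mono h1; first lra.
    apply: Rle_trans (_ : / / (M + 1) <= _); first by rewrite Rinv_inv; lra.
    by apply: Rinv_le_contravar.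
  have p0 : 0 < (Cmod (u, v) - R0) / 2 by lra.
  by exists (mkposreal _ p0); split=> /=; lra.
pose D u v := epsilon (inhabits (mkposreal 1 Rlt_0_1)) (ok u v).
have hD u v : ok u v (D u v) by apply: epsilon_spec.
have [d hd] := compactness_value_2d (- R0) R0 (- R0) R0 D.
pose good z L := forall z', Cmod (z' - z) < d ->
  norm (f z' - f z - cx K (z' - z) * L)%K <= / d * Cmod (z' - z) ^ 2.
exists d, (/ d), (fun z => epsilon (inhabits nul) (good z)); split; first exact: cond_pos.
split; first by apply: Rlt_le; apply: Rinv_0_lt_compat; exact: cond_pos.
move=> z z' hz; move: z'; suff /epsilon_spec : exists L, good z L by apply.
have b1 : Rabs (fst z) <= R0 by apply: Rle_trans hz; apply: Rle_trans (Rmax_Cmod z); exact: Rmax_l.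
have b2 : Rabs (snd z) <= R0 by apply: Rle_trans hz; apply: Rle_trans (Rmax_Cmod z); exact: Rmax_r.
have [b1' b1''] := Rabs_le_between (fst z) R0; have [b2' b2''] := Rabs_le_between (snd z) R0.
have [u [v [_ [_ [h1 [h2 h3]]]]]] := NNPP _ (hd (fst z) (snd z) (b1' b1) (b2' b2)).
have [o1 o2] := hD u v.
have zuv : Cmod (z - (u, v)) < 2 * D u v.
  by apply: Rle_lt_trans (Cmod_le1 _) _; rewrite /= -!/(Rminus _ _); lra.
have D0 := cond_pos (D u v); have d0 := cond_pos d.
have uv : Cmod (u, v) <= R0.
  apply: Rnot_lt_le => h; have := o1 h.
  have : Cmod (u, v) <= Cmod z + Cmod (z - (u, v)).
    rewrite -(Cmod_opp (z - _)%C).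
    have -> : Cmod (u, v) = Cmod (z + - (z - (u, v)))%C.
      by congr Cmod; apply: injective_projections; rewrite /=; ring.
    exact: Cmod_triangle.
  lra.
have [f' hf'] := o2 uv; exists (f' z) => z' hz'.
have z'uv : Cmod (z' - (u, v)) < 4 * D u v.
  have -> : (z' - (u, v) = (z' - z) + (z - (u, v)))%C by ring.
  by apply: Rle_lt_trans (Cmod_triangle _ _) _; lra.
have [_ [_ h]] := hf' z z' ltac:(lra) z'uv.
apply: Rle_trans h _; apply: Rmult_le_compat_r; first exact: pow2_ge_0.
by apply: Rinv_le_contravar.
Qed.

Definition root_angle (N : nat) : R := 2 * PI / INR N.

Definition root_mean f (N : nat) (r : R) : K :=
  sc (/ INR N) (ksum (fun k => f (circle_pt r (INR k * root_angle N))) N).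

Lemma norm_root_mean (F : nat -> K) (b : R) N : (0 < N)%coq_nat ->
  (forall k, norm (F k) <= b) -> norm (sc (/ INR N) (ksum F N)) <= b.
Proof.
move=> N0 h; have n0 := lt_0_INR _ N0.
apply: Rle_trans (norm_sc _ _) _.
have i0 := Rinv_0_lt_compat _ n0.
rewrite Rabs_pos_eq; last lra.
have h1 := norm_ksum (N := N) (fun k _ => h k).
apply: Rle_trans (Rmult_le_compat_l _ _ _ (Rlt_le _ _ i0) h1) _.
by right; field; lra.
Qed.

Lemma root_mean_sub (F G : nat -> K) N :
  (sc (/ INR N) (ksum F N) - sc (/ INR N) (ksum G N))%K
  = sc (/ INR N) (ksum (fun k => F k - G k)%K N).
Proof.
rewrite !(scE _ (ksum _ _)).
have -> : ksum (fun k => F k - G k)%K N = (ksum F N - ksum G N)%K.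
  by elim: N => [|N IH] /=; [ring | rewrite IH; ring].
ring.
Qed.

Lemma root_mean_const (x : K) N : (0 < N)%coq_nat -> sc (/ INR N) (ksum (fun _ => x) N) = x.
Proof.
move=> N0; have n0 := lt_0_INR _ N0.
by rewrite ksum_const -scM Rinv_l ?sc1 //; lra.
Qed.

Definition root_step (N : nat) : C := (circle_pt 1 (root_angle N) - RtoC 1)%C.

Lemma circle_pt_step r N k : (circle_pt r (INR k.+1 * root_angle N) - circle_pt r (INR k * root_angle N)
  = circle_pt r (INR k * root_angle N) * root_step N)%C.
Proof.
rewrite S_INR Rmult_plus_distr_r Rmult_1_l /root_step /circle_pt.
by apply: injective_projections; rewrite /= ?cos_plus ?sin_plus; ring.
Qed.

Lemma root_step_neq0 N : (1 < N)%coq_nat -> root_step N <> RtoC 0.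
Proof.
move=> N1 h.
have n1 : 1 < INR N by rewrite -INR_1; exact: lt_INR.
have : cos (root_angle N) < 1.
  apply: cos_lt1; have := PI_RGT_0; rewrite /root_angle => p.
  split; first by apply: Rdiv_lt_0_compat; lra.
  by apply/Rlt_div_l; nra.
have := f_equal fst h; rewrite /root_step /circle_pt /=; lra.
Qed.

Lemma root_step_small (e : R) : 0 < e -> exists N0, forall N, (N0 <= N)%coq_nat -> (1 < N)%coq_nat ->
  Cmod (root_step N) < e.
Proof.
move=> e0.
have [d1 [d10 h1]] := continuity_cos 0 (e / 2) ltac:(lra).
have [d2 [d20 h2]] := continuity_sin 0 (e / 2) ltac:(lra).
have p := PI_RGT_0.
pose d := Rmin d1 d2; have d0 : 0 < d by exact: Rmin_pos.
have [N0 hN0] := INR_unbounded (2 * PI / d).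
exists N0 => N hN N1.
have n1 : 1 < INR N by rewrite -INR_1; exact: lt_INR.
have hd : 0 < root_angle N < d.
  split; first by apply: Rdiv_lt_0_compat; lra.
  have := le_INR _ _ hN => h; rewrite /root_angle.
  apply/Rlt_div_l; first lra.
  have q : d * (2 * PI / d) = 2 * PI by field; lra.
  have : d * (2 * PI / d) < d * INR N by apply: Rmult_lt_compat_l; lra.
  lra.
have [m1 m2] := (Rmin_l d1 d2, Rmin_r d1 d2); rewrite -/d in m1 m2.
have D a dd : 0 < a < dd -> D_x no_cond 0 a /\ Rabs (a - 0) < dd.
  by move=> [a0 ad]; split; [by split=> //; exact: Rlt_not_eq | rewrite Rminus_0_r Rabs_pos_eq; lra].
have {}h1 := h1 (root_angle N) (D (root_angle N) d1 ltac:(lra)).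
have {}h2 := h2 (root_angle N) (D (root_angle N) d2 ltac:(lra)).
rewrite /= /Rdist cos_0 sin_0 in h1 h2.
apply: Rle_lt_trans (Cmod_le1 _) _; rewrite /root_step /circle_pt /= !Rmult_1_l.
by have h3 := Rplus_lt_compat _ _ _ _ h1 h2; apply: Rlt_le_trans h3 _; lra.
Qed.

(** Both the tangential and the radial increment of f at a root are multiples
   of the same complex derivative, up to quadratic remainders. Eliminating the
   derivative leaves the tangential increments, which telescope around the
   circle. *)
Lemma root_mean_step f f' (R0 d M r h : R) N :
  (forall z z', Cmod z <= R0 -> Cmod (z' - z) < d ->
    norm (f z' - f z - cx K (z' - z) * f' z)%K <= M * Cmod (z' - z) ^ 2) ->
  0 <= M -> (1 < N)%coq_nat -> 0 < r <= R0 -> 0 < h < d -> R0 * Cmod (root_step N) < d ->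
  norm (root_mean f N (Rplus r h) - root_mean f N r)%K
    <= M * h ^ 2 + cx_bound K * M * h * R0 * Cmod (root_step N).
Proof.
move=> hf M0 N1 [r0 rR] [h0 hd] td.
have al := root_step_neq0 N1; have a0 := Cmod_ge_0 (root_step N).
have c1 := cx_bound_ge1 K.
pose F r k := f (circle_pt r (INR k * root_angle N)).
(* ratio of the radial increment to the tangential one, the same at every root *)
pose be := (RtoC (h / r) / root_step N)%C.
have tele : ksum (fun k => F r k.+1 - F r k)%K N = nul.
  rewrite ksum_tele /F /=.
  have -> : INR N * root_angle N = 0 + 2 * PI.
    by rewrite /root_angle; field; apply: not_0_INR; lia.
  rewrite Rmult_0_l /circle_pt (_ : 0 + 2 * PI = 0 + 2 * INR 1 * PI); last by rewrite /=; ring.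
  rewrite cos_period sin_period; ring.
have -> : (root_mean f N (Rplus r h) - root_mean f N r)%K = sc (/ INR N)
   (ksum (fun k => (F (Rplus r h) k - F r k) - cx K be * (F r k.+1 - F r k))%K N).
  rewrite /root_mean root_mean_sub; congr sc.
  transitivity (ksum (fun k => F (Rplus r h) k - F r k)%K N
     - cx K be * ksum (fun k => F r k.+1 - F r k)%K N)%K.
    have e x : (x - cx K be * nul = x)%K by ring.
    by rewrite tele e.
  rewrite -ksumM; move: (N) => N'.
  by elim: N' => [|N' IH] /=; [ring | rewrite -IH; ring].
apply: norm_root_mean; first lia.
move=> k; rewrite /F.
set z := circle_pt r (INR k * root_angle N); set zr := circle_pt (r + h) _.
set zt := circle_pt r (INR k.+1 * _).
have zn : Cmod z = r by apply: Cmod_circle_pt; lra.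
have ezr : (zr - z = z * RtoC (h / r))%C.
  by rewrite /zr /z /circle_pt; apply: injective_projections => /=; field; lra.
have ezt : (zt - z = z * root_step N)%C by exact: circle_pt_step.
have nzr : Cmod (zr - z) = h.
  rewrite ezr Cmod_mult zn Cmod_R Rabs_pos_eq; first by field; lra.
  by apply: Rlt_le; apply: Rdiv_lt_0_compat; lra.
have nzt : Cmod (zt - z) = r * Cmod (root_step N) by rewrite ezt Cmod_mult zn.
have k1 := hf z zr ltac:(lra) ltac:(lra).
have tl : r * Cmod (root_step N) <= R0 * Cmod (root_step N) by apply: Rmult_le_compat_r.
have k2 := hf z zt ltac:(lra) ltac:(lra).
have ebe : (be * (zt - z) = zr - z)%C.
  rewrite ezr ezt /be; field; exact: al.
have -> : (f zr - f z - cx K be * (f zt - f z) = (f zr - f z - cx K (zr - z) * f' z)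
   - cx K be * (f zt - f z - cx K (zt - z) * f' z))%K.
  have -> : cx K (zr - z) = (cx K be * cx K (zt - z))%K by rewrite -cxM ebe.
  ring.
apply: Rle_trans (normB _ _) _.
have k3 := norm_mul_le (norm_cx K be) k2.
apply: Rle_trans (Rplus_le_compat _ _ _ _ k1 k3) _.
rewrite nzr nzt.
have -> : Cmod be = h / r / Cmod (root_step N).
  rewrite /be Cmod_div // Cmod_R Rabs_pos_eq //.
  by apply: Rlt_le; apply: Rdiv_lt_0_compat; lra.
have tp : 0 < Cmod (root_step N) by apply/Cmod_gt_0.
have -> : h / r / Cmod (root_step N) * cx_bound K * (M * (r * Cmod (root_step N)) ^ 2)
   = cx_bound K * M * h * (r * Cmod (root_step N)) by field; lra.
rewrite (Rmult_assoc _ R0).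
have : cx_bound K * M * h * (r * Cmod (root_step N)) <= cx_bound K * M * h * (R0 * Cmod (root_step N)).
  by apply: Rmult_le_compat_l => //; repeat apply: Rmult_le_pos; lra.
lra.
Qed.

(** The radius is travelled in m equal steps. Each costs O(1/m^2) plus
   O(1/m) times the angular step, so the total is small once m is large and
   then N is large. *)
Theorem mean_value f (R0 : R) : 0 < R0 ->
  (forall z, Cmod z <= R0 -> exists f', hol f f' z) ->
  forall e, 0 < e -> exists N0, forall N, (N0 <= N)%coq_nat -> (1 < N)%coq_nat ->
    norm (root_mean f N R0 - f (RtoC 0))%K <= e.
Proof.
move=> R00 hf e e0.
have [d [M [f' [d0 [M0 hu]]]]] := hol_uniform hf.
have c1 := cx_bound_ge1 K.
pose c0 := cx_bound K * norm (f' (RtoC 0)).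
have c00 : 0 <= c0 by apply: Rmult_le_pos; [lra | exact: norm_ge_0].
(* m * (M h^2) + c0 h = B / m when h = R0 / m; c0 h is the first-order part of
   the first step, taken from the centre *)
pose B := M * R0 ^ 2 + c0 * R0.
have B0 : 0 <= B by rewrite /B; have := pow2_ge_0 R0; nra.
have [m hm] := INR_unbounded (R0 / d + 2 * B / e + 1).
have R0d : 0 < R0 / d by apply: Rdiv_lt_0_compat.
have Be : 0 <= 2 * B / e by apply: Rdiv_le_0_compat; lra.
have m0 : 0 < INR m by lra.
pose h := R0 / INR m.
have h0 : 0 < h by apply: Rdiv_lt_0_compat.
have mh : INR m * h = R0 by rewrite /h; field; lra.
have hd : h < d.
  have : d * (R0 / d) = R0 by field; lra.
  have : d * (R0 / d) < d * INR m by apply: Rmult_lt_compat_l; lra.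
  rewrite /h => q1 q2; apply/Rlt_div_l; lra.
have he : B / INR m <= e / 2.
  have q1 : e * (2 * B / e) = 2 * B by field; lra.
  have q2 : e * (2 * B / e) <= e * INR m by apply: Rmult_le_compat_l; lra.
  apply/Rle_div_l; lra.
pose c2 := cx_bound K * M * R0 * R0 + R0 + 1.
have c20 : 0 <= cx_bound K * M * R0 * R0 by repeat apply: Rmult_le_pos; lra.
have [|N0 hN0] := @root_step_small (Rmin (e / 2) d / c2).
  by apply: Rdiv_lt_0_compat; [apply: Rmin_pos; lra | rewrite /c2; lra].
exists N0 => N hN N1; have {hN0} ht := hN0 N hN N1.
set a := Cmod (root_step N) in ht; have a0 : 0 <= a := Cmod_ge_0 _.
have ca : c2 * a < Rmin (e / 2) d.
  have q : c2 * (Rmin (e / 2) d / c2) = Rmin (e / 2) d by field; rewrite /c2; lra.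
  by rewrite -q; apply: Rmult_lt_compat_l => //; rewrite /c2; lra.
have [m1 m2] := (Rmin_l (e / 2) d, Rmin_r (e / 2) d).
have c2a : 0 <= cx_bound K * M * R0 * R0 * a by exact: Rmult_le_pos.
have Ra : R0 * a < d by rewrite /c2 in ca; nra.
have Ra2 : cx_bound K * M * R0 * R0 * a <= e / 2 by rewrite /c2 in ca; nra.
have first_step : norm (root_mean f N h - f (RtoC 0))%K <= c0 * h + M * h ^ 2.
  rewrite -[f (RtoC 0)](@root_mean_const _ N) /root_mean ?root_mean_sub; last lia.
  apply: norm_root_mean => [|k]; first lia.
  set z := circle_pt h _; have zh : Cmod (z - RtoC 0) = h.
    by rewrite (_ : (z - RtoC 0 = z)%C); [apply: Cmod_circle_pt; lra | ring].
  have := hu (RtoC 0) z ltac:(rewrite Cmod_0; lra) ltac:(lra).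
  rewrite zh => k1.
  have k2 := norm_mul_le (norm_cx K (z - RtoC 0)) (Rle_refl (norm (f' (RtoC 0)))).
  rewrite zh in k2.
  have -> : (f z - f (RtoC 0) = (f z - f (RtoC 0) - cx K (z - RtoC 0) * f' (RtoC 0))
    + cx K (z - RtoC 0) * f' (RtoC 0))%K by ring.
  apply: Rle_trans (normD _ _) _; rewrite /c0; lra.
have steps j : INR j.+1 * h <= R0 ->
    norm (root_mean f N (Rmult (INR j.+1) h) - f (RtoC 0))%K
      <= c0 * h + M * h ^ 2 + INR j * (M * h ^ 2 + cx_bound K * M * h * R0 * a).
  elim: j => [|j IH] hj.
    by rewrite INR_1 Rmult_1_l /= Rmult_0_l Rplus_0_r; exact: first_step.
  have j0 := pos_INR j.
  rewrite [INR j.+2]S_INR Rmult_plus_distr_r Rmult_1_l in hj *.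
  have {}IH := IH ltac:(lra).
  have sj : 0 < INR j.+1 * h <= R0 by rewrite S_INR in hj *; split; [apply: Rmult_lt_0_compat; lra | lra].
  have k1 := root_mean_step hu M0 N1 sj (conj h0 hd) Ra.
  rewrite (_ : sub _ _ = (root_mean f N (Rplus (Rmult (INR j.+1) h) h) - root_mean f N (Rmult (INR j.+1) h)
    + (root_mean f N (Rmult (INR j.+1) h) - f (RtoC 0)))%K); last by ring.
  apply: Rle_trans (normD _ _) _; rewrite [INR j.+1]S_INR in k1 IH *; rewrite -/a in k1; lra.
case: m hm m0 h h0 mh hd he first_step steps => [|j] hm m0 h h0 mh hd he first_step steps.
  by rewrite /= in m0; lra.
have := steps j ltac:(lra); rewrite mh => k1; apply: Rle_trans k1 _.
have e1 : B / INR j.+1 = INR j.+1 * (M * h ^ 2) + c0 * h by rewrite /B -mh; field; lra.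
have e2 : INR j.+1 * (cx_bound K * M * h * R0 * a) = cx_bound K * M * R0 * R0 * a.
  by rewrite -[X in _ = _ * X * _ * _]mh; ring.
have e3 : 0 <= cx_bound K * M * h * R0 * a by repeat apply: Rmult_le_pos; lra.
rewrite S_INR in e1 e2 he; lra.
Qed.
End MeanValue.

(** * Spectral radius and sums of commuting elements *)

Section Spectral.
Variable K : cba.
Implicit Types (f g : C -> K) (z w : C) (x y : K).

Add Ring Kring : (cba_ring K).

Lemma circle_pt_pow r t j : Cpow (circle_pt r t) j = circle_pt (r ^ j) (INR j * t).
Proof.
elim: j => [|j IH].
  by rewrite /circle_pt Rmult_0_l cos_0 sin_0; apply: injective_projections => /=; ring.
rewrite S_INR Rmult_plus_distr_r Rmult_1_l [LHS]/= IH /circle_pt cos_plus sin_plus.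
by apply: injective_projections => /=; ring.
Qed.

(** Used for sums of powers of roots of unity, where only the power 0 survives. *)
Lemma ksum_first (F : nat -> K) N : (0 < N)%coq_nat ->
  (forall k, ((0 < k)%coq_nat /\ (k < N)%coq_nat) -> F k = nul) -> ksum F N = F 0%N.
Proof.
case: N => [|N _]; first by lia.
elim: N => [|N IH] h; first by rewrite /=; ring.
rewrite (_ : ksum F N.+2 = (ksum F N.+1 + F N.+1)%K) // IH => [|k hk]; last by apply: h; lia.
by rewrite (h N.+1); [ring | lia].
Qed.

Lemma root_sum (s : R) j N : ((0 < j)%coq_nat /\ (j < N)%coq_nat) ->
  ksum (fun k => cx K (circle_pt s (INR j * (INR k * root_angle N)))) N = nul.
Proof.
move=> hj; set P := fun k => _.
pose om := (circle_pt 1 (INR j * root_angle N) - RtoC 1)%C.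
have j0 : 0 < INR j by apply: lt_0_INR; lia.
have jN : INR j < INR N by apply: lt_INR; lia.
have om0 : om <> RtoC 0.
  move=> h; have := f_equal fst h; rewrite /om /circle_pt /=.
  have : cos (INR j * root_angle N) < 1; last by lra.
  apply: cos_lt1; have p := PI_RGT_0; rewrite /root_angle.
  split; first by apply: Rmult_lt_0_compat => //; apply: Rdiv_lt_0_compat; lra.
  have -> : INR j * (2 * PI / INR N) = INR j * (2 * PI) / INR N by field; lra.
  by apply/Rlt_div_l; nra.
have tele : (cx K om * ksum P N)%K = nul.
  rewrite -ksumM.
  rewrite (@ksum_ext _ _ (fun k => P k.+1 - P k)%K) => [|k _].
    rewrite ksum_tele /P.
    have -> : INR j * (INR N * root_angle N) = 0 + 2 * INR j * PI by rewrite /root_angle; field; lra.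
    have -> : INR j * (INR 0 * root_angle N) = 0 by rewrite /=; ring.
    rewrite /circle_pt cos_period sin_period; ring.
  rewrite /P -cxM -cxB; congr (cx K _); rewrite S_INR.
  have -> : INR j * ((INR k + 1) * root_angle N) = INR j * (INR k * root_angle N) + INR j * root_angle N by ring.
  rewrite /om /circle_pt cos_plus sin_plus.
  by apply: injective_projections => /=; ring.
have h := cx_inv K om0.
transitivity (cx K om * cx K (/ om)%C * ksum P N)%K; first by rewrite h; ring.
transitivity (cx K (/ om)%C * (cx K om * ksum P N))%K; first by ring.
rewrite tele; ring.
Qed.

(** Averaging the geometric series over roots of unity keeps only its terms of
   degree divisible by N. *)
Lemma root_mean_resolvent x (r : R) N : (0 < N)%coq_nat ->
  (forall z, Cmod z <= r -> invertible (one - cx K z * x)%K) -> 0 <= r ->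
  ((one - sc (r ^ N) (kpow x N)) * root_mean (fun z => kinv (one - cx K z * x)%K) N r)%K = one.
Proof.
move=> N0 hx r0; have n0 : 0 < INR N by exact: lt_0_INR.
have key k : ((one - sc (r ^ N) (kpow x N)) * kinv (one - cx K (circle_pt r (INR k * root_angle N)) * x)
    = ksum (fun j => kpow x j * cx K (circle_pt (r ^ j) (INR j * (INR k * root_angle N)))) N)%K.
  set z := circle_pt r _.
  have zi := kinvP (hx z ltac:(rewrite Cmod_circle_pt; lra)).
  have zN : (sc (r ^ N) (kpow x N) = kpow (cx K z * x) N)%K.
    rewrite powM pow_cx circle_pt_pow scE_cx; congr (mul (cx K _) _).
    have -> : INR N * (INR k * root_angle N) = 0 + 2 * INR k * PI by rewrite /root_angle; field; lra.
    rewrite /circle_pt cos_period sin_period cos_0 sin_0.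
    by apply: injective_projections => /=; ring.
  rewrite zN -geom_sum.
  transitivity ((one - cx K z * x) * kinv (one - cx K z * x) * ksum (kpow (cx K z * x)%K) N)%K.
    ring.
  rewrite zi mul1; apply: ksum_ext => j _.
  by rewrite powM pow_cx circle_pt_pow mulC.
rewrite /root_mean (scE _ (ksum _ _)) mulA (mulC _ (sc (/ _) _)) -mulA -ksumM.
rewrite (ksum_ext (fun k _ => key k)) ksum_swap.
rewrite ksum_first //.
  rewrite (@ksum_ext _ _ (fun _ => one)) => [|k _].
    by rewrite ksum_const -scE -scM Rinv_l ?sc1 //; lra.
  rewrite /= Rmult_0_l /circle_pt cos_0 sin_0 (_ : cx K _ = one) ?mul1 //.
  by rewrite -cx1; congr (cx K _); apply: injective_projections => /=; ring.
move=> j hj; rewrite ksumM root_sum //; ring.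
Qed.

Lemma hol_resolvent x z0 : invertible (one - cx K z0 * x)%K ->
  exists f', hol (fun z => kinv (one - cx K z * x)%K) f' z0.
Proof.
move=> h; eexists; apply: hol_inv h.
have h1 := hol_mul (hol_cx K z0) (hol_const (- x)%K z0).
apply: (hol_ext (d := 1)) (hol_add (hol_const one z0) h1) => [|z _]; first lra.
split; first by ring.
by reflexivity.
Qed.

(** The mean of (1 - z x)^-1 over the circle of radius 1/r is the inverse of
   1 - (x/r)^N, and it tends to the value 1 at the centre. Hence (x/r)^N tends
   to 0. *)
Lemma power_bound x (r : R) : 0 < r ->
  (forall w, r <= Cmod w -> invertible (cx K w - x)%K) ->
  exists B, 0 <= B /\ forall N, norm (kpow x N) <= B * r ^ N.
Proof.
move=> r0 hx.
have ir := Rinv_0_lt_compat _ r0.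
have hz z : Cmod z <= / r -> invertible (one - cx K z * x)%K.
  move=> hz; case: (Ceq_dec z (RtoC 0)) => [->|z0].
    by rewrite cx0; exists one; rewrite /inv_pair; ring.
  have -> : (one - cx K z * x = cx K z * (cx K (/ z)%C - x))%K.
    have h := cx_inv K z0; ring [h].
  apply: mul_invertible; first exact: invertible_cx.
  apply: hx; rewrite Cmod_inv //.
  have p : 0 < Cmod z by apply/Cmod_gt_0.
  by rewrite -(Rinv_inv r); apply: Rinv_le_contravar.
have half0 : 0 < / 2 by lra.
have [N0 hN0] := mean_value ir (fun z h => hol_resolvent (hz z h)) half0.
have big N : (N0.+2 <= N)%coq_nat -> norm (kpow x N) <= 1 * r ^ N.
  move=> hN; have {hN0} := hN0 N ltac:(lia) ltac:(lia).
  rewrite cx0 (@kinv_eq _ _ one); last by ring.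
  have := @root_mean_resolvent x (/ r) N ltac:(lia) hz ltac:(lra).
  set U := root_mean _ _ _; set y := sc _ _ => hU Un.
  have e : y = ((U - one) * (one - y))%K.
    transitivity ((one - y) * U - one + y)%K; [rewrite hU; ring | ring].
  have ny : norm y <= 1.
    have h1 : norm (one - y)%K <= 1 + norm y.
      by apply: Rle_trans (normB _ _) _; apply: Rplus_le_compat_r; exact: norm_one.
    have := norm_mul_le Un h1; rewrite -e; lra.
  have -> : kpow x N = sc (r ^ N) y.
    by rewrite /y -scM -Rpow_mult_distr Rinv_r ?pow1 ?sc1 //; lra.
  have p : 0 < r ^ N by exact: pow_lt.
  apply: Rle_trans (norm_sc _ _) _; rewrite Rabs_pos_eq; nra.
have [B [B1 hB]] : exists B, 1 <= B /\ forall N, (N < N0.+2)%coq_nat ->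
    norm (kpow x N) <= B * r ^ N.
  elim: N0.+2 => [|m [B [B1 IH]]]; first by exists 1; split; [lra | lia].
  have p : 0 < r ^ m by exact: pow_lt.
  have n0 := norm_ge_0 (kpow x m).
  have q0 : 0 <= norm (kpow x m) / r ^ m by apply: Rdiv_le_0_compat.
  exists (B + norm (kpow x m) / r ^ m); split; first lra.
  move=> N hN; have pN : 0 < r ^ N by exact: pow_lt.
  case: (Nat.eq_dec N m) => [->|Nm].
    have -> : (B + norm (kpow x m) / r ^ m) * r ^ m = B * r ^ m + norm (kpow x m) by field; lra.
    nra.
  have := IH N ltac:(lia); nra.
exists B; split; first lra; move=> N; case: (Nat.le_gt_cases N0.+2 N) => h.
  have := big N h; have : 0 < r ^ N by exact: pow_lt.
  nra.
exact: hB.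
Qed.

(** Some power of x/w has norm less than 1, and 1 - (x/w)^N has 1 - x/w as a
   factor. *)
Lemma power_bound_inv x (B r : R) w : 0 <= B -> 0 <= r ->
  (forall N, norm (kpow x N) <= B * r ^ N) -> r < Cmod w -> invertible (cx K w - x)%K.
Proof.
move=> B0 r0 hx rw.
have w0 : w <> RtoC 0 by move=> h; rewrite h Cmod_0 in rw; lra.
have c1 := cx_bound_ge1 K.
have q0 : 0 <= r / Cmod w by apply: Rdiv_le_0_compat; lra.
have q1 : r / Cmod w < 1 by apply/Rlt_div_l; lra.
have Bc : 0 <= B * cx_bound K by apply: Rmult_le_pos; lra.
have [|N hN] := pow_lt_1_zero (r / Cmod w) _ (/ (B * cx_bound K + 1)) ltac:(apply: Rinv_0_lt_compat; lra).
  by rewrite Rabs_pos_eq.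
have {hN} := hN N (Nat.le_refl _); rewrite Rabs_pos_eq => [hN|]; last exact: pow_le.
pose u := (cx K (/ w)%C * x)%K.
have nu : norm (kpow u N) < 1.
  rewrite /u powM pow_cx.
  apply: Rle_lt_trans (norm_mul_le (norm_cx K _) (hx N)) _.
  have wp : 0 < Cmod w by lra.
  have -> : Cmod (Cpow (/ w) N) = / (Cmod w) ^ N.
    by rewrite -pow_inv -Cmod_inv //; elim: (N) => [|m IH] /=; [exact: Cmod_1 | rewrite Cmod_mult IH].
  have -> : / Cmod w ^ N * cx_bound K * (B * r ^ N) = B * cx_bound K * (r / Cmod w) ^ N.
    by rewrite /Rdiv Rpow_mult_distr pow_inv; ring.
  have p0 : 0 <= (r / Cmod w) ^ N by exact: pow_le.
  have : (B * cx_bound K + 1) * (r / Cmod w) ^ N < (B * cx_bound K + 1) * / (B * cx_bound K + 1).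
    by apply: Rmult_lt_compat_l; lra.
  rewrite Rinv_r; lra.
have h := neumann nu; rewrite -geom_sum in h.
have -> : (cx K w - x = cx K w * (one - u))%K.
  by have e := cx_inv K w0; rewrite /u; ring [e].
apply: mul_invertible; first exact: invertible_cx.
exact: invertible_mul h.
Qed.

Lemma invertible_large x w : norm x < Cmod w -> invertible (cx K w - x)%K.
Proof.
apply: (@power_bound_inv x 1); [lra | exact: norm_ge_0 |].
by move=> N; rewrite Rmult_1_l; exact: norm_pow.
Qed.

(** The factor x^i y^j carried through the induction replaces the binomial
   formula. *)
Lemma power_bound_add x y (B D r s : R) : 0 <= B -> 0 <= D -> 0 <= r -> 0 <= s ->
  (forall N, norm (kpow x N) <= B * r ^ N) -> (forall N, norm (kpow y N) <= D * s ^ N) ->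
  forall N, norm (kpow (x + y)%K N) <= B * D * (r + s) ^ N.
Proof.
move=> B0 D0 r0 s0 hx hy.
have h N : forall i j, norm (kpow (x + y)%K N * (kpow x i * kpow y j))%K
    <= B * D * (r + s) ^ N * (r ^ i * s ^ j).
  elim: N => [|N IH] i j.
    rewrite [kpow _ 0]/= mul1.
    by apply: Rle_trans (norm_mul_le (hx i) (hy j)) _; rewrite /=; lra.
  have -> : (kpow (x + y) N.+1 * (kpow x i * kpow y j)
     = kpow (x + y) N * (kpow x i.+1 * kpow y j) + kpow (x + y) N * (kpow x i * kpow y j.+1))%K.
    by rewrite /=; ring.
  apply: Rle_trans (normD _ _) _.
  apply: Rle_trans (Rplus_le_compat _ _ _ _ (IH i.+1 j) (IH i j.+1)) _.
  by rewrite /=; lra.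
move=> N; have := h N 0%N 0%N; rewrite /= !Rmult_1_r.
by rewrite (_ : (_ * (one * one) = kpow (x + y) N)%K) //; ring.
Qed.

Definition nonneg_spectrum x := forall w, ~ (snd w = 0 /\ 0 <= fst w) -> invertible (cx K w - x)%K.

(** The centre is M/2 - i s with s large and of the sign of Im w, or with M
   large when w is a negative real; the radius barely exceeds the distance of
   the centre to 0 and to M. *)
Lemma separating_disc w m : ~ (snd w = 0 /\ 0 <= fst w) -> exists (c : C) (r : R),
  0 < r /\ r < Cmod (w - c) /\
  forall v, snd v = 0 -> 0 <= fst v -> fst v <= m -> Cmod (v - c) < r.
Proof.
move=> hw.
have [M [s [mM hM]]] : exists M s : R, m <= M /\ 0 <= M /\
    M ^ 2 / 4 + 1 < (fst w - M / 2) ^ 2 + snd w ^ 2 + 2 * snd w * s.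
  have m0 := Rabs_pos m; have mm := Rle_abs m.
  case: (Req_dec (snd w) 0) => b0.
    have a0 : fst w < 0 by apply: Rnot_le_lt => h; apply: hw.
    have p : 0 < 2 / - fst w by apply: Rdiv_lt_0_compat; lra.
    exists (Rabs m + 2 / - fst w), 0; split; first lra; split; first lra.
    have e : fst w * (2 / - fst w) = - 2 by field; lra.
    by rewrite b0; nra.
  exists (Rabs m), ((Rabs m ^ 2 / 4 + 2) / (2 * snd w)); split=> //; split=> //.
  have -> : 2 * snd w * ((Rabs m ^ 2 / 4 + 2) / (2 * snd w)) = Rabs m ^ 2 / 4 + 2 by field.
  have := pow2_ge_0 (fst w - Rabs m / 2); have := pow2_ge_0 (snd w); lra.
have [M0 {}hM] := hM.
have pos := pow2_ge_0 s; have posM := pow2_ge_0 M.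
exists (M / 2, - s), (sqrt (M ^ 2 / 4 + s ^ 2 + 1)); split; first by apply: sqrt_lt_R0; lra.
split; first by apply: sqrt_lt_1_alt; rewrite /=; split; [nra | simpl in hM; nra].
move=> v v0 v1 v2; apply: sqrt_lt_1_alt; rewrite /= v0; split.
  by have q := pow2_ge_0 (fst v + - (M / 2)); simpl in q, pos; lra.
have : fst v * (M - fst v) >= 0 by apply: Rle_ge; apply: Rmult_le_pos; lra.
nra.
Qed.

(** A point w off the half-line is separated by w/2 outside a disc that
   contains both spectra. Centring x and y at the centre of the disc turns this
   into power bounds, and these add up: the spectrum of x + y lies in the disc
   with twice the centre and twice the radius. *)
Lemma nonneg_spectrum_add x y : nonneg_spectrum x -> nonneg_spectrum y -> nonneg_spectrum (x + y)%K.
Proof.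
move=> hx hy w hw.
have hv : ~ (snd (w / RtoC 2)%C = 0 /\ 0 <= fst (w / RtoC 2)%C).
  have e : (w / RtoC 2)%C = (fst w / 2, snd w / 2).
    by apply: injective_projections => /=; field.
  by rewrite e /= => -[h1 h2]; apply: hw; split; lra.
have [c [r [r0 [out ins]]]] := separating_disc (norm x + norm y) hv.
have nx := norm_ge_0 x; have ny := norm_ge_0 y.
have shift u : nonneg_spectrum u -> norm u <= norm x + norm y ->
    exists B, 0 <= B /\ forall N, norm (kpow (u - cx K c)%K N) <= B * r ^ N.
  move=> hu nu; apply: power_bound => // v hv'.
  have -> : (cx K v - (u - cx K c) = cx K (v + c)%C - u)%K by rewrite cxD; ring.
  case: (classic (snd (v + c)%C = 0 /\ 0 <= fst (v + c)%C)) => [[h1 h2]|]; last exact: hu.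
  apply: invertible_large.
  apply: Rnot_le_lt => h3.
  have h4 : fst (v + c)%C <= norm x + norm y.
    apply: Rle_trans (Rle_abs _) _; apply: Rle_trans (Rle_trans _ _ _ (Rmax_l _ _) (Rmax_Cmod _)) _.
    lra.
  have := ins _ h1 h2 h4; rewrite (_ : (v + c - c = v)%C); [lra | ring].
have [B [B0 hB]] := shift x hx ltac:(lra).
have [D [D0 hD]] := shift y hy ltac:(lra).
have h := power_bound_add B0 D0 (Rlt_le _ _ r0) (Rlt_le _ _ r0) hB hD.
have BD : 0 <= B * D by exact: Rmult_le_pos.
have h1 : r + r < Cmod (w - (c + c)).
  have -> : (w - (c + c) = RtoC 2 * (w / RtoC 2 - c))%C.
    by field; apply: RtoC_neq; lra.
  rewrite Cmod_mult Cmod_R Rabs_pos_eq; lra.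
have rr : 0 <= r + r by lra.
have := power_bound_inv BD rr h h1.
by rewrite cxB cxD (_ : (_ - _ = cx K w - (x + y))%K) //; ring.
Qed.

Lemma nonneg_spectrum_nul : nonneg_spectrum (nul : K).
Proof.
move=> w hw; rewrite (_ : (_ - _)%K = cx K w); last by ring.
by apply: invertible_cx => h; apply: hw; rewrite h /=; lra.
Qed.

(** * Division by the quadratic pencil *)

Variable A : K.

Definition pencil (z : C) : K := (cx K (z * z)%C + A)%K.
Definition pencil_inv (z : C) : K := kinv (pencil z).

Lemma hol_pencil z0 : hol pencil (fun z => cx K z + cx K z)%K z0.
Proof.
apply: (hol_ext (d := 1))
  (hol_add (hol_mul (hol_cx K z0) (hol_cx K z0)) (hol_const A z0)) => [|z _]; first lra.
by rewrite /pencil cxM; split; [reflexivity | ring].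
Qed.

Lemma hol_pencil_inv z0 : invertible (pencil z0) ->
  hol pencil_inv (fun z => - ((cx K z + cx K z) * (pencil_inv z * pencil_inv z)))%K z0.
Proof. exact: hol_inv (hol_pencil z0). Qed.

Lemma pencil_inv_large z : z <> RtoC 0 -> norm (A * cx K (/ (z * z))%C)%K <= / 2 ->
  invertible (pencil z) /\
  forall x, norm (cx K (z * z)%C * pencil_inv z * x - x)%K
    <= 2 * norm (A * cx K (/ (z * z))%C)%K * norm x.
Proof.
move=> z0; have zz : (z * z)%C <> RtoC 0 by exact: Cmult_neq_0.
set y := (A * _)%K => hy.
have e : pencil z = (cx K (z * z)%C * (one + y))%K.
  by have h := cx_inv K zz; rewrite /pencil /y; ring [h].
have qi : invertible (pencil z).
  by rewrite e; apply: mul_invertible; [exact: invertible_cx | exact: neumann_half].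
split=> // x; have h := kinvP qi; rewrite -/(pencil_inv z) e in h.
have [_ k] := @neumann_bound _ y (cx K (z * z)%C * pencil_inv z)%K hy ltac:(rewrite -[RHS]h; ring).
rewrite (_ : (_ - x = (cx K (z * z)%C * pencil_inv z - one) * x)%K); last by ring.
by apply: norm_mul_le => //; exact: Rle_refl.
Qed.

(** The quotient of z^2 D by the pencil is z^2 Q_z D off the spectrum, and the
   given F continues it across the spectrum. This entire function tends to D at
   infinity while its means over large circles tend to its value 0 at 0. *)
Theorem entire_division (D : K) (F : C -> K) :
  F (RtoC 0) = nul ->
  (forall z0, ~ invertible (pencil z0) ->
     (exists F', hol F F' z0) /\
     exists d, 0 < d /\ forall z, Cmod (z - z0) < d -> (pencil z * F z)%K = (cx K (z * z)%C * D)%K) ->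
  D = nul.
Proof.
move=> F0 hF.
pose f z := if excluded_middle_informative (invertible (pencil z))
  then (cx K (z * z)%C * pencil_inv z * D)%K else F z.
have fhol z0 : exists f', hol f f' z0.
  case: (classic (invertible (pencil z0))) => h.
    have [d [d0 near]] := hol_inv_near (hol_pencil z0) h.
    have hh := hol_mul (hol_mul (hol_mul (hol_cx K z0) (hol_cx K z0)) (hol_pencil_inv h)) (hol_const D z0).
    eexists; apply: (hol_local d0) hh => z hz.
    by rewrite /f cxM; case: excluded_middle_informative => // -[]; have [] := near z hz.
  have [[F' hF'] [d [d0 hd]]] := hF z0 h.
  exists F'; apply: (hol_local d0) hF' => z hz.
  rewrite /f; case: excluded_middle_informative => [zi|//] /=.
  have := kinvP zi; rewrite -/(pencil_inv z) => e.
  transitivity (pencil z * pencil_inv z * F z)%K; first by rewrite e; ring.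
  transitivity (pencil_inv z * (pencil z * F z))%K; first by ring.
  by rewrite (hd z hz); ring.
have f0 : f (RtoC 0) = nul.
  rewrite /f; case: excluded_middle_informative => [a|//] /=.
  rewrite (_ : cx K _ = nul); [ring | rewrite -cx0; congr (cx K _); ring].
apply: norm0_eq; apply: le_epsilon => e e0; rewrite Rplus_0_l.
have c1 := cx_bound_ge1 K.
have nA := norm_ge_0 A; have nD := norm_ge_0 D.
pose B := norm A * cx_bound K * (2 * norm D + 2).
have B0 : 0 <= B by repeat apply: Rmult_le_pos; lra.
pose r := 1 + B / (Rmin 1 (e / 2)).
have m0 : 0 < Rmin 1 (e / 2) by apply: Rmin_pos; lra.
have r1 : 1 <= r by rewrite /r; have := Rdiv_le_0_compat _ _ B0 m0; lra.
have small z : Cmod z = r -> norm (f z - D)%K <= e / 2.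
  move=> zr; have z0 : z <> RtoC 0 by move=> h; rewrite h Cmod_0 in zr; lra.
  have yn : norm (A * cx K (/ (z * z))%C)%K * (2 * norm D + 2) <= Rmin 1 (e / 2).
    have h := norm_mul_le (Rle_refl (norm A)) (norm_cx K (/ (z * z))%C).
    apply: Rle_trans (Rmult_le_compat_r _ _ _ _ h) _; first lra.
    rewrite (Cmod_inv _ (Cmult_neq_0 _ _ z0 z0)) Cmod_mult zr.
    have -> : norm A * (/ (r * r) * cx_bound K) * (2 * norm D + 2) = B / (r * r).
      by rewrite /B; field; lra.
    apply/Rle_div_l; first nra.
    apply: Rle_trans (_ : Rmin 1 (e / 2) * r <= _).
      have -> : Rmin 1 (e / 2) * r = Rmin 1 (e / 2) + B by rewrite /r; field; lra.
      lra.
    by apply: Rmult_le_compat_l; nra.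
  set y := norm (A * _)%K in yn *.
  have y0 : 0 <= y := norm_ge_0 _.
  have [m1 m2] := (Rmin_l 1 (e / 2), Rmin_r 1 (e / 2)).
  have yD : 0 <= y * norm D by exact: Rmult_le_pos.
  have [qi k] := @pencil_inv_large z z0 ltac:(rewrite -/y; lra).
  rewrite /f; case: excluded_middle_informative => [a|//] /=.
  by apply: Rle_trans (k D) _; rewrite -/y; lra.
have [N hN] := @mean_value _ f r ltac:(lra) (fun z _ => fhol z) (e / 2) ltac:(lra).
have {hN} := hN N.+2 ltac:(lia) ltac:(lia); rewrite f0.
move: N.+2 (Nat.lt_0_succ N.+1) => {}N N0 k1.
have k2 : norm (root_mean f N r - D)%K <= e / 2.
  rewrite -[D](@root_mean_const _ _ N) // /root_mean root_mean_sub; apply: norm_root_mean => // k.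
  by apply: small; rewrite Cmod_circle_pt; lra.
have -> : D = ((root_mean f N r - nul) - (root_mean f N r - D))%K by ring.
by apply: Rle_trans (normB _ _) _; lra.
Qed.
End Spectral.

(** * Contour integrals *)

(** Bounded linear maps commute with Riemann sums, hence with the integral. *)
Lemma is_RInt_linear (U W : NormedModule R_AbsRing) (L : U -> W) (f : R -> U) a b l :
  is_linear L -> is_RInt f a b l -> is_RInt (fun t => L (f t)) a b (L l).
Proof.
move=> hL hf; rewrite /is_RInt.
apply: (filterlim_ext (fun ptd => L (scal (sign (b - a)) (Riemann_sum f ptd)))).
  move=> ptd; rewrite (linear_scal _ hL); congr scal.
  apply: (SF_cons_ind (fun s => L (Riemann_sum f s) = Riemann_sum (fun t => L (f t)) s)).
    by move=> x0; exact: linear_zero.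
  by move=> h s IH; rewrite !Riemann_sum_cons (linear_plus _ hL) (linear_scal _ hL) IH.
apply: filterlim_comp hf _; exact: linear_cont.
Qed.

Lemma normC (z : C) : norm (z : C_R_NormedModule) = Cmod z.
Proof.
by rewrite /norm /= /prod_norm /Cmod /norm /= /abs /=; congr sqrt;
  rewrite -!/(pow _ 2) !pow2_abs.
Qed.

Section Contour.
Variable K : cba.
Implicit Types (phi psi F : C -> K) (gam : R -> C).

Add Ring Kring : (cba_ring K).
Ltac kring := match goal with |- @eq _ ?x ?y => change (x = y :> K); ring end.

Lemma continuousE (W : NormedModule R_AbsRing) (f : R -> W) (x : R) :
  continuous f x <-> forall e, 0 < e ->
    exists d, 0 < d /\ forall t, Rabs (t - x) < d -> norm (minus (f t) (f x)) < e.
Proof.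
rewrite /continuous (filterlim_locally_ball_norm f (f x)); split=> h.
  move=> e e0; have [d hd] := h (mkposreal e e0).
  by exists d; split; [exact: cond_pos | move=> t ht; apply: hd].
move=> e; have [d [d0 hd]] := h e (cond_pos e).
by exists (mkposreal d d0) => t ht; apply: hd.
Qed.

Lemma continuous_mul (f g : R -> K) (x : R) :
  continuous f x -> continuous g x -> continuous (fun t => f t * g t)%K x.
Proof.
move=> /continuousE hf /continuousE hg; apply/continuousE => e e0.
have n1 := norm_ge_0 (f x); have n2 := norm_ge_0 (g x).
pose M := norm (f x) + norm (g x) + 1.
have eM : 0 < Rmin 1 (e / (2 * M)).
  by apply: Rmin_pos; [lra | apply: Rdiv_lt_0_compat; rewrite /M; lra].
have [m1 m2] := (Rmin_l 1 (e / (2 * M)), Rmin_r 1 (e / (2 * M))).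
have [d1 [d10 h1]] := hf _ eM; have [d2 [d20 h2]] := hg _ eM.
exists (Rmin d1 d2); split; first exact: Rmin_pos.
move=> t ht.
have {}h1 := h1 t (Rlt_le_trans _ _ _ ht (Rmin_l _ _)).
have {}h2 := h2 t (Rlt_le_trans _ _ _ ht (Rmin_r _ _)).
change (norm (f t - f x)%K < Rmin 1 (e / (2 * M))) in h1.
change (norm (g t - g x)%K < Rmin 1 (e / (2 * M))) in h2.
change (norm (f t * g t - f x * g x)%K < e).
have -> : (f t * g t - f x * g x = (f t - f x) * (g t - g x)
   + (f t - f x) * g x + f x * (g t - g x))%K by ring.
have k1 := norm_mul_le (Rlt_le _ _ h1) (Rlt_le _ _ h2).
have k2 := norm_mul_le (Rlt_le _ _ h1) (Rle_refl (norm (g x))).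
have k3 := norm_mul_le (Rle_refl (norm (f x))) (Rlt_le _ _ h2).
set m := Rmin 1 _ in eM m1 m2 h1 h2 k1 k2 k3.
apply: Rle_lt_trans (normD _ _) _.
apply: Rle_lt_trans (Rplus_le_compat_r _ _ _ (normD _ _)) _.
have : m * M <= e / 2.
  have -> : e / 2 = e / (2 * M) * M by rewrite /M; field; lra.
  by apply: Rmult_le_compat_r => //; rewrite /M; lra.
have : m * m <= m * 1 by apply: Rmult_le_compat_l; lra.
have : m * M = m * norm (f x) + m * norm (g x) + m by rewrite /M; ring.
move: k1 k2 k3; set a := norm _; set b := norm _; set c := norm _; set d := norm _; set h := norm _.
lra.
Qed.

Lemma continuousC gam (x : R) : continuous (U := C_R_NormedModule) gam x -> forall e, 0 < e ->
  exists d, 0 < d /\ forall t, Rabs (t - x) < d -> Cmod (gam t - gam x) < e.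
Proof.
move=> /(continuousE (W := C_R_NormedModule)) h e e0.
have [d [d0 hd]] := h e e0; exists d; split=> // t ht.
by have := hd t ht; rewrite normC.
Qed.

(** The quadratic estimate turns into the chain rule along a real curve. *)
Lemma is_derive_hol_comp F F' gam (x : R) (v : C) :
  is_derive (V := C_R_NormedModule) gam x v -> hol F F' (gam x) ->
  is_derive (fun t => F (gam t)) x (F' (gam x) * cx K v)%K.
Proof.
move=> hg [d [M [[d0 d1] [M0 hF]]]].
have cg := continuousC (ex_derive_continuous (V := C_R_NormedModule) _ _ (ex_intro _ v hg)).
have c1 := cx_bound_ge1 K; have v0 := Cmod_ge_0 v.
split; first exact: is_linear_scal_l.
move=> y hy e; have <- : x = y by exact: (is_filter_lim_locally_unique (V := R_NormedModule)).
have e0 := cond_pos e.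
pose n := norm (F' (gam x)); have n0 : 0 <= n := norm_ge_0 _.
pose e1 := Rmin 1 (e / 2 / (cx_bound K * n + 1)).
have cn : 0 <= cx_bound K * n by apply: Rmult_le_pos; lra.
have e10 : 0 < e1 by apply: Rmin_pos; [lra | repeat apply: Rdiv_lt_0_compat; lra].
have [m1 m2] := (Rmin_l 1 (e / 2 / (cx_bound K * n + 1)), Rmin_r 1 (e / 2 / (cx_bound K * n + 1))).
rewrite -/e1 in m1 m2.
have [_ /(_ x (fun P h => h) (mkposreal e1 e10)) [da hda]] := hg.
have [db [db0 hdb]] := cg d d0.
pose B := M * (Cmod v + 1) ^ 2.
have B0 : 0 <= B by apply: Rmult_le_pos => //; exact: pow2_ge_0.
have dc0 : 0 < e / 2 / (B + 1) by repeat apply: Rdiv_lt_0_compat; lra.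
have da0 := cond_pos da.
have r0 : 0 < Rmin da (Rmin db (e / 2 / (B + 1))) by repeat apply: Rmin_pos.
exists (mkposreal _ r0) => t ht.
have {}ht : Rabs (t - x) < Rmin da (Rmin db (e / 2 / (B + 1))) by exact: ht.
have t1 := Rlt_le_trans _ _ _ ht (Rmin_l _ _).
have t23 := Rlt_le_trans _ _ _ ht (Rmin_r _ _).
have t2 := Rlt_le_trans _ _ _ t23 (Rmin_l _ _); have t3 := Rlt_le_trans _ _ _ t23 (Rmin_r _ _).
have k1 : Cmod ((gam t - gam x) - RtoC (t - x) * v)%C <= e1 * Rabs (t - x).
  have k := hda t t1; rewrite normC in k; apply: Rle_trans k; right; congr Cmod.
  by apply: injective_projections; rewrite /= /minus /plus /opp /scal /= /mult /=; ring.
change (norm (F (gam t) - F (gam x) - sc (t - x) (F' (gam x) * cx K v))%K <= e * Rabs (t - x)).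
set s := Rabs (t - x) in k1 t1 t2 t3 *; have s0 : 0 <= s := Rabs_pos _.
have z0 : Cmod (gam x - gam x) < d by rewrite (_ : (gam x - gam x = RtoC 0)%C) ?Cmod_0 //; ring.
have [_ [_ k2]] := hF (gam x) (gam t) z0 (hdb t t2).
set D := (gam t - gam x)%C in k1 k2.
set E := (D - RtoC (t - x) * v)%C in k1.
have De : D = (RtoC (t - x) * v + E)%C by rewrite /E; ring.
have DD : Cmod D <= (Cmod v + 1) * s.
  rewrite De; apply: Rle_trans (Cmod_triangle _ _) _; rewrite Cmod_mult Cmod_R -/s.
  have : e1 * s <= 1 * s by apply: Rmult_le_compat_r.
  lra.
rewrite (_ : sub _ _ = (F (gam t) - F (gam x) - cx K D * F' (gam x) + cx K E * F' (gam x))%K);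
  last first.
  rewrite (scE_cx (t - x)) (_ : cx K D = (cx K (RtoC (t - x)) * cx K v + cx K E)%K); first by ring.
  by rewrite -cxM -cxD -De.
apply: Rle_trans (normD _ _) _.
have k3 := norm_mul_le (norm_cx K E) (Rle_refl n).
have k4 : M * Cmod D ^ 2 <= e / 2 * s.
  apply: Rle_trans (_ : B * s * s <= _).
    have -> : B * s * s = M * ((Cmod v + 1) * s) ^ 2 by rewrite /B; ring.
    by apply: Rmult_le_compat_l => //; apply: pow_incr; split=> //; exact: Cmod_ge_0.
  apply: Rmult_le_compat_r => //.
  have : (B + 1) * s <= (B + 1) * (e / 2 / (B + 1)) by apply: Rmult_le_compat_l; lra.
  have -> : (B + 1) * (e / 2 / (B + 1)) = e / 2 by field; lra.
  lra.
have k5 : Cmod E * cx_bound K * n <= e / 2 * s.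
  apply: Rle_trans (_ : e1 * s * (cx_bound K * n) <= _).
    by rewrite Rmult_assoc; apply: Rmult_le_compat_r.
  have : e1 * (cx_bound K * n + 1) <= e / 2 / (cx_bound K * n + 1) * (cx_bound K * n + 1).
    by apply: Rmult_le_compat_r; lra.
  have -> : e / 2 / (cx_bound K * n + 1) * (cx_bound K * n + 1) = e / 2 by field; lra.
  nra.
rewrite -/n in k3; lra.
Qed.

Lemma velocity_smooth gam g (v : C) (x : R) : is_derive (V := C_R_NormedModule) g x v ->
  locally x (fun t => gam t = g t) -> velocity gam x = v.
Proof.
move=> hg e; rewrite /velocity (surjective_pairing v); congr pair.
- rewrite (Derive_ext_loc _ (fun s => fst (g s))); last by apply: filter_imp e => t ->.
  apply: is_derive_unique.
  exact: (filterdiff_comp (U := R_NormedModule) (V := C_R_NormedModule) (W := R_NormedModule)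
    g fst _ fst hg (filterdiff_linear _ is_linear_fst)).
- rewrite (Derive_ext_loc _ (fun s => snd (g s))); last by apply: filter_imp e => t ->.
  apply: is_derive_unique.
  exact: (filterdiff_comp (U := R_NormedModule) (V := C_R_NormedModule) (W := R_NormedModule)
    g snd _ snd hg (filterdiff_linear _ is_linear_snd)).
Qed.

(** Additive properties of an interval need only be checked on a piece where
   the curve extends to a C^1 map of the line; in this form the junk values of
   the velocity at the breaks are met only once. *)
Lemma piecewise_induction gam (P : R -> R -> Prop) : piecewise_C1 gam ->
  (forall a b c, a <= b <= c -> P a b -> P b c -> P a c) ->
  (forall a b g dg, 0 <= a -> a < b -> b <= 1 ->
     (forall s, is_derive (V := C_R_NormedModule) g s (dg s)
                /\ continuous (U := C_R_NormedModule) dg s) ->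
     (forall s, a <= s <= b -> gam s = g s) -> P a b) ->
  P 0 1.
Proof.
move=> [k [t [t0 [tk hk]]]] chain step.
have mono i j : (i + j <= k)%N -> t i <= t (i + j)%N.
  elim: j => [|j IH] h; first by rewrite addn0; exact: Rle_refl.
  rewrite addnS in h *; have := IH (ltnW h); have [] := hk _ h; lra.
have pos i : (i <= k)%N -> 0 <= t i by move=> h; rewrite -t0 -[i]add0n; exact: mono.
have le1 i : (i <= k)%N -> t i <= 1.
  by move=> h; rewrite -tk -[k](subnKC h); apply: mono; rewrite subnKC.
have seg i : (i < k)%N -> P (t i) (t i.+1).
  move=> h; have [h1 [g [dg [h2 h3]]]] := hk i h.
  exact: step (pos _ (ltnW h)) h1 (le1 _ h) h2 h3.
have main i : (i < k)%N -> P 0 (t i.+1).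
  elim: i => [|i IH] h; first by rewrite -t0; exact: seg.
  apply: chain (IH (ltnW h)) (seg _ h); split; first by apply: pos; exact: ltnW.
  by have [] := hk _ h; lra.
case: k tk hk mono pos le1 seg main => [|k] tk _ _ _ _ _ main; first by lra.
by rewrite -tk; exact: main.
Qed.

Definition hol_along gam phi := forall z, curve_image gam z -> exists phi', hol phi phi' z.
Definition integrand gam phi (t : R) : K := (phi (gam t) * cx K (velocity gam t))%K.

Lemma integrand_smooth gam g dg phi (a b s : R) :
  (forall s, is_derive (V := C_R_NormedModule) g s (dg s)
             /\ continuous (U := C_R_NormedModule) dg s) ->
  (forall s, a <= s <= b -> gam s = g s) -> a < s < b ->
  integrand gam phi s = (phi (g s) * cx K (dg s))%K.
Proof.
move=> hg e hs; rewrite /integrand (e s); last lra.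
rewrite (velocity_smooth (proj1 (hg s))) //.
have p0 : 0 < Rmin (s - a) (b - s) by apply: Rmin_pos; lra.
exists (mkposreal _ p0) => t ht; apply: e.
have {}ht : Rabs (t - s) < Rmin (s - a) (b - s) by exact: ht.
have := Rmin_l (s - a) (b - s); have := Rmin_r (s - a) (b - s).
by have := Rabs_def2 _ _ ht; lra.
Qed.

Lemma continuous_segment g dg phi phi' (s : R) :
  is_derive (V := C_R_NormedModule) g s (dg s) ->
  continuous (U := C_R_NormedModule) dg s -> hol phi phi' (g s) ->
  continuous (fun t => phi (g t) * cx K (dg t))%K s.
Proof.
move=> h1 h2 h3; apply: continuous_mul.
  by apply: (ex_derive_continuous (V := K)); eexists; exact: is_derive_hol_comp h1 h3.
apply/continuousE => e e0.
have c1 := cx_bound_ge1 K.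
have [|d [d0 hd]] := continuousC h2 (e := e / cx_bound K); first by apply: Rdiv_lt_0_compat; lra.
exists d; split=> // t ht; change (norm (cx K (dg t) - cx K (dg s))%K < e); rewrite -cxB.
apply: Rle_lt_trans (norm_cx K _) _.
have -> : e = e / cx_bound K * cx_bound K by field; lra.
by apply: Rmult_lt_compat_r; [lra | exact: hd].
Qed.

Lemma ex_RInt_integrand gam phi : piecewise_C1 gam -> hol_along gam phi ->
  ex_RInt (integrand gam phi) 0 1.
Proof.
move=> hg hphi; apply: (piecewise_induction hg) => [a b c _|a b g dg a0 ab b1 hd e].
  exact: ex_RInt_Chasles.
apply: (ex_RInt_ext (fun s => phi (g s) * cx K (dg s))%K).
  move=> s; rewrite Rmin_left ?Rmax_right; try lra.
  by move=> hs; rewrite (integrand_smooth _ hd e hs).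
apply: ex_RInt_continuous => s; rewrite Rmin_left ?Rmax_right; try lra.
move=> hs; have [phi' h] : exists phi', hol phi phi' (g s).
  by apply: hphi; exists s; split; [lra | rewrite e //; lra].
exact: continuous_segment (proj1 (hd s)) (proj2 (hd s)) h.
Qed.

(** The length estimate. One factor is fixed in advance and absorbed in the
   constant, so that the Cauchy kernel can vary. *)
Lemma integrand_bound gam phi : piecewise_C1 gam -> hol_along gam phi ->
  exists L, 0 <= L /\ forall psi M l, (forall z, curve_image gam z -> norm (psi z) <= M) ->
    hol_along gam psi -> is_RInt (integrand gam (fun z => phi z * psi z)%K) 0 1 l ->
    norm l <= L * M.
Proof.
move=> hg hphi.
pose P a b := exists L, 0 <= L /\ forall psi M, (forall z, curve_image gam z -> norm (psi z) <= M) ->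
    hol_along gam psi -> 
    exists l, is_RInt (integrand gam (fun z => phi z * psi z)%K) a b l /\ norm l <= L * M.
suff [L [L0 hL]] : P 0 1.
  exists L; split=> // psi M l b h hl; have [l' [h1 h2]] := hL psi M b h.
  by rewrite -(is_RInt_unique _ _ _ _ hl) (is_RInt_unique _ _ _ _ h1).
apply: (piecewise_induction hg).
  move=> a b c _ [L1 [L10 h1]] [L2 [L20 h2]]; exists (L1 + L2); split; first lra.
  move=> psi M bd h; have [l1 [i1 n1]] := h1 psi M bd h; have [l2 [i2 n2]] := h2 psi M bd h.
  exists (plus l1 l2); split; first exact: is_RInt_Chasles i1 i2.
  by apply: Rle_trans (normD _ _) _; lra.
move=> a b g dg a0 ab b1 hd e.
have onc s : a <= s <= b -> curve_image gam (g s) by move=> hs; exists s; split; [lra | rewrite e].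
have cphi s : a <= s <= b -> continuous (fun t => phi (g t) * cx K (dg t))%K s.
  move=> hs; have [phi' h] := hphi _ (onc s hs).
  exact: continuous_segment (proj1 (hd s)) (proj2 (hd s)) h.
have [B hB] := bounded_continuity _ _ _ cphi.
have B0 : 0 <= B by have := hB a ltac:(lra); have := norm_ge_0 (phi (g a) * cx K (dg a))%K; lra.
exists ((b - a) * B); split; first by apply: Rmult_le_pos; lra.
move=> psi M bd h.
pose G t := ((phi (g t) * cx K (dg t)) * psi (g t))%K.
have [l hl] : ex_RInt G a b.
  apply: ex_RInt_continuous => s; rewrite Rmin_left ?Rmax_right; try lra.
  move=> hs; apply: continuous_mul; first exact: cphi.
  have [psi' k] := h _ (onc s hs).
  by apply: (ex_derive_continuous (V := K)); eexists; exact: is_derive_hol_comp (proj1 (hd s)) k.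
exists l; split.
  apply: is_RInt_ext hl => s; rewrite Rmin_left ?Rmax_right; try lra.
  by move=> hs; rewrite (integrand_smooth _ hd e hs) /G; kring.
rewrite Rmult_assoc; apply: norm_RInt_le_const hl; first lra.
move=> s hs; apply: norm_mul_le; first exact: Rlt_le (hB s hs).
exact: bd (onc s hs).
Qed.

Lemma is_RInt_primitive gam F F' : piecewise_C1 gam ->
  (forall z, curve_image gam z -> hol F F' z) -> (hol_along gam F') ->
  is_RInt (integrand gam F') 0 1 (sub (F (gam 1)) (F (gam 0))).
Proof.
move=> hg hF hF'.
apply: (piecewise_induction (P := fun a b => is_RInt (integrand gam F') a b (F (gam b) - F (gam a))%K) hg).
  move=> a b c _ h1 h2.
  have -> : (F (gam c) - F (gam a) = (F (gam b) - F (gam a)) + (F (gam c) - F (gam b)))%K by ring.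
  exact: is_RInt_Chasles h1 h2.
move=> a b g dg a0 ab b1 hd e.
have onc s : a <= s <= b -> curve_image gam (g s) by move=> hs; exists s; split; [lra | rewrite e].
apply: (is_RInt_ext (fun s => F' (g s) * cx K (dg s))%K).
  move=> s; rewrite Rmin_left ?Rmax_right; try lra.
  by move=> hs; rewrite (integrand_smooth _ hd e hs).
rewrite !e; try lra.
apply: (is_RInt_derive (fun s => F (g s))) => s; rewrite Rmin_left ?Rmax_right; try lra; move=> hs.
  exact: is_derive_hol_comp (proj1 (hd s)) (hF _ (onc s hs)).
have [F'' k] := hF' _ (onc s hs).
exact: continuous_segment (proj1 (hd s)) (proj2 (hd s)) k.
Qed.

(** * Integrals over a system of closed curves *)

Variables (m : nat) (Gam : 'I_m -> R -> C).
Hypothesis Gam_C1 : forall j, piecewise_C1 (Gam j).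
Hypothesis Gam_closed : forall j, Gam j 0 = Gam j 1.

Definition on_cycle (z : C) := exists j, curve_image (Gam j) z.
Definition hol_cycle phi := forall z, on_cycle z -> exists phi', hol phi phi' z.
Definition cycle_int phi : K := \big[plus/zero]_(j < m) RInt (integrand (Gam j) phi) 0 1.

Lemma hol_cycle_along phi j : hol_cycle phi -> hol_along (Gam j) phi.
Proof. by move=> h z hz; apply: h; exists j. Qed.

Lemma is_contour_int_cycle phi : hol_cycle phi ->
  is_contour_int (W := K) Gam (fun z dz => phi z * cx K dz)%K (cycle_int phi).
Proof.
move=> h; exists (fun j => RInt (integrand (Gam j) phi) 0 1); split=> // j.
exact: RInt_correct (ex_RInt_integrand (Gam_C1 j) (hol_cycle_along h)).
Qed.

Lemma cycle_int_ext phi psi : (forall z, on_cycle z -> phi z = psi z) -> cycle_int phi = cycle_int psi.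
Proof.
move=> h; apply: eq_bigr => j _; apply: RInt_ext => t; rewrite Rmin_left ?Rmax_right; try lra.
by move=> ht; rewrite /integrand h //; exists j, t; split; [lra | by []].
Qed.

Lemma cycle_int_add phi psi : hol_cycle phi -> hol_cycle psi ->
  cycle_int (fun z => phi z + psi z)%K = (cycle_int phi + cycle_int psi)%K.
Proof.
move=> h1 h2; rewrite /cycle_int -[RHS]big_split; apply: eq_bigr => j _.
apply: is_RInt_unique.
have k1 := RInt_correct _ _ _ (ex_RInt_integrand (Gam_C1 j) (hol_cycle_along h1)).
have k2 := RInt_correct _ _ _ (ex_RInt_integrand (Gam_C1 j) (hol_cycle_along h2)).
apply: is_RInt_ext (is_RInt_plus _ _ _ _ _ _ k1 k2) => t _.
change (integrand (Gam j) phi t + integrand (Gam j) psi t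
  = integrand (Gam j) (fun z => phi z + psi z) t)%K.
by rewrite /integrand; ring.
Qed.

Lemma mul_linear (x : K) : is_linear (fun y : K => x * y)%K.
Proof.
split.
- by move=> y z; change (x * (y + z) = x * y + x * z)%K; ring.
- by move=> k y; change (x * sc k y = sc k (x * y))%K; rewrite (scE k y) (scE k (x * y)%K); ring.
exists (norm x + 1); have n0 := norm_ge_0 x; split; first lra.
move=> y; apply: Rle_trans (norm_mul x y) _; have := norm_ge_0 y; nra.
Qed.

Lemma cycle_int_mull (x : K) phi : hol_cycle phi -> cycle_int (fun z => x * phi z)%K = (x * cycle_int phi)%K.
Proof.
move=> h; rewrite /cycle_int (big_morph (mul x) (linear_plus _ (mul_linear x)) (linear_zero _ (mul_linear x))).
apply: eq_bigr => j _; apply: is_RInt_unique.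
have k1 := RInt_correct _ _ _ (ex_RInt_integrand (Gam_C1 j) (hol_cycle_along h)).
apply: is_RInt_ext (is_RInt_linear (mul_linear x) k1) => t _.
by rewrite /integrand; kring.
Qed.

Lemma cycle_int_bound phi : hol_cycle phi -> exists L, 0 <= L /\ forall psi M,
  0 <= M -> (forall z, on_cycle z -> norm (psi z) <= M) -> hol_cycle psi ->
  norm (cycle_int (fun z => phi z * psi z)%K) <= L * M.
Proof.
move=> hphi.
pose ok j (L : R) := 0 <= L /\ forall psi M l, (forall z, curve_image (Gam j) z -> norm (psi z) <= M) ->
    hol_along (Gam j) psi -> is_RInt (integrand (Gam j) (fun z => phi z * psi z)%K) 0 1 l ->
    norm l <= L * M.
pose L j := epsilon (inhabits 0) (ok j).
have hL j : ok j (L j).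
  by apply: epsilon_spec; exact: integrand_bound (Gam_C1 j) (hol_cycle_along hphi).
exists (\big[plus/zero]_(j < m) (L j : R)); split; first by apply: sum_ge0 => j; have [] := hL j.
move=> psi M M0 bd h; rewrite sum_mulr.
apply: Rle_trans (norm_sum_le _) _; apply: sum_le => j.
have [_ hj] := hL j; apply: (hj psi M).
- by move=> z hz; apply: bd; exists j.
- exact: hol_cycle_along.
apply: RInt_correct; apply: ex_RInt_integrand => // z hz.
have [p' k1] := hphi z (ex_intro _ j hz); have [q' k2] := h z (ex_intro _ j hz).
eexists; exact: hol_mul k1 k2.
Qed.

Lemma cycle_int_primitive F F' : (forall z, on_cycle z -> hol F F' z) -> hol_cycle F' -> cycle_int F' = nul.
Proof.
move=> hF hF'; rewrite /cycle_int big1 // => j _; apply: is_RInt_unique.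
have k := is_RInt_primitive (Gam_C1 j) (fun z hz => hF z (ex_intro _ j hz))
  (hol_cycle_along (j := j) hF').
by rewrite Gam_closed (_ : (_ - _)%K = nul) in k; [exact: k | ring].
Qed.

Lemma cx_linear : is_linear (fun c : C_R_NormedModule => cx K c).
Proof.
split.
- by move=> a b; exact: cxD.
- move=> k c; change (cx K (scal k c) = sc k (cx K c)).
  rewrite scE_cx -cxM; congr (cx K _).
  by apply: injective_projections; rewrite /= /scal /= /mult /=; ring.
exists (cx_bound K); split; first by have := cx_bound_ge1 K; lra.
by move=> c; rewrite normC Rmult_comm; exact: norm_cx.
Qed.

Lemma cycle_int_scalar (f : C -> C) (l : C) phi :
  is_contour_int (W := C_R_NormedModule) Gam (fun w dw => dw / f w)%C l ->
  (forall w, on_cycle w -> phi w = cx K (/ f w)%C) -> cycle_int phi = cx K l.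
Proof.
move=> [J [hJ ->]] e.
rewrite (big_morph (fun c : C_R_NormedModule => cx K c) (linear_plus _ cx_linear)
  (linear_zero _ cx_linear)).
apply: eq_bigr => j _; apply: is_RInt_unique.
apply: is_RInt_ext (is_RInt_linear cx_linear (hJ j)) => t; rewrite Rmin_left ?Rmax_right; try lra.
move=> ht; rewrite /integrand e; last by exists j, t; split; [lra | by []].
by rewrite -cxM; congr (cx K _); rewrite /Cdiv; ring.
Qed.
End Contour.

(** * Integrals of the inverse of the pencil *)

Section Pencil.
Variables (K : cba) (A : K).
Implicit Types (z p w : C).

Add Ring Kring : (cba_ring K).

Notation quad := (pencil A).
Notation Q := (pencil_inv A).

Definition cauchy_kernel z p : K := kinv (cx K p - cx K z)%K.

Lemma cauchy_kernelE z p : p <> z -> cauchy_kernel z p = cx K (/ (p - z))%C.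
Proof.
move=> pz; rewrite /cauchy_kernel -cxB kinv_cx // => h; apply: pz.
by have -> : (p = (p - z) + z)%C by [ring]; rewrite h; ring.
Qed.

Lemma cauchy_kernelP z p : p <> z -> ((cx K p - cx K z) * cauchy_kernel z p)%K = one.
Proof.
move=> pz; rewrite cauchy_kernelE // -cxB; apply: cx_inv => h; apply: pz.
by have -> : (p = (p - z) + z)%C by [ring]; rewrite h; ring.
Qed.

Lemma hol_cauchy_kernel z p : p <> z -> exists f', hol (cauchy_kernel z) f' p.
Proof.
move=> pz; eexists; apply: hol_inv; last by exists (cauchy_kernel z p); exact: cauchy_kernelP.
exact: hol_add (hol_cx K p) (hol_const (- cx K z)%K p).
Qed.

Lemma pencil_opp z : quad (- z)%C = quad z.
Proof. by rewrite /pencil; congr (cx K _ + _)%K; ring. Qed.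

Section OneCycle.
Variables (m : nat) (Gam : 'I_m -> R -> C).
Hypothesis Gam_C1 : forall j, piecewise_C1 (Gam j).
Hypothesis Gam_closed : forall j, Gam j 0 = Gam j 1.
Hypothesis Gam_res : forall p, on_cycle Gam p -> invertible (quad p).

Definition int_Q : K := cycle_int Gam Q.
Definition int_pQ : K := cycle_int Gam (fun p => cx K p * Q p)%K.
Definition winding z : K := cycle_int Gam (cauchy_kernel z).
Definition cauchy_tr z : K := cycle_int Gam (fun p => Q p * cauchy_kernel z p)%K.

Lemma hol_cycle_Q : hol_cycle Gam Q.
Proof. by move=> p hp; eexists; exact: hol_pencil_inv (Gam_res hp). Qed.

Lemma hol_cycle_mul f g : hol_cycle (K := K) Gam f -> hol_cycle Gam g ->
  hol_cycle Gam (fun p => f p * g p)%K.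
Proof.
by move=> hf hg p hp; have [f' h1] := hf p hp; have [g' h2] := hg p hp; eexists; exact: hol_mul h1 h2.
Qed.

Lemma hol_cycle_cx : hol_cycle Gam (cx K).
Proof. by move=> p _; eexists; exact: hol_cx. Qed.

Lemma hol_cycle_const (x : K) : hol_cycle Gam (fun _ => x).
Proof. by move=> p _; eexists; exact: hol_const. Qed.

Lemma hol_cycle_kernel z : ~ on_cycle Gam z -> hol_cycle Gam (cauchy_kernel z).
Proof. by move=> hz p hp; apply: hol_cauchy_kernel => e; apply: hz; rewrite -e. Qed.

(** The pencil at z and at p differ by (p - z)(p + z), which cancels the Cauchy
   kernel. *)
Lemma pencil_cauchy_tr z : ~ on_cycle Gam z ->
  (quad z * cauchy_tr z)%K = (winding z - cx K z * int_Q - int_pQ)%K.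
Proof.
move=> hz; have hk := hol_cycle_kernel hz.
have hQ := hol_cycle_Q; have hzQ := hol_cycle_mul (hol_cycle_const (- cx K z)%K) hQ.
have hpQ := hol_cycle_mul (hol_cycle_const (- one)%K) (hol_cycle_mul hol_cycle_cx hQ).
rewrite /cauchy_tr -(cycle_int_mull Gam_C1); last exact: hol_cycle_mul.
rewrite (@cycle_int_ext _ _ _ _ (fun p => cauchy_kernel z p + (- cx K z * Q p + (- one) * (cx K p * Q p)))%K).
  rewrite (cycle_int_add Gam_C1 hk); last first.
    move=> p hp; have [f' h1] := hzQ p hp; have [g' h2] := hpQ p hp.
    by eexists; exact: hol_add h1 h2.
  rewrite (cycle_int_add Gam_C1 hzQ hpQ) !(cycle_int_mull Gam_C1) //; last exact: hol_cycle_mul hol_cycle_cx hQ.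
  rewrite /int_Q /int_pQ /winding; ring.
move=> p hp; have qi := kinvP (Gam_res hp); rewrite -/(Q p) in qi.
have pz : p <> z by move=> e; apply: hz; rewrite -e.
have k := cauchy_kernelP pz.
have -> : quad z = (quad p - (cx K p - cx K z) * (cx K p + cx K z))%K.
  by rewrite /pencil !cxM; ring.
transitivity (quad p * Q p * cauchy_kernel z p
   - (cx K p - cx K z) * cauchy_kernel z p * ((cx K p + cx K z) * Q p))%K; first by ring.
rewrite qi k; ring.
Qed.

(** The kernel satisfies k(z') = k(z) + (z' - z) k(z)^2 + (z' - z)^2 k(z') k(z)^2,
   and the last term is integrated against the length estimate. *)
Lemma hol_cauchy_tr z0 d : 0 < d ->
  (forall z, Cmod (z - z0) < d -> ~ on_cycle Gam z) -> exists f', hol cauchy_tr f' z0.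
Proof.
move=> d0 off; have c1 := cx_bound_ge1 K.
have [L [L0 hL]] := cycle_int_bound Gam_C1 hol_cycle_Q.
pose r := Rmin 1 (d / 2); have r0 : 0 < r by apply: Rmin_pos; lra.
have [m1 m2] := (Rmin_l 1 (d / 2), Rmin_r 1 (d / 2)); rewrite -/r in m1 m2.
have far z p : Cmod (z - z0) < r -> on_cycle Gam p -> r <= Cmod (p - z).
  move=> hz hp; apply: Rnot_lt_le => h; apply: (off p) => //.
  have -> : (p - z0 = (p - z) + (z - z0))%C by ring.
  by apply: Rle_lt_trans (Cmod_triangle _ _) _; lra.
have offr z : Cmod (z - z0) < r -> ~ on_cycle Gam z by move=> hz; apply: off; lra.
pose b := cx_bound K / r; have b0 : 0 <= b by apply: Rdiv_le_0_compat; lra.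
have neq z p : Cmod (z - z0) < r -> on_cycle Gam p -> p <> z.
  by move=> hz hp e; apply: (offr z hz); rewrite -e.
have kb z p : Cmod (z - z0) < r -> on_cycle Gam p -> norm (cauchy_kernel z p) <= b.
  move=> hz hp; rewrite cauchy_kernelE; last exact: neq hp.
  apply: Rle_trans (norm_cx K _) _; have f := far z p hz hp.
  have pz : (p - z <> RtoC 0)%C by move=> e; rewrite e Cmod_0 in f; lra.
  rewrite Cmod_inv // /b /Rdiv Rmult_comm; apply: Rmult_le_compat_l; first lra.
  exact: Rinv_le_contravar.
pose k2 z p := (cauchy_kernel z p * cauchy_kernel z p)%K; pose k3 z z' p := (cauchy_kernel z' p * k2 z p)%K.
have hk z : Cmod (z - z0) < r -> hol_cycle Gam (cauchy_kernel z).
  by move=> hz; apply: hol_cycle_kernel; exact: offr.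
have hk2 z : Cmod (z - z0) < r -> hol_cycle Gam (k2 z) by move=> hz; apply: hol_cycle_mul; exact: hk.
have hk3 z z' : Cmod (z - z0) < r -> Cmod (z' - z0) < r -> hol_cycle Gam (k3 z z').
  by move=> hz hz'; apply: hol_cycle_mul; [exact: hk | exact: hk2].
have bb : 0 <= b * b by exact: Rmult_le_pos.
have bbb : 0 <= b * (b * b) by exact: Rmult_le_pos.
have hQ := hol_cycle_Q.
exists (fun z => cycle_int Gam (fun p => Q p * k2 z p)%K), r,
  (L * b + L * (b * b) + cx_bound K * (L * (b * (b * b)))).
have p1 : 0 <= L * b by exact: Rmult_le_pos.
have p2 : 0 <= L * (b * b) by exact: Rmult_le_pos.
have p3 : 0 <= cx_bound K * (L * (b * (b * b))) by apply: Rmult_le_pos; [lra | exact: Rmult_le_pos].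
split; first lra; split; first lra.
move=> z z' hz hz'; split.
  by have := hL (cauchy_kernel z) b b0 (fun p => @kb z p hz) (hk z hz); rewrite /cauchy_tr; lra.
have n2 p : on_cycle Gam p -> norm (k2 z p) <= b * b by move=> hp; apply: norm_mul_le; exact: kb.
split; first by have := hL (k2 z) _ bb n2 (hk2 z hz); lra.
have n3 p : on_cycle Gam p -> norm (k3 z z' p) <= b * (b * b).
  by move=> hp; apply: norm_mul_le; [exact: kb | exact: n2].
have := hL (k3 z z') _ bbb n3 (hk3 z z' hz hz').
set S := cycle_int _ _ => hS.
have e : cauchy_tr z' = (cauchy_tr z + (cx K (z' - z) * cycle_int Gam (fun p => Q p * k2 z p)
    + cx K (z' - z) * cx K (z' - z) * S))%K.
  have h1 := hol_cycle_mul hQ (hk z hz); have h2 := hol_cycle_mul hQ (hk2 z hz).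
  have h3 := hol_cycle_mul hQ (hk3 z z' hz hz').
  rewrite /S /cauchy_tr -!(cycle_int_mull Gam_C1) // -(cycle_int_add Gam_C1); last first.
  - by apply: hol_cycle_mul h3; exact: hol_cycle_const.
  - by apply: hol_cycle_mul h2; exact: hol_cycle_const.
  rewrite -(cycle_int_add Gam_C1) //; last first.
    move=> p hp; have [f' q2] := h2 p hp; have [g' q3] := h3 p hp.
    by eexists; apply: hol_add; apply: hol_mul; try exact: hol_const; [exact: q2 | exact: q3].
  apply: cycle_int_ext => p hp.
  have k := cauchy_kernelP (neq z p hz hp); have k' := cauchy_kernelP (neq z' p hz' hp).
  have kk : (cauchy_kernel z' p
      = cauchy_kernel z p + cx K (z' - z) * (cauchy_kernel z p * cauchy_kernel z' p))%K.
    rewrite cxB.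
    transitivity (cauchy_kernel z p
      + ((cx K p - cx K z) * cauchy_kernel z p * cauchy_kernel z' p
         - (cx K p - cx K z') * cauchy_kernel z' p * cauchy_kernel z p))%K.
      by rewrite k k'; ring.
    ring.
  rewrite {1}kk {1}kk /k3 /k2; ring.
rewrite (_ : sub _ _ = (cx K (z' - z) * cx K (z' - z) * S)%K); last by rewrite e; ring.
have nz := norm_cx K (z' - z).
rewrite -cxM; have := norm_mul_le (norm_cx K ((z' - z) * (z' - z))%C) hS.
rewrite Cmod_mult; set t := Cmod _ => n4; apply: Rle_trans n4 _.
have t2 := pow2_ge_0 t; have : 0 <= (L * b + L * (b * b)) * t ^ 2 by apply: Rmult_le_pos; lra.
simpl; lra.
Qed.

Lemma hol_pow f f' n z0 : hol (K := K) f f' z0 ->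
  hol (fun z => kpow (f z) n.+1) (fun z => sc (INR n.+1) one * (kpow (f z) n * f' z))%K z0.
Proof.
move=> h; elim: n => [|n IH].
  apply: (hol_ext (d := 1)) h => [|z _]; first lra.
  by rewrite INR_1 sc1 /=; split; ring.
apply: (hol_ext (d := 1)) (hol_mul h IH) => [|z _]; first lra.
split=> //; rewrite [in RHS]S_INR scD sc1 /=; ring.
Qed.

Definition moment k h : K := cycle_int Gam (fun p => kpow (cx K p) k * kpow (Q p) h)%K.

Lemma hol_cycle_pow f n : hol_cycle (K := K) Gam f -> hol_cycle Gam (fun p => kpow (f p) n).
Proof.
move=> hf; elim: n => [|n IH] /=; first exact: hol_cycle_const.
exact: hol_cycle_mul.
Qed.

Lemma hol_cycle_moment k h : hol_cycle Gam (fun p => kpow (cx K p) k * kpow (Q p) h)%K.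
Proof. by apply: hol_cycle_mul; apply: hol_cycle_pow; [exact: hol_cycle_cx | exact: hol_cycle_Q]. Qed.

(** Integration by parts: the derivative of p^(k+1) Q^(h+1) integrates to zero. *)
Lemma moment_rec k h :
  sc (INR k.+1) (moment k h.+1) = sc (2 * INR h.+1) (moment k.+2 h.+2).
Proof.
pose F' p := (sc (INR k.+1) one * (kpow (cx K p) k * kpow (Q p) h.+1)
  + (- sc (2 * INR h.+1) one) * (kpow (cx K p) k.+2 * kpow (Q p) h.+2))%K.
have hF p : on_cycle Gam p -> hol (fun p => kpow (cx K p) k.+1 * kpow (Q p) h.+1)%K F' p.
  move=> hp.
  apply: (hol_ext (d := 1)) (hol_mul (hol_pow k (hol_cx K p)) (hol_pow h (hol_pencil_inv (Gam_res hp)))).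
    lra.
  move=> z _; split=> //; rewrite /F' Rmult_plus_distr_r !Rmult_1_l scD /=; ring.
have h1 := hol_cycle_mul (hol_cycle_const (sc (INR k.+1) one)) (hol_cycle_moment k h.+1).
have h2 := hol_cycle_mul (hol_cycle_const (- sc (2 * INR h.+1) one)%K) (hol_cycle_moment k.+2 h.+2).
have := cycle_int_primitive Gam_C1 Gam_closed hF.
rewrite /F' (cycle_int_add Gam_C1 h1 h2) !(cycle_int_mull Gam_C1); [|exact: hol_cycle_moment|exact: hol_cycle_moment].
rewrite -/(moment _ _) -/(moment _ _) (scE _ (moment k _)) (scE _ (moment k.+2 _)) => e.
set a := (_ * moment k h.+1)%K; set b := (_ * moment k.+2 h.+2)%K.
have {}e : (a + - b)%K = nul.
  rewrite -e; first by rewrite /a /b; ring.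
  move=> p hp; have [f' q1] := h1 p hp; have [g' q2] := h2 p hp.
  by eexists; exact: hol_add q1 q2.
transitivity (a + - b + b)%K; [ring | rewrite e; ring].
Qed.

Lemma sc_inj (a : R) (x y : K) : a <> 0 -> sc a x = sc a y -> x = y.
Proof.
move=> a0 e; rewrite -(sc1 x) -(sc1 y) -(Rinv_l a a0) !scM; congr sc; exact: e.
Qed.

(** For k = 2h + 1 the two coefficients of the recursion agree. *)
Lemma moment_odd h : moment h.*2.+1 h.+1 = int_pQ.
Proof.
elim: h => [|h IH]; first by apply: cycle_int_ext => p _ /=; ring.
rewrite -IH; apply/esym; apply: (@sc_inj (INR h.*2.+2)).
  by have := lt_0_INR h.*2.+2 (Nat.lt_0_succ _); lra.
rewrite moment_rec; congr sc.
by rewrite -addnn !S_INR -plusE plus_INR; ring.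
Qed.

Lemma moment_even h : int_Q = nul -> moment h.*2 h.+1 = nul.
Proof.
move=> Y0; elim: h => [|h IH].
  by rewrite -Y0; apply: cycle_int_ext => p _ /=; ring.
apply: (@sc_inj (2 * INR h.+1)).
  by have := lt_0_INR h.+1 (Nat.lt_0_succ _); lra.
rewrite -moment_rec IH !(scE _ nul); ring.
Qed.

End OneCycle.

(** All that the integrals need to know about a domain with its boundary. The
   symmetry under z -> - z is asked for at spectral points only, where it comes
   from the symmetry of the domain under conjugation. *)
Record separates (m : nat) (Gam : 'I_m -> R -> C) (ins out : C -> Prop) : Prop := {
  sep_C1 : forall j, piecewise_C1 (Gam j);
  sep_closed : forall j, Gam j 0 = Gam j 1;
  sep_res : forall p, on_cycle Gam p -> invertible (quad p);
  sep_in : forall z, ins z -> winding Gam z = cx K (RtoC (2 * PI) * Ci)%C;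
  sep_out : forall z, out z -> winding Gam z = nul;
  sep_in_open : forall z0, ins z0 -> exists d, 0 < d /\
    forall z, Cmod (z - z0) < d -> ins z /\ ~ on_cycle Gam z;
  sep_out_open : forall z0, out z0 -> exists d, 0 < d /\
    forall z, Cmod (z - z0) < d -> out z /\ ~ ins z /\ ~ on_cycle Gam z;
  sep_in_opp : forall z, ~ invertible (quad z) -> ins z -> ins (- z)%C;
  sep_out_opp : forall z, ~ invertible (quad z) -> out z -> out (- z)%C;
  sep_spec : forall z, ~ invertible (quad z) -> ins z \/ out z }.

Lemma Cmod_opp_sub z z0 : Cmod (- z - - z0)%C = Cmod (z - z0).
Proof. by rewrite -Cmod_opp; congr Cmod; ring. Qed.

Lemma hol_sq z0 : hol (fun z => cx K (z * z)%C) (fun z => cx K z + cx K z)%K z0.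
Proof.
apply: (hol_ext (d := 1)) (hol_mul (hol_cx K z0) (hol_cx K z0)) => [|z _]; first lra.
by rewrite cxM; split; [reflexivity | ring].
Qed.

Lemma cx_sq0 : cx K (RtoC 0 * RtoC 0)%C = nul.
Proof. by rewrite -cx0; congr (cx K _); ring. Qed.

Section Separated.
Variables (m : nat) (Gam : 'I_m -> R -> C) (ins out : C -> Prop).
Hypothesis sep : separates Gam ins out.

(** The pencil at z and - z is the same, so (z^2 + A)(c(z) - c(- z)) is
   - 2 z Y plus a difference of winding numbers, which symmetry cancels. *)
Lemma int_Q_eq0 : int_Q Gam = nul.
Proof.
have [C1 _ res win wout inO outO inN outN spec] := sep.
suff : (int_Q Gam + int_Q Gam)%K = nul.
  move=> h; apply: (@sc_inj 2); first lra.
  by rewrite (_ : 2 = 1 + 1) // !scD !sc1 h; ring.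
pose F z := (- cx K z * (cauchy_tr Gam z - cauchy_tr Gam (- z)%C))%K.
apply: (@entire_division K A _ F); first by rewrite /F cx0; ring.
move=> z0 hz0.
have [d [d0 hd]] : exists d, 0 < d /\ forall z, Cmod (z - z0) < d ->
    ~ on_cycle Gam z /\ ~ on_cycle Gam (- z)%C /\ winding Gam z = winding Gam (- z)%C.
  have near (S : C -> Prop) : (forall z1, S z1 -> exists d, 0 < d /\
      forall z, Cmod (z - z1) < d -> S z /\ ~ on_cycle Gam z) ->
      (forall z, S z -> S (- z)%C -> winding Gam z = winding Gam (- z)%C) ->
      S z0 -> S (- z0)%C -> exists d, 0 < d /\ forall z, Cmod (z - z0) < d ->
      ~ on_cycle Gam z /\ ~ on_cycle Gam (- z)%C /\ winding Gam z = winding Gam (- z)%C.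
    move=> SO Sw S1 S2; have [d1 [d10 h1]] := SO _ S1; have [d2 [d20 h2]] := SO _ S2.
    exists (Rmin d1 d2); split; first exact: Rmin_pos.
    move=> z hz; have [s1 s2] := h1 z (Rlt_le_trans _ _ _ hz (Rmin_l _ _)).
    have [|s3 s4] := h2 (- z)%C.
      by rewrite Cmod_opp_sub; exact: Rlt_le_trans hz (Rmin_r _ _).
    by split=> //; split=> //; exact: Sw.
  case: (spec z0 hz0) => h.
    apply: near (inN _ hz0 h) => // z s1 s2; by rewrite !win.
  apply: near (outN _ hz0 h) => // [z1 s1|z s1 s2]; last by rewrite !wout.
  by have [d [d0 hd]] := outO z1 s1; exists d; split=> // z hz; have [? []] := hd z hz.
split.
  have [f1 h1] := hol_cauchy_tr C1 res d0 (fun z hz => proj1 (hd z hz)).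
  have [|f2 h2] := @hol_cauchy_tr _ _ C1 res (- z0)%C d d0.
    move=> z hz; rewrite (_ : z = (- - z)%C); last by ring.
    by apply: (proj1 (proj2 (hd (- z)%C _))); rewrite -Cmod_opp_sub (_ : (- - z = z)%C) //; ring.
  eexists; apply: (hol_local (d := 1)) (hol_mul (hol_mul (hol_const (- one)%K z0) (hol_cx K z0))
    (hol_add h1 (hol_mul (hol_const (- one)%K z0) (hol_opp_arg h2)))); first lra.
  by move=> z _; rewrite /F; ring.
exists d; split=> // z hz; have [o1 [o2 e]] := hd z hz.
have q1 := pencil_cauchy_tr C1 res o1; have q2 := pencil_cauchy_tr C1 res o2.
rewrite pencil_opp cxN -e in q2.
transitivity (- cx K z * (quad z * cauchy_tr Gam z - quad z * cauchy_tr Gam (- z)%C))%K.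
  by rewrite /F; ring.
by rewrite q1 q2 cxM; ring.
Qed.

Lemma pencil_cauchy_tr_simpl z : ~ on_cycle Gam z ->
  (quad z * cauchy_tr Gam z)%K = (winding Gam z - int_pQ Gam)%K.
Proof.
by move=> hz; rewrite (pencil_cauchy_tr (sep_C1 sep) (sep_res sep) hz) int_Q_eq0; ring.
Qed.

Definition riesz_proj : K := (cx K (/ (RtoC (2 * PI) * Ci))%C * int_pQ Gam)%K.

Lemma twopii_neq0 : (RtoC (2 * PI) * Ci)%C <> RtoC 0.
Proof. by move=> h; have := f_equal snd h; rewrite /=; have := PI_RGT_0; lra. Qed.

(** P^2 - P is divisible near the spectrum inside because there the pencil
   divides 1 - P, and near the spectrum outside because it divides P. *)
Theorem riesz_proj_idempotent : (riesz_proj * riesz_proj)%K = riesz_proj.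
Proof.
have [C1 _ res win wout inO outO _ _ spec] := sep.
have ti := cx_inv K twopii_neq0.
set ka := cx K (/ _)%C in ti; have P : riesz_proj = (ka * int_pQ Gam)%K by [].
suff h : (riesz_proj * riesz_proj - riesz_proj)%K = nul.
  transitivity (riesz_proj * riesz_proj - riesz_proj + riesz_proj)%K; [ring | rewrite h; ring].
pose Fin z := (- cx K (z * z)%C * (ka * cauchy_tr Gam z * riesz_proj))%K.
pose Fout z := (cx K (z * z)%C * (ka * cauchy_tr Gam z * (one - riesz_proj)))%K.
pose F z := if excluded_middle_informative (ins z) then Fin z else Fout z.
apply: (@entire_division K A _ F).
  rewrite /F; case: excluded_middle_informative => [a|a] /=; rewrite /Fin /Fout cx_sq0; ring.
move=> z0 hz0; case: (spec z0 hz0) => h.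
  have [d [d0 hd]] := inO z0 h.
  have FE z : Cmod (z - z0) < d -> Fin z = F z.
    by move=> hz; rewrite /F; case: excluded_middle_informative => // -[]; have [] := hd z hz.
  split.
    have [f h1] := hol_cauchy_tr C1 res d0 (fun z hz => proj2 (hd z hz)).
    eexists; apply: (hol_local d0) (hol_mul (hol_mul (hol_const (- one)%K z0) (hol_sq z0))
       (hol_mul (hol_mul (hol_const ka z0) h1) (hol_const riesz_proj z0))).
    by move=> z hz; rewrite -FE // /Fin; ring.
  exists d; split=> // z hz; have [s1 s2] := hd z hz.
  rewrite -FE // /Fin.
  transitivity (- cx K (z * z)%C * (ka * (quad z * cauchy_tr Gam z) * riesz_proj))%K; first by ring.
  rewrite pencil_cauchy_tr_simpl // win // P; ring [ti].
have [d [d0 hd]] := outO z0 h.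
have FE z : Cmod (z - z0) < d -> Fout z = F z.
  by move=> hz; rewrite /F; case: excluded_middle_informative => // i; have [_ []] := hd z hz.
split.
  have [f h1] := hol_cauchy_tr C1 res d0 (fun z hz => proj2 (proj2 (hd z hz))).
  eexists; apply: (hol_local d0) (hol_mul (hol_sq z0)
     (hol_mul (hol_mul (hol_const ka z0) h1) (hol_const (one - riesz_proj)%K z0))).
  by move=> z hz; rewrite -FE // /Fout; ring.
exists d; split=> // z hz; have [s1 [s2 s3]] := hd z hz.
rewrite -FE // /Fout.
transitivity (cx K (z * z)%C * (ka * (quad z * cauchy_tr Gam z) * (one - riesz_proj)))%K; first by ring.
rewrite pencil_cauchy_tr_simpl // wout // P; ring.
Qed.

End Separated.

(** Near a spectral point the two winding numbers agree, so the difference of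
   the Cauchy transforms has the difference of the integrals as its product
   with the pencil. *)
Theorem int_pQ_unique m1 (Gam1 : 'I_m1 -> R -> C) ins1 out1 m2 (Gam2 : 'I_m2 -> R -> C) ins2 out2 :
  separates Gam1 ins1 out1 -> separates Gam2 ins2 out2 ->
  (forall z, ~ invertible (quad z) -> (ins1 z /\ ins2 z) \/ (out1 z /\ out2 z)) ->
  int_pQ Gam1 = int_pQ Gam2.
Proof.
move=> sep1 sep2 spec.
have [C1 _ res1 win1 wout1 inO1 outO1 _ _ _] := sep1.
have [C2 _ res2 win2 wout2 inO2 outO2 _ _ _] := sep2.
suff h : (int_pQ Gam1 - int_pQ Gam2)%K = nul.
  transitivity (int_pQ Gam1 - int_pQ Gam2 + int_pQ Gam2)%K; [ring | rewrite h; ring].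
pose F z := (- cx K (z * z)%C * (cauchy_tr Gam1 z - cauchy_tr Gam2 z))%K.
apply: (@entire_division K A _ F); first by rewrite /F cx_sq0; ring.
move=> z0 hz0.
have [d [d0 hd]] : exists d, 0 < d /\ forall z, Cmod (z - z0) < d ->
    ~ on_cycle Gam1 z /\ ~ on_cycle Gam2 z /\ winding Gam1 z = winding Gam2 z.
  case: (spec z0 hz0) => -[s1 s2].
    have [d1 [d10 h1]] := inO1 _ s1; have [d2 [d20 h2]] := inO2 _ s2.
    exists (Rmin d1 d2); split; first exact: Rmin_pos.
    move=> z hz; have [a1 b1] := h1 z (Rlt_le_trans _ _ _ hz (Rmin_l _ _)).
    have [a2 b2] := h2 z (Rlt_le_trans _ _ _ hz (Rmin_r _ _)).
    by rewrite win1 // win2.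
  have [d1 [d10 h1]] := outO1 _ s1; have [d2 [d20 h2]] := outO2 _ s2.
  exists (Rmin d1 d2); split; first exact: Rmin_pos.
  move=> z hz; have [a1 [_ b1]] := h1 z (Rlt_le_trans _ _ _ hz (Rmin_l _ _)).
  have [a2 [_ b2]] := h2 z (Rlt_le_trans _ _ _ hz (Rmin_r _ _)).
  by rewrite wout1 // wout2.
split.
  have [f1 h1] := hol_cauchy_tr C1 res1 d0 (fun z hz => proj1 (hd z hz)).
  have [f2 h2] := hol_cauchy_tr C2 res2 d0 (fun z hz => proj1 (proj2 (hd z hz))).
  eexists; apply: (hol_local d0) (hol_mul (hol_mul (hol_const (- one)%K z0) (hol_sq z0))
    (hol_add h1 (hol_mul (hol_const (- one)%K z0) h2))).
  by move=> z _; rewrite /F; ring.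
exists d; split=> // z hz; have [o1 [o2 e]] := hd z hz.
have q1 := pencil_cauchy_tr_simpl sep1 o1; have q2 := pencil_cauchy_tr_simpl sep2 o2.
transitivity (- cx K (z * z)%C * (quad z * cauchy_tr Gam1 z - quad z * cauchy_tr Gam2 z))%K.
  by rewrite /F; ring.
by rewrite q1 q2 e; ring.
Qed.
End Pencil.

(** * Completeness of the operator algebra *)

(** A choice function for limits serves as the limit operator: equivalent
   filters are equal, so the chosen limits are equal too. *)
Lemma complete_mixin (X : UniformSpace) (x0 : X) :
  (forall F : (X -> Prop) -> Prop, ProperFilter F -> cauchy F ->
     exists l, forall eps : posreal, F (ball l eps)) -> CompleteSpace.mixin_of X.
Proof.
move=> h.
pose lm (F : (X -> Prop) -> Prop) :=
  epsilon (inhabits x0) (fun l => forall eps : posreal, F (ball l eps)).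
apply: (CompleteSpace.Mixin X lm) => [F pF cF|F1 F2 h12 h21].
  by apply: (epsilon_spec (inhabits x0) (fun l => forall eps : posreal, F (ball l eps))); exact: h.
have -> : F1 = F2; last by move=> e; exact: ball_center.
apply: functional_extensionality => P; apply: propositional_extensionality.
by split; [exact: h21 | exact: h12].
Qed.

Section RopComplete.
Variables (V : CompleteNormedModule R_AbsRing) (n : nat).

Lemma ract_bound (a : Cl n) : exists M, 0 <= M /\ forall v : Vn V n, norm (ract v a) <= M * norm v.
Proof.
exists (\big[plus/zero]_(C : {set 'I_n}) \big[plus/zero]_(A : {set 'I_n})
  (Rabs (a A * cl_sgn (symdiff C A) A) : R)); split.
  by apply: sum_ge0 => C; apply: sum_ge0 => A; exact: Rabs_pos.
move=> v; rewrite sum_mulr; apply: sum_le => C; rewrite sum_mulr.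
apply: Rle_trans (norm_sum_le _) _; apply: sum_le => A.
apply: Rle_trans (norm_scal _ _) _; apply: Rmult_le_compat_l; first exact: Rabs_pos.
exact: Vn_norm_comp.
Qed.

Lemma norm_small_zero (W : NormedModule R_AbsRing) (x : W) (c : R) : 0 <= c ->
  (forall d, 0 < d -> norm x <= c * d) -> x = zero.
Proof.
move=> c0 h; apply: norm_eq_zero; apply: Rle_antisym; last exact: norm_ge_0.
apply: le_epsilon => e e0; rewrite Rplus_0_l.
have d0 : 0 < e / (c + 1) by apply: Rdiv_lt_0_compat; lra.
apply: Rle_trans (h _ d0) _.
have q : (c + 1) * (e / (c + 1)) = e by field; lra.
lra.
Qed.

Lemma minus0_eq (W : NormedModule R_AbsRing) (x y : W) : minus x y = zero -> x = y.
Proof.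
move=> h; rewrite -(plus_zero_r x) -(plus_opp_l y) plus_assoc.
by change (plus (minus x y) y = y); rewrite h plus_zero_l.
Qed.

Lemma minus_plus_shift (G : AbelianGroup) (x p q b c : G) :
  minus x (plus p q) = minus (minus x (plus b c)) (plus (minus p b) (minus q c)).
Proof.
rewrite /minus !opp_plus !opp_opp -plus_assoc; congr plus.
have -> : plus (plus (opp p) b) (plus (opp q) c) = plus (plus b c) (plus (opp p) (opp q)).
  rewrite (plus_comm (opp p)) (plus_comm (opp q)) -!plus_assoc; congr plus.
  by rewrite !plus_assoc (plus_comm (opp p) c).
by rewrite -(opp_plus b c) (plus_assoc (opp (plus b c))) plus_opp_l plus_zero_l.
Qed.

(** The pointwise limit. Its distance to an operator S0 of the filter is at
   most a constant times d on the unit ball when the d-ball around S0 is in the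
   filter; linearity, right linearity and boundedness are inherited from such
   approximations. *)
Lemma rop_cauchy_limit (F : (rop V n -> Prop) -> Prop) : ProperFilter F -> cauchy F ->
  exists L : rop V n, forall eps : posreal, F (ball L eps).
Proof.
move=> pF cF.
have nf0 := @norm_factor_gt_0 _ V.
pose nc : R := \big[plus/zero]_(A : {set 'I_n}) (1 : R).
have nc0 : 0 <= nc by apply: sum_ge0 => A; lra.
pose Fc v A (P : V -> Prop) := F (fun S => P (S v A)).
have pFc v A : ProperFilter (Fc v A).
  exact: (@filtermap_proper_filter _ _ (fun S : rop V n => S v A) F pF).
pose L0 (v : Vn V n) : Vn V n := fun A => lim (Fc v A).
have near (S0 : rop V n) (d : R) v A (S : rop V n) :
    ball S0 d S -> norm (minus (S v A) (S0 v A)) <= d * norm v.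
  move=> hS; apply: Rle_trans (Vn_norm_comp (minus (S v) (S0 v)) A) _.
  apply: Rle_trans (rop_normP (minus S S0) v) _.
  by apply: Rmult_le_compat_r; [exact: norm_ge_0 | exact: Rlt_le].
have hL0 v A (e : posreal) : F (fun S : rop V n => ball (L0 v A) e (S v A)).
  apply: (complete_cauchy (Fc v A)) => {}e.
  have nv := norm_ge_0 v.
  have d0 : 0 < e / (norm v + 1) by apply: Rdiv_lt_0_compat; [exact: cond_pos | lra].
  have [S0 hS0] := cF (mkposreal _ d0).
  exists (S0 v A); change (F (fun S : rop V n => ball (S0 v A) e (S v A))).
  apply: filter_imp hS0 => S hS; apply: norm_compat1.
  apply: Rle_lt_trans (near _ _ v A S hS) _ => /=.
  have q : e / (norm v + 1) * (norm v + 1) = e by field; lra.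
  by rewrite -[X in _ < X]q; apply: Rmult_lt_compat_l => //; lra.
have bound (S0 : rop V n) (d : posreal) v : F (ball S0 d) -> norm (minus (L0 v) (S0 v)) <= nc * d * norm v.
  move=> hF.
  have -> : nc * d * norm v = \big[plus/zero]_(A : {set 'I_n}) (d * norm v : R).
    by rewrite Rmult_assoc /nc sum_mulr; apply: eq_bigr => A _; rewrite Rmult_1_l.
  apply: sum_le => A; apply: le_epsilon => e e0.
  have e1 : 0 < e / @norm_factor _ V by apply: Rdiv_lt_0_compat.
  have [S [h1 h2]] := filter_ex _ (filter_and _ _ hF (hL0 v A (mkposreal _ e1))).
  have k1 := near _ _ v A S h1; have k2 := norm_compat2 _ _ _ h2.
  have q : @norm_factor _ V * (e / @norm_factor _ V) = e by field; lra.
  rewrite /= q in k2.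
  change (norm (minus (L0 v A) (S0 v A)) <= d * norm v + e).
  rewrite (minus_trans (S v A)); apply: Rle_trans (norm_triangle _ _) _.
  rewrite -(opp_minus (S v A) (L0 v A)) norm_opp; lra.
have approx d : 0 < d -> exists S0 : rop V n, forall v, norm (minus (L0 v) (S0 v)) <= nc * d * norm v.
  by move=> d0; have [S0 hS0] := cF (mkposreal d d0); exists S0 => v; exact: bound hS0.
have addL u v : L0 (plus u v) = plus (L0 u) (L0 v).
  apply: minus0_eq; apply: (@norm_small_zero _ _ (nc * (norm (plus u v) + norm u + norm v))).
    have := norm_ge_0 u; have := norm_ge_0 v; have := norm_ge_0 (plus u v) => a b c.
    by apply: Rmult_le_pos => //; lra.
  move=> d d0; have [S hS] := approx d d0.
  have -> : minus (L0 (plus u v)) (plus (L0 u) (L0 v)) = minus (minus (L0 (plus u v)) (S (plus u v)))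
     (plus (minus (L0 u) (S u)) (minus (L0 v) (S v))).
    by rewrite (linear_plus _ (rop_linear S)); exact: minus_plus_shift.
  apply: Rle_trans (norm_triangle _ _) _; rewrite norm_opp.
  apply: Rle_trans (Rplus_le_compat_l _ _ _ (norm_triangle _ _)) _.
  have := hS u; have := hS v; have := hS (plus u v); lra.
have scalL (k : R) v : L0 (scal k v) = scal k (L0 v).
  apply: minus0_eq; apply: (@norm_small_zero _ _ (nc * (norm (scal k v) + Rabs k * norm v))).
    apply: Rmult_le_pos => //; apply: Rplus_le_le_0_compat; first exact: norm_ge_0.
    by apply: Rmult_le_pos; [exact: Rabs_pos | exact: norm_ge_0].
  move=> d d0; have [S hS] := approx d d0.
  have -> : minus (L0 (scal k v)) (scal k (L0 v))
     = minus (minus (L0 (scal k v)) (S (scal k v))) (scal k (minus (L0 v) (S v))).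
    rewrite (linear_scal _ (rop_linear S)) /minus scal_distr_l scal_opp_r opp_plus opp_opp.
    rewrite -!plus_assoc; congr plus.
    by rewrite (plus_comm (opp (scal k (L0 v)))) plus_assoc plus_opp_l plus_zero_l.
  apply: Rle_trans (norm_triangle _ _) _; rewrite norm_opp.
  apply: Rle_trans (Rplus_le_compat_l _ _ _ (norm_scal _ _)) _.
  have k1 := hS (scal k v).
  have k2 := Rmult_le_compat_l _ _ _ (Rabs_pos k) (hS v).
  change (abs k) with (Rabs k); lra.
have rightL v a : L0 (ract v a) = ract (L0 v) a.
  have [M [M0 hM]] := ract_bound a.
  apply: minus0_eq; apply: (@norm_small_zero _ _ (nc * (norm (ract v a) + M * norm v))).
    apply: Rmult_le_pos => //; apply: Rplus_le_le_0_compat; first exact: norm_ge_0.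
    by apply: Rmult_le_pos; [lra | exact: norm_ge_0].
  move=> d d0; have [S hS] := approx d d0.
  have ractB (u w : Vn V n) : ract (minus u w) a = minus (ract u a) (ract w a).
    by rewrite /minus ractDl -(scal_opp_one (K := R_Ring) w) ractZl (scal_opp_one (K := R_Ring)).
  have -> : minus (L0 (ract v a)) (ract (L0 v) a)
     = minus (minus (L0 (ract v a)) (S (ract v a))) (ract (minus (L0 v) (S v)) a).
    rewrite rop_right ractB /minus opp_plus opp_opp.
    rewrite -!plus_assoc; congr plus.
    by rewrite (plus_comm (opp (ract (L0 v) a))) plus_assoc plus_opp_l plus_zero_l.
  apply: Rle_trans (norm_triangle _ _) _; rewrite norm_opp.
  apply: Rle_trans (Rplus_le_compat_l _ _ _ (hM _)) _.
  have k1 := hS (ract v a).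
  have k2 := Rmult_le_compat_l _ _ _ M0 (hS v); lra.
have [S1 hS1] := approx 1 Rlt_0_1.
have linL : is_linear L0.
  apply: (is_linear_intro (M := nc * 1 + rop_norm S1)) => // v.
  have -> : L0 v = plus (minus (L0 v) (S1 v)) (S1 v).
    by rewrite /minus -plus_assoc plus_opp_l plus_zero_r.
  apply: Rle_trans (norm_triangle _ _) _.
  have := hS1 v; have := rop_normP S1 v; lra.
exists (Rop linL rightL) => e.
have d0 : 0 < e / 2 / (nc + 1) by repeat apply: Rdiv_lt_0_compat; [exact: cond_pos | lra | lra].
have [S0 hS0] := cF (mkposreal _ d0).
have q : (nc + 1) * (e / 2 / (nc + 1)) = e / 2 by field; lra.
have hL : rop_norm (minus S0 (Rop linL rightL)) <= nc * (e / 2 / (nc + 1)).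
  apply: rop_norm_min; split; first by apply: Rmult_le_pos => //; exact: Rlt_le.
  move=> v; rewrite -norm_opp.
  change (norm (opp (minus (S0 v) (L0 v))) <= nc * (e / 2 / (nc + 1)) * norm v).
  by rewrite opp_minus; exact: bound hS0.
apply: filter_imp hS0 => S hS.
change (rop_norm (minus S (Rop linL rightL)) < e).
rewrite (minus_trans S0); apply: Rle_lt_trans (rop_norm_triangle _ _) _.
have {}hS : rop_norm (minus S S0) < e / 2 / (nc + 1) by exact: hS.
have := cond_pos e; lra.
Qed.

Definition rop_CompleteNormedModule : CompleteNormedModule R_AbsRing :=
  CompleteNormedModule.Pack R_AbsRing (rop V n)
    (CompleteNormedModule.Class R_AbsRing _
      (NormedModule.class _ (rop_NormedModule V n))
      (complete_mixin (zero : rop_UniformSpace V n) rop_cauchy_limit)) (rop V n).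

End RopComplete.

(** Closed subspaces are needed as complete normed modules in their own right,
   to carry the commutative algebra below. *)
Section ClosedSubspace.
Variables (W : CompleteNormedModule R_AbsRing) (S : W -> Prop).
Hypothesis S0 : S zero.
Hypothesis SD : forall x y, S x -> S y -> S (plus x y).
Hypothesis SZ : forall (k : R) x, S x -> S (scal k x).
Hypothesis S_closed : forall x, (forall eps : posreal, exists y, ball x eps y /\ S y) -> S x.

Record subsp : Type := Subsp { subv :> W; subP : S subv }.

Lemma subv_inj (x y : subsp) : subv x = subv y -> x = y.
Proof. by case: x y => [x px] [y py] /= e; subst y; congr Subsp; exact: proof_irrelevance. Qed.

Lemma S_opp x : S x -> S (opp x).
Proof. by rewrite -(scal_opp_one (K := R_Ring)); exact: SZ. Qed.

Definition sub_plus (x y : subsp) := Subsp (SD (subP x) (subP y)).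
Definition sub_zero := Subsp S0.
Definition sub_opp (x : subsp) := Subsp (S_opp (subP x)).
Definition sub_scal (k : R) (x : subsp) := Subsp (SZ k (subP x)).

Lemma sub_plusC x y : sub_plus x y = sub_plus y x.
Proof. by apply: subv_inj; exact: plus_comm. Qed.
Lemma sub_plusA x y z : sub_plus x (sub_plus y z) = sub_plus (sub_plus x y) z.
Proof. by apply: subv_inj; exact: plus_assoc. Qed.
Lemma sub_plus0 x : sub_plus x sub_zero = x.
Proof. by apply: subv_inj; exact: plus_zero_r. Qed.
Lemma sub_plusN x : sub_plus x (sub_opp x) = sub_zero.
Proof. by apply: subv_inj; exact: plus_opp_r. Qed.
Lemma sub_scalA (k l : R) x : sub_scal k (sub_scal l x) = sub_scal (k * l) x.
Proof. by apply: subv_inj; exact: scal_assoc. Qed.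
Lemma sub_scal1 x : sub_scal 1 x = x.
Proof. by apply: subv_inj; exact: (scal_one (K := R_Ring)). Qed.
Lemma sub_scalDr (k : R) x y : sub_scal k (sub_plus x y) = sub_plus (sub_scal k x) (sub_scal k y).
Proof. by apply: subv_inj; exact: scal_distr_l. Qed.
Lemma sub_scalDl (k l : R) x : sub_scal (k + l) x = sub_plus (sub_scal k x) (sub_scal l x).
Proof. by apply: subv_inj; exact: (scal_distr_r (K := R_Ring)). Qed.

Definition sub_AbelianMonoid := AbelianMonoid.Pack subsp
  (AbelianMonoid.Mixin subsp sub_plus sub_zero sub_plusC sub_plusA sub_plus0) subsp.
Definition sub_AbelianGroup := AbelianGroup.Pack subsp (AbelianGroup.Class subsp
  (AbelianMonoid.class sub_AbelianMonoid)
  (AbelianGroup.Mixin sub_AbelianMonoid sub_opp sub_plusN)) subsp.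
Definition sub_ModuleSpace := ModuleSpace.Pack R_Ring subsp (ModuleSpace.Class R_Ring subsp
  (AbelianGroup.class sub_AbelianGroup)
  (ModuleSpace.Mixin R_Ring sub_AbelianGroup sub_scal sub_scalA sub_scal1 sub_scalDr sub_scalDl)) subsp.
Definition sub_UniformMixin := UniformSpace.Mixin subsp sub_zero
  (fun x (e : R) y => ball (subv x) e (subv y))
  (fun x e => ball_center (subv x) e)
  (fun x y e => ball_sym (subv x) (subv y) e)
  (fun x y z e1 e2 => ball_triangle (subv x) (subv y) (subv z) e1 e2).
Definition sub_NormedModuleAux := NormedModuleAux.Pack R_AbsRing subsp
  (NormedModuleAux.Class R_AbsRing subsp (ModuleSpace.class _ sub_ModuleSpace) sub_UniformMixin) subsp.
Definition sub_NormedModule := NormedModule.Pack R_AbsRing subsp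
  (NormedModule.Class R_AbsRing subsp (NormedModuleAux.class _ sub_NormedModuleAux)
  (NormedModule.Mixin R_AbsRing sub_NormedModuleAux (fun x => norm (subv x)) (@norm_factor _ W)
    (fun x y => norm_triangle (subv x) (subv y))
    (fun k x => norm_scal k (subv x))
    (fun x y e => @norm_compat1 _ W (subv x) (subv y) e)
    (fun x y e => @norm_compat2 _ W (subv x) (subv y) e)
    (fun x h => @subv_inj x sub_zero (norm_eq_zero (subv x) h)))) subsp.

Lemma sub_cauchy_limit (F : (sub_NormedModule -> Prop) -> Prop) : ProperFilter F -> cauchy F ->
  exists l : sub_NormedModule, forall eps : posreal, F (ball l eps).
Proof.
move=> pF cF; pose G (P : W -> Prop) := F (fun x => P (subv x)).
have pG : ProperFilter G by exact: (@filtermap_proper_filter _ _ subv F pF).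
have hl : forall eps : posreal, G (ball (lim G) eps).
  apply: (complete_cauchy G) => e; have [x hx] := cF e.
  by exists (subv x).
have Sl : S (lim G).
  by apply: S_closed => e; have [x hx] := @filter_ex _ F _ _ (hl e : F (fun x => ball (lim G) e (subv x)));
     exists (subv x); split=> //; exact: subP.
by exists (Subsp Sl).
Qed.

Definition sub_CompleteNormedModule : CompleteNormedModule R_AbsRing :=
  CompleteNormedModule.Pack R_AbsRing subsp
    (CompleteNormedModule.Class R_AbsRing subsp (NormedModule.class _ sub_NormedModule)
      (complete_mixin (sub_zero : sub_NormedModule) sub_cauchy_limit)) subsp.

Lemma subv_linear : is_linear (fun x : sub_CompleteNormedModule => (subv x : W)).
Proof.
split=> //; exists 1; split; first lra.
by move=> x; rewrite Rmult_1_l; exact: Rle_refl.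
Qed.

End ClosedSubspace.

(** * Composition of operators and left multiplication *)

Section RopAlgebra.
Variables (V : NormedModule R_AbsRing) (n : nat).
Implicit Types (S X Y : rop V n) (a b : Cl n).

Lemma comp_plusl S X Y : rop_comp (plus S X) Y = plus (rop_comp S Y) (rop_comp X Y).
Proof. by apply: rop_ext => v. Qed.

Lemma comp_plusr S X Y : rop_comp Y (plus S X) = plus (rop_comp Y S) (rop_comp Y X).
Proof. by apply: rop_ext => v; exact: linear_plus (rop_linear Y) _ _. Qed.

Lemma comp_scall (k : R) S Y : rop_comp (scal k S) Y = scal k (rop_comp S Y).
Proof. by apply: rop_ext => v. Qed.

Lemma comp_scalr (k : R) S Y : rop_comp Y (scal k S) = scal k (rop_comp Y S).
Proof. by apply: rop_ext => v; exact: linear_scal (rop_linear Y) _ _. Qed.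

Lemma comp_oppl S Y : rop_comp (opp S) Y = opp (rop_comp S Y).
Proof. by apply: rop_ext => v. Qed.

Lemma comp_oppr S Y : rop_comp Y (opp S) = opp (rop_comp Y S).
Proof. by rewrite -(scal_opp_one (K := R_Ring) S) comp_scalr (scal_opp_one (K := R_Ring)). Qed.

Lemma comp_zerol Y : rop_comp zero Y = zero.
Proof. by apply: rop_ext => v. Qed.

Lemma comp_zeror Y : rop_comp Y zero = zero.
Proof. by apply: rop_ext => v; exact: linear_zero (rop_linear Y). Qed.

Lemma compA S X Y : rop_comp S (rop_comp X Y) = rop_comp (rop_comp S X) Y.
Proof. by apply: rop_ext. Qed.

Lemma comp_idl S : rop_comp rop_id S = S.
Proof. by apply: rop_ext. Qed.

Lemma comp_idr S : rop_comp S rop_id = S.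
Proof. by apply: rop_ext. Qed.

Lemma comp_suml (J : finType) (F : J -> rop V n) Y :
  rop_comp (\big[plus/zero]_j F j) Y = \big[plus/zero]_j rop_comp (F j) Y.
Proof.
apply: (big_morph (fun S => rop_comp S Y)); [by move=> S X; exact: comp_plusl | exact: comp_zerol].
Qed.

Lemma comp_sumr (J : finType) (F : J -> rop V n) Y :
  rop_comp Y (\big[plus/zero]_j F j) = \big[plus/zero]_j rop_comp Y (F j).
Proof.
apply: (big_morph (rop_comp Y)); [by move=> S X; exact: comp_plusr | exact: comp_zeror].
Qed.

Lemma rop_norm_comp S X : norm (rop_comp S X) <= norm S * norm X.
Proof.
apply: rop_norm_min; split; first by apply: Rmult_le_pos; exact: rop_norm_ge0.
move=> v; apply: Rle_trans (rop_normP S (X v)) _; rewrite Rmult_assoc.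
by apply: Rmult_le_compat_l; [exact: rop_norm_ge0 | exact: rop_normP].
Qed.

Lemma rop_norm_id : norm (rop_id : rop V n) <= 1.
Proof. by apply: rop_norm_min; split; [lra | move=> v; rewrite Rmult_1_l; exact: Rle_refl]. Qed.

Lemma comp_linearl Y : is_linear (fun S : rop V n => rop_comp Y S).
Proof.
split; [by move=> S X; exact: comp_plusr | by move=> k S; exact: comp_scalr |].
exists (norm Y + 1); have n0 := norm_ge_0 Y; split; first lra.
by move=> S; apply: Rle_trans (rop_norm_comp Y S) _; have := norm_ge_0 S; nra.
Qed.

Lemma comp_linearr Y : is_linear (fun S : rop V n => rop_comp S Y).
Proof.
split; [by move=> S X; exact: comp_plusl | by move=> k S; exact: comp_scall |].
exists (norm Y + 1); have n0 := norm_ge_0 Y; split; first lra.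
by move=> S; apply: Rle_trans (rop_norm_comp S Y) _; have := norm_ge_0 S; nra.
Qed.

Lemma rop_inv_eq S X : rop_comp S X = rop_id -> rop_comp X S = rop_id -> rop_inv S = X.
Proof.
move=> h1 h2; have [k1 k2] := rop_invP (ex_intro _ X (conj h1 h2)).
by rewrite -(comp_idl (rop_inv S)) -h2 -compA k1 comp_idr.
Qed.

Lemma lmulD a b : lmul (V := V) (plus a b) = plus (lmul a) (lmul b).
Proof.
apply: rop_ext => v; apply: functional_extensionality => C.
rewrite /= /lact [RHS]/plus /= /Vn_plus -big_split; apply: eq_bigr => A _.
by rewrite Rmult_plus_distr_r; exact: (scal_distr_r (K := R_Ring)).
Qed.

Lemma lmulZ (k : R) a : lmul (V := V) (scal k a) = scal k (lmul a).
Proof.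
apply: rop_ext => v; apply: functional_extensionality => C.
rewrite /= /lact [RHS]/scal /= /Vn_scal scal_bigl; apply: eq_bigr => A _.
by rewrite scal_assoc; congr scal; rewrite /scal /= /Vn_scal /scal /= /mult /=; ring.
Qed.

Lemma lmul0 : lmul (V := V) (zero : Cl n) = zero.
Proof.
by rewrite -(scal_zero_l (K := R_Ring) (zero : Cl n)) lmulZ; exact: (scal_zero_l (K := R_Ring)).
Qed.

Lemma lmulN a : lmul (V := V) (opp a) = opp (lmul a).
Proof. by rewrite -(scal_opp_one (K := R_Ring) a) lmulZ (scal_opp_one (K := R_Ring)). Qed.

Lemma lmulM a b : lmul (V := V) (cl_mul a b) = rop_comp (lmul a) (lmul b).
Proof. by apply: rop_ext => v; exact: lact_assoc. Qed.

Lemma lmul1 : lmul (V := V) (cl_one n) = rop_id.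
Proof. by apply: rop_ext => v; exact: lact_one. Qed.

Lemma lmul_sum (J : finType) (F : J -> Cl n) :
  lmul (V := V) (\big[plus/zero]_j F j) = \big[plus/zero]_j lmul (F j).
Proof. by apply: (big_morph (lmul (V := V))); [exact: lmulD | exact: lmul0]. Qed.

Lemma cwise_lmul (f : V -> V) (lf : is_linear f) a :
  rop_comp (cwise n lf) (lmul a) = rop_comp (lmul a) (cwise n lf).
Proof.
apply: rop_ext => v; apply: functional_extensionality => C; rewrite /= /lact.
rewrite (big_morph f (linear_plus _ lf) (linear_zero _ lf)).
by apply: eq_bigr => A _; exact: linear_scal lf _ _.
Qed.

Lemma plus_self_inj (x y : rop V n) : plus x x = plus y y -> x = y.
Proof.
have d z : plus z z = scal (2 : R) z :> rop V n.
  rewrite (_ : 2 = plus 1 1 :> R) // (scal_distr_r (K := R_Ring)) .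
  by rewrite !(scal_one (K := R_Ring)).
have e z : z = scal (/ 2) (scal (2 : R) z) :> rop V n.
  rewrite scal_assoc (_ : mult (/ 2) 2 = 1 :> R); last by rewrite /mult /=; field.
  by rewrite (scal_one (K := R_Ring)).
by rewrite !d => h; rewrite (e x) h -e.
Qed.

(** In the square of e_1 x_1 + ... + e_n x_n the mixed terms cancel by
   anticommutation. *)
Lemma clifford_square (x : 'I_n -> rop V n) :
  (forall j k, rop_comp (x j) (x k) = rop_comp (x k) (x j)) ->
  (forall j a, rop_comp (x j) (lmul a) = rop_comp (lmul a) (x j)) ->
  let W := \big[plus/zero]_(j < n) rop_comp (lmul (cl_gen j)) (x j) in
  rop_comp W W = opp (\big[plus/zero]_(j < n) rop_comp (x j) (x j)).
Proof.
move=> xx xl W.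
pose a j k := rop_comp (lmul (cl_mul (cl_gen j) (cl_gen k))) (rop_comp (x j) (x k)).
have WW : rop_comp W W = \big[plus/zero]_(j < n) \big[plus/zero]_(k < n) a j k.
  rewrite /W comp_suml; apply: eq_bigr => j _; rewrite comp_sumr; apply: eq_bigr => k _.
  by rewrite /a lmulM -!compA; congr rop_comp; rewrite !compA xl.
have ajj j : a j j = opp (rop_comp (x j) (x j)).
  by rewrite /a cl_gen_sq lmulN lmul1 comp_oppl comp_idl.
have ajk j k : j != k -> plus (a j k) (a k j) = zero.
  by move=> jk; rewrite /a (xx k j) -comp_plusl -lmulD cl_gen_anticomm // lmul0 comp_zerol.
apply: plus_self_inj; rewrite WW {2}exchange_big -big_split /=.
have -> : opp (\big[plus/zero]_(j < n) rop_comp (x j) (x j)) = \big[plus/zero]_(j < n) a j j.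
  rewrite -(scal_opp_one (K := R_Ring)) scal_bigl; apply: eq_bigr => j _.
  by rewrite ajj (scal_opp_one (K := R_Ring)).
rewrite -big_split; apply: eq_bigr => j _.
rewrite -big_split (bigD1 j) //= big1 ?plus_zero_r // => k kj.
by apply: ajk; rewrite eq_sym.
Qed.

End RopAlgebra.

(** * The commutative algebra generated by the imaginary unit and the components *)

Section Bicommutant.
Variables (V : CompleteNormedModule R_AbsRing) (n : nat) (T : BC01 V n).
Variables (I : pv n) (I_sphere : imag_sphere I).

Definition imag_unit_op : rop V n := lmul (paravec I).

Lemma paravec_slice (z : C) :
  paravec (slice_pt I z) = plus (scal (fst z) (cl_one n)) (scal (snd z) (paravec I)).
Proof.
have [I0 _] := I_sphere.
rewrite /paravec /slice_pt eqxx I0 (scal_zero_l (K := R_Ring)) plus_zero_l Rmult_0_r Rplus_0_r.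
congr plus; rewrite scal_bigl; apply: eq_bigr => j _.
by rewrite (scal_assoc (K := R_Ring)) eq_sym (negbTE (neq_lift _ _)) Rplus_0_l.
Qed.

Lemma imag_unit_op_sq : rop_comp imag_unit_op imag_unit_op = opp rop_id.
Proof.
have [I0 I1] := I_sphere.
pose x j : rop V n := scal (I (lift ord0 j)) rop_id.
have JE : imag_unit_op = \big[plus/zero]_(j < n) rop_comp (lmul (cl_gen j)) (x j).
  rewrite /imag_unit_op /paravec I0 (scal_zero_l (K := R_Ring)) plus_zero_l lmul_sum.
  by apply: eq_bigr => j _; rewrite lmulZ /x comp_scalr comp_idr.
rewrite JE clifford_square => [|j k|j a]; last 2 first.
- by rewrite /x !comp_scall !comp_scalr !scal_assoc; congr scal; rewrite /mult /=; ring.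
- by rewrite /x comp_scall comp_scalr comp_idl comp_idr.
congr opp; rewrite -[RHS](scal_one (K := R_Ring)) [X in scal X _](_ : _ = 1 :> R) // -I1 sum_scal.
apply: eq_bigr => j _; rewrite /x comp_scall comp_scalr comp_idl scal_assoc.
by congr scal; rewrite /mult /=; ring.
Qed.

Definition commutant (X : rop V n) := rop_comp X imag_unit_op = rop_comp imag_unit_op X /\
  forall l, rop_comp X (comp_op T l) = rop_comp (comp_op T l) X.

(** The bicommutant is commutative because its generators commute, it is closed
   under limits, and, unlike the closed algebra generated, it contains the
   inverses of its invertible operators. *)
Definition bic (S : rop V n) := forall X, commutant X -> rop_comp S X = rop_comp X S.

Lemma comp_op_comm k l : rop_comp (comp_op T k) (comp_op T l) = rop_comp (comp_op T l) (comp_op T k).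
Proof. by apply: rop_ext => v; apply: functional_extensionality => A; exact: component_comm. Qed.

Lemma imag_unit_op_commutant : commutant imag_unit_op.
Proof. by split=> // l; rewrite cwise_lmul. Qed.

Lemma comp_op_commutant l : commutant (comp_op T l).
Proof. by split=> [|k]; [rewrite cwise_lmul | exact: comp_op_comm]. Qed.

Lemma bic_commutant S : bic S -> commutant S.
Proof.
by move=> h; split=> [|l]; apply: h; [exact: imag_unit_op_commutant | exact: comp_op_commutant].
Qed.

Lemma bic0 : bic zero.
Proof. by move=> X _; rewrite comp_zerol comp_zeror. Qed.

Lemma bicD S S' : bic S -> bic S' -> bic (plus S S').
Proof. by move=> h h' X hX; rewrite comp_plusl comp_plusr h // h'. Qed.

Lemma bicZ (k : R) S : bic S -> bic (scal k S).
Proof. by move=> h X hX; rewrite comp_scall comp_scalr h. Qed.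

Lemma bicM S S' : bic S -> bic S' -> bic (rop_comp S S').
Proof. by move=> h h' X hX; rewrite -compA h' // compA h // compA. Qed.

Lemma bic1 : bic rop_id.
Proof. by move=> X _; rewrite comp_idl comp_idr. Qed.

Lemma bic_imag_unit_op : bic imag_unit_op.
Proof. by move=> X [h _]. Qed.

Lemma bic_comp_op l : bic (comp_op T l).
Proof. by move=> X [_ h]. Qed.

Lemma bic_closed (S : rop_CompleteNormedModule V n) :
  (forall eps : posreal, exists Y : rop_CompleteNormedModule V n, ball S eps Y /\ bic Y) -> bic S.
Proof.
move=> h X hX; apply: minus0_eq.
apply: (@norm_small_zero _ _ (2 * norm X)); first by have := norm_ge_0 X; lra.
move=> d d0; have [Y [h1 h2]] := h (mkposreal d d0).
have {}h1 : norm (minus Y S) <= d by apply: Rlt_le; exact: h1.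
have -> : minus (rop_comp S X) (rop_comp X S)
    = minus (rop_comp X (minus Y S)) (rop_comp (minus Y S) X).
  rewrite /minus comp_plusl comp_plusr comp_oppl comp_oppr h2 //.
  rewrite opp_plus opp_opp (plus_comm (rop_comp X Y)) -plus_assoc (plus_assoc (rop_comp X Y)).
  by rewrite plus_opp_r plus_zero_l plus_comm.
apply: Rle_trans (norm_triangle _ _) _; rewrite norm_opp.
have key (D : rop V n) : norm D <= d -> norm (rop_comp X D) + norm (rop_comp D X) <= 2 * norm X * d.
  move=> hD; have k1 := rop_norm_comp X D; have k2 := rop_norm_comp D X.
  have k3 := Rmult_le_compat_l _ _ _ (norm_ge_0 X) hD; lra.
exact: key h1.
Qed.

Definition bic_space :=
  @sub_CompleteNormedModule (rop_CompleteNormedModule V n) bic bic0 bicD bicZ bic_closed.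

Definition bk_mul (x y : bic_space) : bic_space := Subsp (bicM (subP x) (subP y)).
Definition bk_one : bic_space := Subsp bic1.
Definition bk_iu : bic_space := Subsp bic_imag_unit_op.

Lemma bk_mulC x y : bk_mul x y = bk_mul y x.
Proof. by apply: subv_inj => /=; apply: (subP x); apply: bic_commutant; exact: subP. Qed.
Lemma bk_mulA x y z : bk_mul x (bk_mul y z) = bk_mul (bk_mul x y) z.
Proof. by apply: subv_inj => /=; exact: compA. Qed.
Lemma bk_mul1 x : bk_mul bk_one x = x.
Proof. by apply: subv_inj => /=; exact: comp_idl. Qed.
Lemma bk_mulDl x y z : bk_mul (plus x y) z = plus (bk_mul x z) (bk_mul y z).
Proof. by apply: subv_inj => /=; exact: comp_plusl. Qed.
Lemma bk_scal_mul (k : R) x y : scal k (bk_mul x y) = bk_mul (scal k x) y.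
Proof. by apply: subv_inj => /=; rewrite comp_scall. Qed.
Lemma bk_iu_sq : bk_mul bk_iu bk_iu = opp bk_one.
Proof. by apply: subv_inj => /=; exact: imag_unit_op_sq. Qed.
Lemma bk_norm_mul x y : norm (bk_mul x y) <= norm x * norm y.
Proof. exact: rop_norm_comp. Qed.
Lemma bk_norm_one : norm bk_one <= 1.
Proof. exact: rop_norm_id. Qed.

Definition bic_algebra : cba :=
  Cba bk_mulC bk_mulA bk_mul1 bk_mulDl bk_scal_mul bk_iu_sq bk_norm_mul bk_norm_one.

Definition rop_of (x : bic_algebra) : rop V n := subv x.

Lemma rop_of_linear : is_linear (U := bic_algebra) (V := rop_NormedModule V n) rop_of.
Proof. exact: (@subv_linear (rop_CompleteNormedModule V n) bic bic0 bicD bicZ bic_closed). Qed.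

Lemma rop_of_inj x y : rop_of x = rop_of y -> x = y.
Proof. exact: (@subv_inj (rop_CompleteNormedModule V n) bic). Qed.

Lemma invertibleP x : rop_invertible (rop_of x) <-> invertible x.
Proof.
split=> [[S [h1 h2]]|[y h]].
  have bS : bic S.
    move=> X hX; have e := subP x X hX; rewrite -/(rop_of x) in e.
    by rewrite -[in LHS](comp_idr X) -h1 (compA X) -e -(compA (rop_of x)) (compA S) h2 comp_idl.
  by exists (Subsp bS : bic_algebra); apply: rop_of_inj.
exists (rop_of y); split; first exact: (f_equal rop_of h).
by have := mulC x y => e; have := f_equal rop_of h; rewrite e.
Qed.

Lemma rop_of_inv x : invertible x -> rop_inv (rop_of x) = rop_of (kinv x).
Proof.
move=> /kinvP h; apply: rop_inv_eq; first exact: (f_equal rop_of h).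
by rewrite mulC in h; exact: (f_equal rop_of h).
Qed.

Lemma rop_of_pow x k : rop_pow (rop_of x) k = rop_of (kpow x k).
Proof. by elim: k => [|k IH] //; rewrite /rop_pow iterS -/(rop_pow _ _) IH. Qed.

Lemma lmul_slice (z : C) : lmul (paravec (slice_pt I z)) = rop_of (cx bic_algebra z).
Proof. by rewrite paravec_slice lmulD !lmulZ lmul1. Qed.

Lemma lmul_pow (z : C) k : lmul (cl_pow (paravec (slice_pt I z)) k) = rop_of (kpow (cx bic_algebra z) k).
Proof.
elim: k => [|k IH]; first by rewrite /cl_pow /= lmul1.
by rewrite /cl_pow iterS -/(cl_pow _ _) lmulM IH lmul_slice.
Qed.
End Bicommutant.

(** * The spectrum of the pencil *)

Section RealSpectrum.
Variables (V : CompleteNormedModule R_AbsRing) (n : nat) (T : BC01 V n).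
Variables (I : pv n) (I_sphere : imag_sphere I).
Notation K := (bic_algebra T I_sphere).
Notation cxK := (cx K).

Add Ring Kring : (cba_ring K).
Ltac kring := match goal with |- @eq _ ?x ?y => change (x = y :> K); ring end.

Definition bic_component (l : 'I_n.+1) : K := Subsp (@bic_comp_op V n T I l).

(** On the complexification (f - z)(f - conj z) acts as (f - a)^2 + b^2 on each
   of the two factors, so its inverse restricts to V. *)
Lemma real_quadratic_inverse (f : V -> V) (lf : is_linear f) (a b : R) :
  ~ spectrum f (a, b) -> ~ spectrum f (a, - b) ->
  let N x := minus (f x) (scal a x) in
  exists h : V -> V, is_linear h /\
    (forall x, h (plus (N (N x)) (scal (b * b) x)) = x) /\
    (forall x, plus (N (N (h x))) (scal (b * b) (h x)) = x).
Proof.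
move=> /NNPP [g [[lg _] [g1 g2]]] /NNPP [g' [[lg' _] [g1' g2']]] N.
(* (f - a)^2 + b^2, which acts diagonally on the complexification *)
pose Z x := plus (N (N x)) (scal (b * b) x).
pose M (l : C) (x : V * V) := minus (cx_op f x) (cx_scal l x).
have lN : is_linear N.
  have l1 : is_linear (fun x : V => scal a x).
    by apply: (is_linear_scal_r (K := R_AbsRing)) => x y; exact: Rmult_comm.
  have l2 := is_linear_comp _ _ l1 is_linear_opp.
  exact: (is_linear_comp _ _ (is_linear_prod _ _ lf l2) is_linear_plus).
have ME c x y : M (a, c) (x, y) = (plus (N x) (scal c y), minus (N y) (scal c x)).
  rewrite /M /cx_op /cx_scal /= /N; apply: injective_projections => /=.
    by rewrite /minus opp_plus opp_opp -plus_assoc.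
  by rewrite /minus opp_plus -plus_assoc.
clearbody N.
have MM x y : M (a, - b) (M (a, b) (x, y)) = (Z x, Z y).
  have nb (u : V) : scal (- b) u = opp (scal b u) by exact: (scal_opp_l (K := R_Ring) b u).
  rewrite !ME /Z; apply: injective_projections; rewrite /= /minus (linear_plus _ lN).
    rewrite (linear_scal _ lN) nb scal_distr_l scal_opp_r opp_plus opp_opp (scal_assoc (K := R_Ring)).
    by rewrite -plus_assoc (plus_assoc (scal b (N y))) plus_opp_r plus_zero_l.
  rewrite nb opp_opp -(nb x) (linear_scal _ lN) nb scal_distr_l (scal_assoc (K := R_Ring)).
  by rewrite -plus_assoc (plus_assoc (opp _)) plus_opp_l plus_zero_l.
have lin0 : is_linear (fun x : V => (x, zero : V)).
  exact: (is_linear_prod _ _ is_linear_id is_linear_zero).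
have lh := is_linear_comp _ _ (is_linear_comp _ _ (is_linear_comp _ _ lin0 lg') lg) is_linear_fst.
exists (fun x => fst (g (g' (x, zero)))); split; first exact: lh.
have Z0 : Z zero = zero by rewrite /Z !(linear_zero _ lN) scal_zero_r plus_zero_r.
split=> x.
  have := MM x zero; rewrite Z0 /Z => e.
  rewrite -e; have := g1' (M (a, b) (x, zero)); rewrite -/(M _ _) => ->.
  by have := g1 (x, zero); rewrite -/(M _ _) => ->.
have := MM (fst (g (g' (x, zero)))) (snd (g (g' (x, zero)))); rewrite -surjective_pairing.
have := g2 (g' (x, zero)); rewrite -/(M _ _) => ->.
have := g2' (x, zero); rewrite -/(M _ _) => -> e.
by have := f_equal fst e.
Qed.

(** A nonreal point is regular because (f - z)(f - conj z) is a real operator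
   with a real inverse, which acts on V_n componentwise. *)
Lemma component_resolvent (l : 'I_n.+1) (z : C) :
  (forall lam : C, spectrum (T l) lam -> Im lam = 0) -> snd z <> 0 ->
  invertible (cxK z - bic_component l)%K.
Proof.
move=> hT b0; case: z b0 => a b /= b0.
have off (c : R) : c <> 0 -> ~ spectrum (T l) (a, c) by move=> c0 h; apply: c0; exact: hT h.
have [h [lh [h1 h2]]] := real_quadratic_inverse (component_linear T l) (off b b0)
  (off (- b) (Ropp_neq_0_compat _ b0)).
apply: (@invertible_mul _ _ (cxK (a, Ropp b) - bic_component l)%K).
have e : ((cxK (a, b) - bic_component l) * (cxK (a, Ropp b) - bic_component l)
    = (bic_component l - sc a one) * (bic_component l - sc a one) + sc (b * b) one)%K.
  have i2 := iu_sq K; change (iu * iu = - one :> K)%K in i2.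
  have e1 c : cxK (a, c) = (sc a one + sc c one * iu)%K by rewrite /cx /= (scE c iu).
  by rewrite !e1 scN (scM b b one) (scE b (sc b one)); ring [i2].
rewrite e; apply/invertibleP; exists (cwise n lh).
by split; apply: rop_ext => v; apply: functional_extensionality => A;
  [exact: (h2 (v A)) | exact: (h1 (v A))].
Qed.

Lemma Csqrt_nonreal (w : C) : ~ (snd w = 0 /\ 0 <= fst w) -> exists z : C, (z * z)%C = w /\ snd z <> 0.
Proof.
case: w => a b /= hw.
pose r := Cmod (a, b).
have r2 : r * r = a * a + b * b.
  by rewrite /r /Cmod /= sqrt_sqrt; [ring | have := Rle_0_sqr a; have := Rle_0_sqr b; rewrite /Rsqr; lra].
have r0 : 0 <= r := Cmod_ge_0 _.
have ra : 0 < r - a.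
  apply: Rnot_le_lt => h; apply: hw.
  have b2 : b * b = 0 by have := Rle_0_sqr b; rewrite /Rsqr; nra.
  by split; [nra | lra].
pose be := sqrt ((r - a) / 2).
have be0 : 0 < be by apply: sqrt_lt_R0; lra.
have be2 : be * be = (r - a) / 2 by apply: sqrt_sqrt; lra.
exists (b / (2 * be), be); split; last by rewrite /=; lra.
apply: injective_projections => /=; last by field; lra.
have -> : b / (2 * be) * (b / (2 * be)) = b * b / (4 * (be * be)) by field; lra.
rewrite be2; have -> : b * b = (r - a) * (r + a) by lra.
field; lra.
Qed.

(** w - x^2 = (z - x)(z + x) with z a nonreal square root of w. *)
Lemma component_sq_nonneg (l : 'I_n.+1) :
  (forall lam : C, spectrum (T l) lam -> Im lam = 0) -> nonneg_spectrum (bic_component l * bic_component l)%K.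
Proof.
move=> hT w hw; have [z [<- z0]] := Csqrt_nonreal hw.
rewrite cxM (_ : sub _ _
  = (- one * ((cxK z - bic_component l) * (cxK (- z)%C - bic_component l)))%K);
  last by rewrite cxN; ring.
apply: mul_invertible; first by exists (- one)%K; rewrite /inv_pair; ring.
apply: mul_invertible; first exact: component_resolvent.
by apply: component_resolvent => //=; exact: Ropp_neq_0_compat.
Qed.

Definition bic_square_sum : K :=
  \big[plus/zero]_(l < n) (bic_component (lift ord0 l) * bic_component (lift ord0 l))%K.

Hypothesis T_real : forall (l : 'I_n) (lam : C), spectrum (T (lift ord0 l)) lam -> Im lam = 0.

Lemma bic_square_sum_nonneg : nonneg_spectrum bic_square_sum.
Proof.
apply: (big_ind (@nonneg_spectrum K)); [exact: nonneg_spectrum_nul | by move=> x y; exact: nonneg_spectrum_add |].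
by move=> l _; exact: component_sq_nonneg (@T_real l).
Qed.

Lemma pencil_invertible (z : C) : fst z <> 0 -> invertible (pencil bic_square_sum z).
Proof.
move=> z0; have -> : pencil bic_square_sum z = (- one * (cxK (- (z * z))%C - bic_square_sum))%K.
  by rewrite /pencil cxN; ring.
apply: mul_invertible; first by exists (- one)%K; rewrite /inv_pair; ring.
apply: bic_square_sum_nonneg => -[h1 h2]; case: z z0 h1 h2 => a b /= a0 h1 h2.
have b0 : b = 0 by nra.
rewrite b0 in h2; nra.
Qed.

Hypothesis T0 : forall x : V, T ord0 x = zero.

Lemma comp_op0 : comp_op T ord0 = zero.
Proof. by apply: rop_ext => v; apply: functional_extensionality => A; exact: T0. Qed.

Lemma para_opE : para_op T = vec_part T.
Proof. by rewrite /para_op comp_op0 plus_zero_l. Qed.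

Lemma para_conjE : para_conj T = opp (vec_part T).
Proof. by rewrite /para_conj comp_op0 /minus plus_zero_l. Qed.

Lemma rop_of_sum (J : finType) (F : J -> K) :
  rop_of (\big[plus/zero]_j F j) = \big[plus/zero]_j rop_of (F j).
Proof. by apply: (big_morph (@rop_of _ _ _ _ _)). Qed.

Lemma vec_part_sq : rop_comp (vec_part T) (vec_part T) = opp (rop_of bic_square_sum).
Proof.
rewrite /vec_part clifford_square => [|j k|j a]; last 2 first.
- exact: comp_op_comm.
- exact: cwise_lmul.
by rewrite /bic_square_sum rop_of_sum.
Qed.

Lemma quad_op_slice (z : C) : quad_op T (slice_pt I z) = rop_of (pencil bic_square_sum z).
Proof.
rewrite /quad_op para_opE para_conjE plus_opp_r /cl_rop comp_zeror comp_oppr vec_part_sq opp_opp.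
rewrite (lmul_pow T I_sphere) comp_idr /minus opp_zero plus_zero_r /pencil.
have -> : kpow (cxK z) 2 = cxK (z * z)%C by rewrite cxM /kpow; kring.
by [].
Qed.

Lemma Q_op_slice (z : C) : invertible (pencil bic_square_sum z) ->
  Q_op T (slice_pt I z) = rop_of (pencil_inv bic_square_sum z).
Proof. by move=> h; rewrite /Q_op quad_op_slice rop_of_inv. Qed.

Lemma diff_IE (dz : C) : lmul (diff_I I dz) = rop_of (cxK dz * - iu)%K.
Proof. by rewrite /diff_I lmulM lmulN (lmul_slice T I_sphere). Qed.

Lemma left_distr (c : R) (X W q d p : rop V n) :
  rop_comp (rop_comp (scal c (rop_comp (minus X (opp W)) q)) d) p
  = scal c (plus (rop_comp (rop_comp (rop_comp X q) d) p) (rop_comp W (rop_comp (rop_comp q d) p))).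
Proof. by rewrite !comp_scall /minus opp_opp !comp_plusl -!compA. Qed.

Lemma right_distr (c : R) (X W q d p : rop V n) :
  rop_comp p (rop_comp d (scal c (rop_comp q (minus X (opp W)))))
  = scal c (plus (rop_comp p (rop_comp d (rop_comp q X))) (rop_comp (rop_comp p (rop_comp d q)) W)).
Proof. by rewrite !comp_scalr /minus opp_opp !comp_plusr -!compA. Qed.

(** The vector part of T does not commute with I in general, so it is kept
   outside the commutative algebra, to the left or to the right. *)
Lemma left_integrandE k (z dz : C) : invertible (pencil bic_square_sum z) ->
  left_integrand T I k z dz = scal (gamma_n n)
    (plus (rop_of ((- iu) * (kpow (cxK z) k.+1 * kpow (pencil_inv bic_square_sum z) n.+1./2) * cxK dz)%K)
       (rop_comp (vec_part T)
         (rop_of ((- iu) * (kpow (cxK z) k * kpow (pencil_inv bic_square_sum z) n.+1./2)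
            * cxK dz)%K))).
Proof.
move=> hz; rewrite /left_integrand /FL /rop_cl Q_op_slice // rop_of_pow (lmul_pow T I_sphere) diff_IE.
rewrite /cl_rop comp_idr (lmul_slice T I_sphere) para_conjE left_distr.
set q := kpow (pencil_inv bic_square_sum z) _; set p := kpow (cxK z) k.
have -> : ((- iu) * (kpow (cxK z) k.+1 * q) * cxK dz = cxK z * q * (cxK dz * - iu) * p)%K.
  by rewrite (_ : kpow (cxK z) k.+1 = (cxK z * p)%K) //; ring.
by have -> : ((- iu) * (p * q) * cxK dz = q * (cxK dz * - iu) * p)%K by ring.
Qed.

Lemma right_integrandE k (z dz : C) : invertible (pencil bic_square_sum z) ->
  right_integrand T I k z dz = scal (gamma_n n)
    (plus (rop_of ((- iu) * (kpow (cxK z) k.+1 * kpow (pencil_inv bic_square_sum z) n.+1./2) * cxK dz)%K)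
       (rop_comp
         (rop_of ((- iu) * (kpow (cxK z) k * kpow (pencil_inv bic_square_sum z) n.+1./2)
            * cxK dz)%K)
         (vec_part T))).
Proof.
move=> hz; rewrite /right_integrand /FR /cl_rop Q_op_slice // rop_of_pow (lmul_pow T I_sphere) diff_IE.
rewrite comp_idr (lmul_slice T I_sphere) para_conjE right_distr.
set q := kpow (pencil_inv bic_square_sum z) _; set p := kpow (cxK z) k.
have -> : ((- iu) * (kpow (cxK z) k.+1 * q) * cxK dz = p * ((cxK dz * - iu) * (q * cxK z)))%K.
  by rewrite (_ : kpow (cxK z) k.+1 = (cxK z * p)%K) //; ring.
by have -> : ((- iu) * (p * q) * cxK dz = p * ((cxK dz * - iu) * q))%K by ring.
Qed.
End RealSpectrum.

(** * Slices of axially symmetric domains *)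

Section Slices.
Variables (n : nat) (I : pv n) (I_sphere : imag_sphere I).

Lemma sphere_le1 j : Rabs (I j) <= 1.
Proof.
have [I0 I1] := I_sphere.
case: (unliftP ord0 j) => [k ->|->]; last by rewrite I0 Rabs_R0; lra.
have : I (lift ord0 k) ^ 2 <= 1.
  by rewrite -I1; apply: (le_sum1 (F := fun j => I (lift ord0 j) ^ 2)) => i; exact: pow2_ge_0.
by rewrite -pow2_abs; have := Rabs_pos (I (lift ord0 k)); nra.
Qed.

Lemma slice_coord (z z0 : C) j :
  Rabs (slice_pt I z j - slice_pt I z0 j) <= Rabs (fst z - fst z0) + Rabs (snd z - snd z0).
Proof.
have h := sphere_le1 j.
have -> : slice_pt I z j - slice_pt I z0 j
   = (if j == ord0 then fst z - fst z0 else 0) + (snd z - snd z0) * I j.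
  by rewrite /slice_pt; case: (j == ord0); ring.
apply: Rle_trans (Rabs_triang _ _) _; rewrite Rabs_mult.
apply: Rplus_le_compat.
  by case: (j == ord0); [exact: Rle_refl | rewrite Rabs_R0; exact: Rabs_pos].
have := Rabs_pos (snd z - snd z0); nra.
Qed.

Lemma slice_pv_norm (z z0 : C) :
  pv_norm (fun j => slice_pt I z j - slice_pt I z0 j) = Cmod (z - z0).
Proof.
have [I0 I1] := I_sphere.
rewrite /pv_norm /Cmod; congr sqrt; rewrite big_ord_recl.
rewrite (eq_bigr (fun j : 'I_n => I (lift ord0 j) ^ 2 * (snd z - snd z0) ^ 2)); last first.
  by move=> j _; rewrite /slice_pt eq_sym (negbTE (neq_lift _ _)); ring.
rewrite -sum_mulr I1 /slice_pt eqxx I0 /plus /=; ring.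
Qed.

Lemma ballC_Cmod (z0 z : C) (e : R) : Cmod (z - z0) < e -> ball (M := C_UniformSpace) z0 e z.
Proof.
move=> h; have := Rmax_Cmod (z - z0)%C; have := Rmax_l (Rabs (fst (z - z0)%C)) (Rabs (snd (z - z0)%C)).
have := Rmax_r (Rabs (fst (z - z0)%C)) (Rabs (snd (z - z0)%C)) => h1 h2 h3.
by split; [change (Rabs (fst (z - z0)%C) < e) | change (Rabs (snd (z - z0)%C) < e)]; lra.
Qed.

Lemma ballC_Rabs (z0 z : C) (e : R) : ball (M := C_UniformSpace) z0 e z ->
  Rabs (fst z - fst z0) < e /\ Rabs (snd z - snd z0) < e.
Proof. by []. Qed.

Lemma slice_ball (z0 z : C) (e : R) : ball (M := C_UniformSpace) z0 (e / 2) z ->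
  ball (M := pv_space n) (slice_pt I z0) e (slice_pt I z).
Proof.
move=> /ballC_Rabs [h1 h2] j.
change (Rabs (slice_pt I z j - slice_pt I z0 j) < e).
by apply: Rle_lt_trans (slice_coord z z0 j) _; lra.
Qed.

Lemma closure_slice (U : pv n -> Prop) (z : C) :
  closure_set (X := C_UniformSpace) (slice I U) z -> closure_set (X := pv_space n) U (slice_pt I z).
Proof.
move=> h e; have e2 : 0 < e / 2 by have := cond_pos e; lra.
have [y [h1 h2]] := h (mkposreal _ e2).
by exists (slice_pt I y); split=> //; exact: slice_ball.
Qed.

Lemma boundary_slice (U : pv n -> Prop) (z : C) :
  boundary_set (X := C_UniformSpace) (slice I U) z -> boundary_set (X := pv_space n) U (slice_pt I z).
Proof. by move=> [h1 h2]; split; [exact: closure_slice | exact: (@closure_slice (fun y => ~ U y))]. Qed.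

Lemma open_slice (U : pv n -> Prop) (z0 : C) : open (T := pv_space n) U -> slice I U z0 ->
  exists d, 0 < d /\ forall z, Cmod (z - z0) < d -> slice I U z.
Proof.
move=> oU hz; have [e he] := oU _ hz.
have e0 := cond_pos e.
exists (e / 2); split; first lra.
by move=> z h; apply: he; apply: slice_ball; exact: ballC_Cmod.
Qed.

Lemma slice_interior (U : pv n -> Prop) (z : C) : open (T := pv_space n) U -> slice I U z ->
  ~ boundary_set (X := C_UniformSpace) (slice I U) z.
Proof.
move=> oU hz [_ h]; have [e he] := oU _ hz.
have e2 : 0 < e / 2 by have := cond_pos e; lra.
have [y [h1 h2]] := h (mkposreal _ e2); apply: h2; apply: he; exact: slice_ball.
Qed.

Lemma closure_slice_near (D : C -> Prop) (z0 : C) : ~ closure_set (X := C_UniformSpace) D z0 ->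
  exists d, 0 < d /\ forall z, Cmod (z - z0) < d -> ~ closure_set (X := C_UniformSpace) D z.
Proof.
move=> h; have [e he] := not_all_ex_not _ _ h.
have e0 := cond_pos e; have e2 : 0 < e / 2 by lra.
exists (e / 2); split=> // z hz hc; have [y [h1 h2]] := hc (mkposreal _ e2).
apply: he; exists y; split=> //.
have {h1} := ball_triangle _ _ _ _ _ (ballC_Cmod hz) h1.
by rewrite /= (_ : e / 2 + e / 2 = e) //; field.
Qed.

Lemma closure_sub (X : UniformSpace) (D : X -> Prop) z : D z -> closure_set D z.
Proof. by move=> h e; exists z; split=> //; exact: ball_center. Qed.

Lemma slice_conj (U : pv n -> Prop) (u v : R) : axially_symmetric U ->
  slice I U (u, v) -> slice I U (u, - v).
Proof.
have [I0 I1] := I_sphere.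
move=> sU; rewrite /slice => h.
pose I' : pv n := fun j => - I j.
have sI' : imag_sphere I'.
  split; first by rewrite /I' I0 Ropp_0.
  by rewrite -I1; apply: eq_bigr => j _; rewrite /I' -!Rsqr_pow2 -Rsqr_neg.
have := sU I I' u v I_sphere sI' h.
rewrite (_ : slice_pt I' (u, v) = slice_pt I (u, - v)) //.
by apply: functional_extensionality => j; rewrite /slice_pt /I' /=; ring.
Qed.

Lemma closure_slice_conj (U : pv n -> Prop) (u v : R) : axially_symmetric U ->
  closure_set (X := C_UniformSpace) (slice I U) (u, v) ->
  closure_set (X := C_UniformSpace) (slice I U) (u, - v).
Proof.
move=> sU h e; have [[y1 y2] [h1 h2]] := h e.
exists (y1, - y2); split; last exact: slice_conj.
have [/= k1 k2] := ballC_Rabs h1.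
split; first exact: k1.
change (Rabs (- y2 - - v) < e).
by rewrite (_ : - y2 - - v = - (y2 - v)) ?Rabs_Ropp //; ring.
Qed.

Lemma set_dist_disjoint (U S : pv n -> Prop) s : Rbar_lt 0 (set_dist U S) -> U s -> S s -> False.
Proof.
move=> h hU hS.
have [lb _] := Glb_Rbar_correct (fun d => exists x y, U x /\ S y /\ d = pv_norm (fun j => x j - y j)).
have h0 : pv_norm (fun j => s j - s j) = 0.
  rewrite /pv_norm big1 => [|j _]; first exact: sqrt_0.
  by rewrite Rminus_diag /=; rewrite Rmult_0_l.
have := lb 0 (ex_intro _ s (ex_intro _ s (conj hU (conj hS (esym h0))))).
by move=> h1; have := Rbar_lt_le_trans _ _ _ h h1; rewrite /=; lra.
Qed.

(** Distances of points of one plane C_I are those of C, so a point of the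
   closure of a slice is at distance 0 from the set. *)
Lemma set_dist_closure (U S : pv n -> Prop) (z : C) : Rbar_lt 0 (set_dist U S) ->
  closure_set (X := C_UniformSpace) (slice I U) z -> ~ S (slice_pt I z).
Proof.
move=> h hc hS.
have [lb _] := Glb_Rbar_correct (fun d => exists x y, U x /\ S y /\ d = pv_norm (fun j => x j - y j)).
have small e : 0 < e -> Rbar_le (set_dist U S) (Finite (e + e)).
  move=> e0; have [y [h1 h2]] := hc (mkposreal e e0).
  have [k1 k2] := ballC_Rabs h1.
  have := lb _ (ex_intro _ (slice_pt I y) (ex_intro _ (slice_pt I z) (conj h2 (conj hS erefl)))).
  move=> h3; apply: Rbar_le_trans h3 _; rewrite slice_pv_norm /=.
  apply: Rle_trans (Cmod_le1 _) _.
  change (Rabs (fst y - fst z) + Rabs (snd y - snd z) <= e + e); simpl in k1, k2; lra.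
move: h small; case: (set_dist U S) => [r| |] //= h small.
  by have := small (r / 4) ltac:(lra); lra.
by have := small 1 ltac:(lra).
Qed.

End Slices.

(** * Transport of contour integrals *)

Lemma is_contour_int_linear (U W : NormedModule R_AbsRing) (L : U -> W) m (Gam : 'I_m -> R -> C) f l :
  is_linear L -> is_contour_int Gam f l -> is_contour_int Gam (fun z dz => L (f z dz)) (L l).
Proof.
move=> hL [J [hJ ->]]; exists (fun j => L (J j)); split; first by move=> j; exact: is_RInt_linear.
exact: (big_morph L (linear_plus _ hL) (linear_zero _ hL)).
Qed.

Lemma is_contour_int_plus (W : NormedModule R_AbsRing) m (Gam : 'I_m -> R -> C) (f g : C -> C -> W) l k :
  is_contour_int Gam f l -> is_contour_int Gam g k ->
  is_contour_int Gam (fun z dz => plus (f z dz) (g z dz)) (plus l k).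
Proof.
move=> [J [hJ ->]] [J' [hJ' ->]]; exists (fun j => plus (J j) (J' j)); split.
  by move=> j; exact: is_RInt_plus.
by rewrite big_split.
Qed.

Lemma is_contour_int_ext (W : NormedModule R_AbsRing) m (Gam : 'I_m -> R -> C) (f g : C -> C -> W) l :
  (forall z dz, on_cycle Gam z -> f z dz = g z dz) ->
  is_contour_int Gam f l -> is_contour_int Gam g l.
Proof.
move=> e [J [hJ ->]]; exists J; split=> // j.
apply: is_RInt_ext (hJ j) => t; rewrite Rmin_left ?Rmax_right; try lra.
by move=> ht; apply: e; exists j, t; split; [lra | by []].
Qed.

Section Final.
Variables (V : CompleteNormedModule R_AbsRing) (n : nat) (T : BC01 V n).
Variables (I : pv n) (I_sphere : imag_sphere I).
Notation K := (bic_algebra T I_sphere).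
Notation A := (bic_square_sum T I_sphere).

Add Ring Kring : (cba_ring K).
Ltac kring := match goal with |- @eq _ ?x ?y => change (x = y :> K); ring end.

Hypothesis T_real : forall (l : 'I_n) (lam : C), spectrum (T (lift ord0 l)) lam -> Im lam = 0.
Hypothesis T0 : forall x : V, T ord0 x = zero.

Lemma F_spectrumE (z : C) : F_spectrum T (slice_pt I z) <-> ~ invertible (pencil A z).
Proof. by rewrite /F_spectrum (quad_op_slice I_sphere T0) invertibleP. Qed.

(** Spectral points are purely imaginary, so there - z is the conjugate of z
   and the symmetry conditions come from axial symmetry. *)
Lemma admissible_separates (G : pv n -> Prop) m (Gam : 'I_m -> R -> C) :
  admissible T G -> positive_boundary (slice I G) Gam ->
  (forall z, F_spectrum T (slice_pt I z) ->
     slice I G z \/ ~ closure_set (X := C_UniformSpace) (slice I G) z) ->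
  separates A Gam (slice I G) (fun z => ~ closure_set (X := C_UniformSpace) (slice I G) z).
Proof.
move=> [[_ [sG [oG _]]] bres] [[jc [_ bd]] [win wout]] spec.
have cyc z : on_cycle Gam z <-> boundary_set (X := C_UniformSpace) (slice I G) z by rewrite bd.
have imag z : ~ invertible (pencil A z) -> z = (0, snd z).
  move=> h; case: (Req_dec (fst z) 0) => [z0|z0]; first by rewrite -z0; case: (z).
  by case: h; exact: pencil_invertible.
have opp_imag z : z = (0, snd z) -> (- z)%C = (0, - snd z).
  by move=> ->; apply: injective_projections; rewrite /= ?Ropp_0.
have kern z w : ~ on_cycle Gam z -> on_cycle Gam w -> cauchy_kernel K z w = cx K (/ (w - z))%C.
  by move=> hz hw; apply: cauchy_kernelE => e; apply: hz; rewrite -e.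
have inn z : slice I G z -> ~ on_cycle Gam z by move=> hz /cyc; exact: slice_interior oG hz.
have outn z : ~ closure_set (X := C_UniformSpace) (slice I G) z -> ~ on_cycle Gam z.
  by move=> hz /cyc [].
split.
- by move=> j; have [] := jc j.
- by move=> j; have [_ []] := jc j.
- move=> p /cyc hp; apply: NNPP; rewrite -F_spectrumE.
  by apply: bres; exact: boundary_slice.
- by move=> z hz; apply: cycle_int_scalar (win z hz) _ => w hw; exact: kern (inn z hz) hw.
- move=> z hz; rewrite -cx0.
  by apply: cycle_int_scalar (wout z hz) _ => w hw; exact: kern (outn z hz) hw.
- move=> z0 hz0; have [d [d0 hd]] := open_slice I_sphere oG hz0.
  by exists d; split=> // z hz; split; [exact: hd | apply: inn; exact: hd].
- move=> z0 hz0; have [d [d0 hd]] := closure_slice_near hz0.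
  exists d; split=> // z hz; have h := hd z hz; split=> //; split; last exact: outn.
  by move=> h1; apply: h; exact: closure_sub.
- move=> z hz h; have e := imag z hz; rewrite (opp_imag z e).
  by apply: (slice_conj I_sphere sG); rewrite -e.
- move=> z hz h hc; have e := imag z hz; apply: h; rewrite (opp_imag z e) in hc.
  by have := closure_slice_conj I_sphere sG hc; rewrite Ropp_involutive -e.
by move=> z hz; apply: spec; apply/F_spectrumE.
Qed.

Lemma gamma_n_neq0 k : gamma_n k <> 0.
Proof.
rewrite /gamma_n; apply: Rmult_integral_contrapositive_currified;
  first apply: Rmult_integral_contrapositive_currified.
- by apply: pow_nonzero; lra.
- by apply: pow_nonzero; lra.
by apply: pow_nonzero; apply: not_0_INR => h; have := fact_gt0 k.-1./2; rewrite h.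
Qed.

Section Cycle.
Variables (m : nat) (Gam : 'I_m -> R -> C) (ins out : C -> Prop).
Hypothesis sep : separates A Gam ins out.
Hypothesis n_odd : odd n.

Let h := n.-1./2.

Lemma odd_index : n.-1 = h.*2 /\ n.+1./2 = h.+1.
Proof.
by rewrite /h; case: n n_odd => // k /= /even_halfK ->.
Qed.

(** The factor - iu comes from the differential dp_I = dp (- I). *)
Lemma main_integrals :
  is_contour_int (W := K) Gam (fun z dz =>
    (- iu) * (kpow (cx K z) n * kpow (pencil_inv A z) n.+1./2) * cx K dz)%K (- iu * int_pQ A Gam)%K /\
  is_contour_int (W := K) Gam (fun z dz =>
    (- iu) * (kpow (cx K z) n.-1 * kpow (pencil_inv A z) n.+1./2) * cx K dz)%K nul.
Proof.
have [e1 e2] := odd_index; have [C1 cl res _ _ _ _ _ _ _] := sep.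
have n1 : n = h.*2.+1 by rewrite -e1; by case: n n_odd.
have gen k l : is_contour_int (W := K) Gam (fun z dz =>
    (- iu) * (kpow (cx K z) k * kpow (pencil_inv A z) l) * cx K dz)%K (- iu * moment A Gam k l)%K.
  have hm := hol_cycle_moment res k l.
  rewrite -(cycle_int_mull C1 (- iu)%K hm); apply: is_contour_int_cycle => //.
  by apply: hol_cycle_mul hm; exact: hol_cycle_const.
split.
  have hv k l : k = h.*2.+1 -> l = h.+1 -> moment A Gam k l = int_pQ A Gam.
    by move=> -> ->; exact: moment_odd.
  by rewrite -(hv _ _ n1 e2); exact: gen.
have hv k l : k = h.*2 -> l = h.+1 -> moment A Gam k l = nul.
  by move=> -> ->; apply: moment_even => //; exact: int_Q_eq0 sep.
have := gen n.-1 n.+1./2; rewrite (hv _ _ e1 e2).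
by rewrite (_ : (- iu * nul)%K = nul) //; ring.
Qed.

(** The map [R'] stands for composition with the vector part of T on either
   side; the integral it is applied to vanishes. *)
Lemma contour_value (R' : K -> rop V n) f :
  is_linear (U := K) (V := rop_NormedModule V n) R' ->
  (forall z dz, invertible (pencil A z) -> f z dz = scal (gamma_n n)
    (plus (rop_of ((- iu) * (kpow (cx K z) n.-1.+1 * kpow (pencil_inv A z) n.+1./2) * cx K dz)%K)
       (R' ((- iu) * (kpow (cx K z) n.-1 * kpow (pencil_inv A z) n.+1./2) * cx K dz)%K))) ->
  exists J : rop V n, is_contour_int Gam f J /\
    rop_of (riesz_proj A Gam) = scal (/ (2 * PI * gamma_n n)) J.
Proof.
move=> hR hf; have [i1 i2] := main_integrals.
have [_ _ res _ _ _ _ _ _ _] := sep.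
have g0 := @gamma_n_neq0 n; have p0 := PI_RGT_0.
have nE : n.-1.+1 = n by case: n n_odd.
exists (scal (gamma_n n) (rop_of (- iu * int_pQ A Gam)%K)); split.
  have l1 : is_linear (fun S : rop V n => scal (gamma_n n) S).
    by apply: (is_linear_scal_r (K := R_AbsRing)) => x y; exact: Rmult_comm.
  have h1 := is_contour_int_linear (@rop_of_linear _ _ T I I_sphere) i1.
  have h2 := is_contour_int_linear hR i2.
  rewrite (linear_zero _ hR) in h2.
  have := is_contour_int_linear l1 (is_contour_int_plus h1 h2).
  rewrite plus_zero_r; apply: is_contour_int_ext => z dz /res hz.
  by rewrite hf // nE.
rewrite scal_assoc (_ : mult _ _ = / (2 * PI)); last by rewrite /mult /=; field; lra.
rewrite /riesz_proj -(linear_scal _ (@rop_of_linear _ _ T I I_sphere)); congr rop_of.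
change (cx K (/ (RtoC (2 * PI) * Ci))%C * int_pQ A Gam = sc (/ (2 * PI)) (- iu * int_pQ A Gam))%K.
rewrite scE (_ : (/ (RtoC (2 * PI) * Ci))%C = (0, - / (2 * PI))).
  by rewrite /cx [fst _]/= [snd _]/= sc0 scN (scE _ iu); kring.
by apply: injective_projections; rewrite /=; field; lra.
Qed.

End Cycle.

End Final.

Theorem theorem7p2 (V : CompleteNormedModule R_AbsRing) (n : nat)
  (n_gt3 : (3 < n)%N) (n_odd : odd n)
  (T : BC01 V n)
  (T0 : forall x : V, T ord0 x = zero)
  (T_real : forall (l : 'I_n) (lam : C),
     spectrum (T (lift ord0 l)) lam -> Im lam = 0)
  (sigma1 sigma2 : pv n -> Prop)
  (sigma_split : forall s : pv n, F_spectrum T s <-> sigma1 s \/ sigma2 s)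
  (sigma_dist : Rbar_lt 0 (set_dist sigma1 sigma2))
  (G1 G2 : pv n -> Prop)
  (G1_adm : admissible T G1) (G2_adm : admissible T G2)
  (sigma1_G1 : forall s : pv n, sigma1 s -> G1 s)
  (G1_G2 : forall s : pv n, closure_set (X := pv_space n) G1 s -> G2 s)
  (G2_dist : Rbar_lt 0 (set_dist G2 sigma2))
  (I : pv n) (I_sphere : imag_sphere I)
  (m1 : nat) (Gam1 : 'I_m1 -> R -> C)
  (Gam1_bd : positive_boundary (slice I G1) Gam1)
  (m2 : nat) (Gam2 : 'I_m2 -> R -> C)
  (Gam2_bd : positive_boundary (slice I G2) Gam2) :
  exists J1 J2 P : rop V n,
    is_contour_int Gam1 (left_integrand T I n.-1) J1 /\
    is_contour_int Gam2 (right_integrand T I n.-1) J2 /\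
    P = scal (/ (2 * PI * gamma_n n)) J1 /\
    P = scal (/ (2 * PI * gamma_n n)) J2 /\
    rop_comp P P = P.
Proof.
have in2 z : slice I G1 z -> slice I G2 z by move=> h; apply: G1_G2; exact: closure_sub.
have out1 z : sigma2 (slice_pt I z) -> ~ closure_set (X := C_UniformSpace) (slice I G1) z.
  move=> h hc; have := G1_G2 _ (closure_slice I_sphere hc) => h2.
  exact: set_dist_disjoint G2_dist h2 h.
have out2 z : sigma2 (slice_pt I z) -> ~ closure_set (X := C_UniformSpace) (slice I G2) z.
  by move=> h hc; apply: (set_dist_closure I_sphere G2_dist hc); exact: h.
have sep1 := admissible_separates I_sphere T_real T0 G1_adm Gam1_bd
  (fun z hz => match proj1 (sigma_split _) hz with
    or_introl h => or_introl (sigma1_G1 _ h) | or_intror h => or_intror (out1 z h) end).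
have sep2 := admissible_separates I_sphere T_real T0 G2_adm Gam2_bd
  (fun z hz => match proj1 (sigma_split _) hz with
    or_introl h => or_introl (in2 z (sigma1_G1 _ h)) | or_intror h => or_intror (out2 z h) end).
have [J1 [i1 p1]] := contour_value sep1 n_odd
  (is_linear_comp _ _ (@rop_of_linear _ _ T I I_sphere) (comp_linearl (vec_part T)))
  (fun z dz hz => left_integrandE T0 n.-1 dz hz).
have [J2 [i2 p2]] := contour_value sep2 n_odd
  (is_linear_comp _ _ (@rop_of_linear _ _ T I I_sphere) (comp_linearr (vec_part T)))
  (fun z dz hz => right_integrandE T0 n.-1 dz hz).
have uniq : int_pQ (bic_square_sum T I_sphere) Gam1 = int_pQ (bic_square_sum T I_sphere) Gam2.
  apply: int_pQ_unique sep1 sep2 _ => z /(F_spectrumE I_sphere T0) /sigma_split [h|h]; [left|right].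
    by split; [exact: sigma1_G1 | apply: in2; exact: sigma1_G1].
  by split; [exact: out1 | exact: out2].
exists J1, J2, (rop_of (riesz_proj (bic_square_sum T I_sphere) Gam1)); split=> //; split=> //; split=> //.
split; first by rewrite /riesz_proj uniq.
exact: (f_equal (@rop_of _ _ T I I_sphere) (riesz_proj_idempotent sep1)).
Qed.
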